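(* Let $p=O(1)$ as $n\to\infty$, $0<\alpha<p$, and $f_0\in\mathcal H^\alpha_p$ with $\|f_0\|_\infty\le F$. Let $L\asymp\log n$ and use the adaptive prior described in the context (which does not depend on $\alpha$). Then there is $\delta>1$ such that with $\xi_n=n^{-\alpha/(2\alpha+p)}\log^\delta n$, $$\Pi\big(f\in\mathcal F(L):\|f-f_0\|_L>M_n\xi_n\mid\bm Y^{(n)}\big)\to0$$ in $\mathbb P_0^n$-probability as $n\to\infty$, for every sequence $M_n\to\infty$.
   Context: Data: fixed covariates $\bm x_1,\dots,\bm x_n\in[0,1]^p$ and responses $Y_i=f_0(\bm x_i)+\epsilon_i$, $\epsilon_i$ i.i.d. $N(0,1)$; $\mathbb P_0^n$ is the law of $\bm Y^{(n)}=(Y_1,\dots,Y_n)$ under this model. $\mathcal H^\alpha_p$ denotes the $\alpha$-Hölder smooth functions on $[0,1]^p$. $\|g\|_L^2=\frac1n\sum_{i=1}^n g(\bm x_i)^2$. ReLU networks: for $L\in\mathbb N$ and $\mathbf p=(p_0,\dots,p_{L+1})$ with $p_0=p$, $p_{L+1}=1$, a network is $f(\bm x)=W_{L+1}\sigma_{b_L}(W_L\sigma_{b_{L-1}}(\cdots\sigma_{b_1}(W_1\bm x)))+b_{L+1}$, with $W_l\in\mathbb R^{p_l\times p_{l-1}}$, $b_l\in\mathbb R^{p_l}$ for $l\le L$, $b_{L+1}\in\mathbb R$, and $\sigma_b(v)=\max(v+b,0)$ componentwise. All parameters are stacked (layers from bottom to top) into $\beta=(\beta_1,\dots,\beta_T)$,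 $T=\sum_{l=0}^{L}p_{l+1}(p_l+1)$, so the last $p_L+1$ coordinates are the top-layer parameters $(W_{L+1},b_{L+1})$. $\mathcal F(L,\mathbf p,s)$ is the set of such networks with at most $s$ nonzero parameters and $\|f\|_\infty\le F$, for a fixed constant $F>0$. Prior (spike-and-slab with fully connected top layer), given $(L,\mathbf p,s)$: a connectivity vector $\gamma\in\{0,1\}^T$ has $\gamma_j=1$ for all $j>T-p_L-1$ and is uniformly distributed over all such vectors with $|\gamma|=s$. Given $\gamma$, independently: $\beta_j=0$ if $\gamma_j=0$; $\beta_j\sim\mathrm{Uniform}[-1,1]$ if $\gamma_j=1$ and $j\le T-p_L-1$; $\beta_j\sim N(0,1)$ if $j>T-p_L-1$; restricted to $\mathcal F(L,\mathbf p,s)$. Adaptive prior: the width parameter $N\in\{1,2,\dots\}$ has prior $\pi(N)=\lambda^N/((e^\lambda-1)N!)$ for a constant $\lambda>0$; given $N$ the widths are $\mathbf p^L_N=(p,12pN,\dots,12pN,1)\in\mathbb N^{L+2}$; the sparsity level $s$ has prior $\pi(s)\propto e^{-\lambda_s s}$ for a constant $\lambda_s>0$; given $(N,s)$ the network has the spike-and-slab prior above on $\mathcal F(L,\mathbf p_N^L,s)$. The parameter space is $\mathcal F(L)=\bigcup_{N\ge1}\bigcup_{s}\mathcal F(L,\mathbf p_N^L,s)$; $\Pi(\cdot\mid\bm Y^{(n)})$ is the posterior. *)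

(* Defs.v *)
From HB Require Import structures.
From mathcomp Require Import all_boot all_order all_algebra.
From mathcomp Require Import all_classical all_reals all_analysis.
Set Implicit Arguments. Unset Strict Implicit. Unset Printing Implicit Defensive.
Import Order.TTheory GRing.Theory Num.Theory.
Import numFieldNormedType.Exports.
Local Open Scope classical_set_scope.
Local Open Scope ring_scope.

Section BNN.
Variable R : realType.

Definition cube (p : nat) : set ('I_p -> R) :=
  [set x | forall i, 0 <= x i <= 1].

Definition dist_inf (p : nat) (x y : 'I_p -> R) : R :=
  \big[Num.max/0]_(i < p) `|x i - y i|.

Definition shift (p : nat) (x : 'I_p -> R) (j : 'I_p) (h : R) : 'I_p -> R :=
  fun i => if i == j then x i + h else x i.

Definition mabs (p : nat) (b : 'I_p -> nat) : nat := (\sum_(i < p) b i)%N.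
Definition mbump (p : nat) (b : 'I_p -> nat) (j : 'I_p) : 'I_p -> nat :=
  fun i => (b i + (i == j))%N.

(* Hoelder class H^alpha_p on [0,1]^p (Schmidt-Hieber convention):
   m = largest integer strictly smaller than alpha; g b = partial derivative
   d^b f (one-sided at the boundary, i.e. limits taken within the cube);
   all d^b f with |b| <= m bounded, and those with |b| = m are
   (alpha - m)-Hoelder w.r.t. the sup-norm, for some constant K. *)
Definition holder (p : nat) (alpha : R) (f : ('I_p -> R) -> R) : Prop :=
  exists (m : nat) (g : ('I_p -> nat) -> ('I_p -> R) -> R) (K : R),
    [/\ m%:R < alpha <= m.+1%:R,
        (forall x, cube x -> g (fun _ => 0%N) x = f x),
        (forall b j x, (mabs b < m)%N -> cube x ->
            (fun h => (g b (shift x j h) - g b x) / h)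
              @ within (fun h : R => cube (shift x j h)) (0 : R)^'
              --> g (mbump b j) x),
        (forall b x, (mabs b <= m)%N -> cube x -> `|g b x| <= K) &
        (forall b x y, mabs b = m -> cube x -> cube y ->
            `|g b x - g b y| <= K * powR (dist_inf x y) (alpha - m%:R))].

Definition dim (p w L k : nat) : nat :=
  if k == 0%N then p else if (k <= L)%N then w else 1%N.

(* parameter index set: layer l (0-based, l = 0..L, layer l maps
   p_l -> p_{l+1}), row i, and column j (Some j) or bias (None) *)
Definition Idx (p w L : nat) : finType :=
  {l : 'I_L.+1 & ('I_(dim p w L l.+1) * option 'I_(dim p w L l))%type}.

Definition top (p w L : nat) (k : Idx p w L) : bool := val (tag k) == L.

Definition par (p w L : nat) (th : Idx p w L -> R) (l i : nat) (j : option nat) : R :=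
  match (insub l : option 'I_L.+1) with
  | Some l' =>
    match (insub i : option 'I_(dim p w L l'.+1)) with
    | Some i' =>
      match j with
      | None => th (existT (fun l0 : 'I_L.+1 =>
                   ('I_(dim p w L l0.+1) * option 'I_(dim p w L l0))%type) l' (i', None))
      | Some j0 =>
        match (insub j0 : option 'I_(dim p w L l')) with
        | Some j' => th (existT (fun l0 : 'I_L.+1 =>
                   ('I_(dim p w L l0.+1) * option 'I_(dim p w L l0))%type) l' (i', Some j'))
        | None => 0
        end
      end
    | None => 0
    end
  | None => 0
  end.

Definition relu (t : R) : R := Num.max t 0.

Definition layer (p w L : nat) (th : Idx p w L -> R) (l : nat) (v : nat -> R) : nat -> R :=
  fun i => \sum_(j < dim p w L l) par th l i (Some (val j)) * v j + par th l i None.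

Fixpoint hid (p w L : nat) (th : Idx p w L -> R) (x : 'I_p -> R) (k : nat) : nat -> R :=
  match k with
  | 0%N => fun j => match (insub j : option 'I_p) with Some j' => x j' | None => 0 end
  | k'.+1 => fun i => relu (layer th k' (hid th x k') i)
  end.

Definition net (p w L : nat) (th : Idx p w L -> R) : ('I_p -> R) -> R :=
  fun x => layer th L (hid th x L) 0%N.

Definition supbdd (p w L : nat) (F : R) : set (Idx p w L -> R) :=
  [set th | forall x, cube x -> `|net th x| <= F].

Definition upd (I : eqType) (th : I -> R) (j : I) (t : R) : I -> R :=
  fun k => if k == j then t else th k.

Fixpoint iint (I : eqType) (js : seq I) (g : (I -> R) -> \bar R) (th : I -> R) : \bar R :=
  match js with
  | [::] => g th
  | j :: js' => (\int[@lebesgue_measure R]_t iint js' g (upd th j t))%E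
  end.

Definition gauss (t : R) : R := expR (- (t ^+ 2) / 2) / Num.sqrt (2 * pi).

Definition Gam (p w L s : nat) : {set {set Idx p w L}} :=
  [set G : {set Idx p w L} | [set k | top k] \subset G & #|G| == s].

(* density (w.r.t. Lebesgue on the coordinates of G) of beta | gamma = G *)
Definition sdens (p w L : nat) (G : {set Idx p w L}) (th : Idx p w L -> R) : R :=
  \prod_(k in G) (if top k then gauss (th k)
                  else 2^-1 * \1_(`[-1, 1]%classic) (th k)).

Definition cint (p w L : nat) (F : R) (G : {set Idx p w L})
    (h : (Idx p w L -> R) -> \bar R) : \bar R :=
  iint (enum G) (fun th => ((\1_(supbdd F) th * sdens G th)%:E * h th)%E) (fun _ => 0).

Definition cexp (p w L : nat) (F : R) (G : {set Idx p w L})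
    (h : (Idx p w L -> R) -> \bar R) : \bar R :=
  (cint F G h * ((fine (cint F G (fun _ => 1%E)))^-1)%:E)%E.

Definition width (p N : nat) : nat := (12 * p * N)%N.
Definition npar (p L N : nat) : nat := #|Idx p (width p N) L|.

Definition piN (lam : R) (N : nat) : R :=
  if N == 0%N then 0 else lam ^+ N / ((expR lam - 1) * (N`!)%:R).

Definition piS (p L : nat) (lams : R) (N s : nat) : R :=
  if ((width p N).+1 <= s <= npar p L N)%N then
    expR (- lams * s%:R) /
      \sum_((width p N).+1 <= s' < (npar p L N).+1) expR (- lams * s'%:R)
  else 0.

Definition prior_int (p L : nat) (lam lams F : R)
    (H : (('I_p -> R) -> R) -> \bar R) : \bar R :=
  (\sum_(N <oo) (piN lam N)%:E *
     \sum_(s < (npar p L N).+1) (piS p L lams N s)%:E *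
       \sum_(G in Gam p (width p N) L s)
          ((#|Gam p (width p N) L s|%:R)^-1)%:E *
          cexp F G (fun th => H (net th)))%E.

Definition emp_norm (p n : nat) (X : 'I_n -> 'I_p -> R) (g : ('I_p -> R) -> R) : R :=
  Num.sqrt (n%:R^-1 * \sum_(i < n) (g (X i)) ^+ 2).

Definition lik (p n : nat) (X : 'I_n -> 'I_p -> R) (Y : 'I_n -> R)
    (f : ('I_p -> R) -> R) : R :=
  expR (- 2^-1 * \sum_(i < n) (Y i - f (X i)) ^+ 2).

Definition posterior (p L n : nat) (lam lams F : R) (X : 'I_n -> 'I_p -> R)
    (A : set (('I_p -> R) -> R)) (Y : 'I_n -> R) : R :=
  fine (prior_int L lam lams F (fun f => (\1_A f * lik X Y f)%:E)) /
  fine (prior_int L lam lams F (fun f => (lik X Y f)%:E)).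

(* P_0^n(E): Y_i = f0(x_i) + eps_i, eps_i iid N(0,1) *)
Definition P0 (p n : nat) (X : 'I_n -> 'I_p -> R) (f0 : ('I_p -> R) -> R)
    (E : set ('I_n -> R)) : \bar R :=
  iint (enum 'I_n)
    (fun Y => (\1_E Y * \prod_(i < n) gauss (Y i - f0 (X i)))%:E) (fun _ => 0).

End BNN.

(* Main.v *)
Require Import Defs.
From HB Require Import structures.
From mathcomp Require Import all_boot all_order all_algebra.
From mathcomp Require Import all_classical all_reals all_analysis.
From mathcomp Require Import measurable_realfun ring lra zify.
Set Implicit Arguments. Unset Strict Implicit. Unset Printing Implicit Defensive.
Import Order.TTheory GRing.Theory Num.Theory.
Import numFieldNormedType.Exports.
Local Open Scope classical_set_scope.
Local Open Scope ring_scope.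

(** The posterior probability is estimated directly as a quotient of two prior integrals of the
    likelihood. Write l for log n up to rounding, q for n^(1/(2 alpha + p)) up to rounding, and K =
    q^p, so that n q^(-2 alpha) is at most K: squared bias and model size balance.

    Approximation. The likelihood and the empirical norm see only the design points, so [f0] has to
    be approximated only there. The cube is cut into K cells whose separating thresholds are moved
    into gaps between design points (a pigeonhole argument, [thresholds]). Steep ReLU ramps then
    identify the cell of every design point exactly ([cellf_val]), so Taylor coefficients can be
    stored in a lookup table ([cheap_cell]). Products reduce to squares, and a square is a Riemann
    sum of K ReLUs with error O(1/K) ([cheap_sqr]). This accuracy suffices because alpha < p gives
    1/K = q^(-p) <= q^(-alpha). The outcome is [net_approx]: networks of every sufficiently large
    depth L, with O(K L) nonzero parameters and with sum of squared errors O(K) over the design.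

    Denominator. Networks are Lipschitz in their parameters with constant exp(O(l^2)). A box of side
    exp(-O(l^2)) around the approximating parameters therefore consists of good networks, and
    together with the prior weights of the width, the sparsity level and the pattern it has prior
    mass at least exp(-O(K l^3)) ([prior_mass], [mass_lb]).

    Numerator. Parameters with width index and sparsity O(K l^3) and top weights at most n are
    rounded to a grid of exp(O(K l^5)) points. Chernoff bounds at all grid points hold
    simultaneously with high probability, and then every such network with sum of squares at least D
    has likelihood ratio at most exp(-D/8 + O(K l^5)) ([lik_upper], [numerator_le]). The other
    parameters have a prior mass that stays small after division by the denominator bound
    ([bad_mass], [rho_le]), and Fubini turns this mass into a bound on the mean of their likelihood
    ([mean_rest]).

    [posterior_bound] combines the three. The exceptional noise events are encoded by one
    nonnegative function with small mean, so a single pointwise domination does the work of the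
    union bound and of Markov's inequality. With delta = 3, D = n xi_n^2 has order K l^6 and
    dominates K l^5; the resulting probability is O(exp(-l)), hence O(1/n). *)

(** * Iterated Lebesgue integrals over finitely many coordinates: monotonicity, Tonelli, products *)

Section IteratedIntegral.
Context {R : realType}.
Local Notation mu := (@lebesgue_measure R).
Local Open Scope ereal_scope.

(** No measurability is assumed, since the integral of a nonnegative function is a supremum over
    simple functions below it. This matters because the posterior events are never shown to be
    measurable. *)
Lemma ge0_le_integralT d (T : measurableType d) (m : {measure set T -> \bar R})
    (f g : T -> \bar R) :
  (forall x, 0 <= f x) -> (forall x, f x <= g x) ->
  \int[m]_x f x <= \int[m]_x g x.
Proof.
move=> f0 fg; have g0 x : 0 <= g x by exact: le_trans (f0 x) (fg x).
rewrite !ge0_integralTE//; apply: le_ereal_sup => _ [h hf <-].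
by exists h => // x; apply: le_trans (hf x) (fg x).
Qed.

(* Measurability for the product sigma-algebra on [I -> R], tested on measurable families of coordinates. *)
Definition tmeas (I : eqType) (g : (I -> R) -> \bar R) : Prop :=
  forall d (T : measurableType d) (u : T -> I -> R),
    (forall i, measurable_fun [set: T] (fun t => u t i)) ->
    measurable_fun [set: T] (fun t => g (u t)).

Lemma measurable_upd (I : eqType) d (T : measurableType d) (u : T -> I -> R) j i :
  (forall i, measurable_fun [set: T] (fun t => u t i)) ->
  measurable_fun [set: T * measurableTypeR R] (fun z => upd (u z.1) j z.2 i).
Proof.
move=> mu_; rewrite /upd; case: eqP => _; first exact: measurable_snd.
exact: (measurableT_comp (mu_ i) measurable_fst).
Qed.

Lemma measurable_upd1 (I : eqType) (th : I -> R) j i :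
  measurable_fun [set: measurableTypeR R] (fun t => upd th j t i).
Proof. by rewrite /upd; case: eqP => _; [exact: measurable_id|exact: measurable_cst]. Qed.

Lemma iint_ge0 (I : eqType) js (g : (I -> R) -> \bar R) th :
  (forall th, 0 <= g th) -> 0 <= iint js g th.
Proof.
by move=> g0; elim: js th => [|j js IH] th //=; apply: integral_ge0 => t _; exact: IH.
Qed.

(** Only the coordinates in [js] are integrated; the others stay frozen at [th], so the comparison
    is needed only there. This is how vanishing off the pattern [G] is retained under the
    integral. *)
Lemma iint_le (I : eqType) js (g g' : (I -> R) -> \bar R) th :
  (forall th, 0 <= g th) ->
  (forall th', (forall k, k \notin js -> th' k = th k) -> g th' <= g' th') ->
  iint js g th <= iint js g' th.
Proof.
move=> g0; elim: js th => [|j js IH] th gg' /=; first exact: gg'.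
apply: ge0_le_integralT => [t|t]; first exact: iint_ge0.
apply: IH => th' H; apply: gg' => k; rewrite inE negb_or => /andP[kj kjs].
by rewrite H// /upd (negbTE kj).
Qed.

(** The quantification of [tmeas] over all parameter spaces [T] makes this induction close: the
    integrated variable is adjoined to [T], and Tonelli on the product removes it again. *)
Lemma tmeas_iint (I : eqType) js (g : (I -> R) -> \bar R) :
  (forall th, 0 <= g th) -> tmeas g -> tmeas (iint js g).
Proof.
move=> g0 mg; elim: js => [|j js IH] //= d T u mu_.
pose f := fun z : T * measurableTypeR R => iint js g (upd (u z.1) j z.2).
apply: (@measurable_fun_fubini_tonelli_F _ _ _ _ _ mu f).
- by apply: IH => i; exact: measurable_upd.
- by move=> z; exact: iint_ge0.
Qed.

Lemma tmeas_iint_upd (I : eqType) js (g : (I -> R) -> \bar R) j th :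
  (forall th, 0 <= g th) -> tmeas g ->
  measurable_fun [set: measurableTypeR R] (fun t => iint js g (upd th j t)).
Proof.
by move=> g0 mg; apply: (tmeas_iint js g0 mg) => i; exact: measurable_upd1.
Qed.

Lemma iintD (I : eqType) js (g h : (I -> R) -> \bar R) th :
  (forall th, 0 <= g th) -> (forall th, 0 <= h th) -> tmeas g -> tmeas h ->
  iint js (fun x => g x + h x) th = iint js g th + iint js h th.
Proof.
move=> g0 h0 mg mh; elim: js th => [|j js IH] th //=.
rewrite -ge0_integralD//.
- by apply: eq_integral => t _; exact: IH.
- by move=> t _; exact: iint_ge0.
- exact: tmeas_iint_upd.
- by move=> t _; exact: iint_ge0.
- exact: tmeas_iint_upd.
Qed.

Lemma iintZl (I : eqType) js (c : \bar R) (g : (I -> R) -> \bar R) th :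
  0 <= c -> (forall th, 0 <= g th) -> tmeas g ->
  iint js (fun x => c * g x) th = c * iint js g th.
Proof.
move=> c0 g0 mg; elim: js th => [|j js IH] th //=.
rewrite -ge0_integralZl//.
- by apply: eq_integral => t _; exact: IH.
- exact: tmeas_iint_upd.
- by move=> t _; exact: iint_ge0.
Qed.

Lemma iint_cst0 (I : eqType) js (th : I -> R) : iint js (fun=> 0) th = 0.
Proof. by elim: js th => [|j js IH] th //=; apply: integral0_eq => t _; exact: IH. Qed.

Lemma eq_iint (I : eqType) js (g h : (I -> R) -> \bar R) th :
  (forall th, g th = h th) -> iint js g th = iint js h th.
Proof. by move=> gh; congr (iint js _ th); apply/funext. Qed.

Lemma iint_series (I : eqType) js (g : nat -> (I -> R) -> \bar R) th :
  (forall k th, 0 <= g k th) -> (forall k, tmeas (g k)) ->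
  iint js (fun x => \sum_(k <oo) g k x) th = \sum_(k <oo) iint js (g k) th.
Proof.
move=> g0 mg; elim: js th => [|j js IH] th //=.
under eq_integral do rewrite IH.
rewrite integral_nneseries// => k; first exact: tmeas_iint_upd.
by move=> t _; exact: iint_ge0.
Qed.

Lemma tmeasD (I : eqType) (g h : (I -> R) -> \bar R) :
  tmeas g -> tmeas h -> tmeas (fun x => g x + h x).
Proof. by move=> mg mh d T u mu_; apply: emeasurable_funD; [exact: mg|exact: mh]. Qed.

Lemma tmeasM (I : eqType) (g h : (I -> R) -> \bar R) :
  tmeas g -> tmeas h -> tmeas (fun x => g x * h x).
Proof. by move=> mg mh d T u mu_; apply: emeasurable_funM; [exact: mg|exact: mh]. Qed.

Lemma tmeas_cst (I : eqType) c : tmeas (fun _ : I -> R => c).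
Proof. by move=> d T u mu_; exact: measurable_cst. Qed.

Lemma tmeas_sum (I : eqType) (J : Type) (s : seq J) (P : pred J) (g : J -> (I -> R) -> \bar R) :
  (forall j, tmeas (g j)) -> tmeas (fun x => \sum_(j <- s | P j) g j x).
Proof.
move=> mg; elim: s => [|j s IH] d T u mu_.
  by under eq_fun do rewrite big_nil; exact: measurable_cst.
under eq_fun do rewrite big_cons; case: (P j); last exact: IH.
by apply: emeasurable_funD; [exact: mg|exact: IH].
Qed.

Lemma tmeas_series (I : eqType) (g : nat -> (I -> R) -> \bar R) :
  (forall k th, 0 <= g k th) -> (forall k, tmeas (g k)) ->
  tmeas (fun x => \sum_(k <oo) g k x).
Proof.
move=> g0 mg d T u mu_; apply: ge0_emeasurable_sum => [k t _ _|k _]; first exact: g0.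
exact: mg.
Qed.

Lemma iint_sum (I : eqType) (J : Type) (s : seq J) (P : pred J) js
    (g : J -> (I -> R) -> \bar R) th :
  (forall j th, 0 <= g j th) -> (forall j, tmeas (g j)) ->
  iint js (fun x => \sum_(j <- s | P j) g j x) th = \sum_(j <- s | P j) iint js (g j) th.
Proof.
move=> g0 mg; elim: s => [|j s IH].
  by rewrite big_nil -[RHS](iint_cst0 js th); apply: eq_iint => x; rewrite big_nil.
rewrite big_cons; under eq_iint do rewrite big_cons.
case: (P j) => //; rewrite iintD// ?IH//; last exact: tmeas_sum.
by move=> x; exact: sume_ge0.
Qed.

Lemma iint_Fubini1 (I : eqType) js (g : R -> (I -> R) -> \bar R) th :
  (forall t x, 0 <= g t x) ->
  (forall d (T : measurableType d) (v : T -> R) (u : T -> I -> R),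
    measurable_fun [set: T] v -> (forall i, measurable_fun [set: T] (fun t => u t i)) ->
    measurable_fun [set: T] (fun t => g (v t) (u t))) ->
  \int[mu]_t iint js (g t) th = iint js (fun x => \int[mu]_t g t x) th.
Proof.
move=> g0 mg; elim: js th => [|j js IH] th //=.
transitivity (\int[mu]_t \int[mu]_s iint js (g s) (upd th j t)); last first.
  by apply: eq_integral => t _; exact: IH.
pose f := fun z : measurableTypeR R * measurableTypeR R => iint js (g z.1) (upd th j z.2).
apply: (@fubini_tonelli _ _ _ _ _ mu mu f); last by move=> z; exact: iint_ge0.
rewrite /f => {f IH}.
have : forall d (T : measurableType d) (v : T -> R) (u : T -> I -> R),
    measurable_fun [set: T] v -> (forall i, measurable_fun [set: T] (fun t => u t i)) ->
    measurable_fun [set: T] (fun t => iint js (g (v t)) (u t)).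
  elim: js => [|k js IH] //= d T v u mv mu_.
  pose f := fun z : T * measurableTypeR R => iint js (g (v z.1)) (upd (u z.1) k z.2).
  apply: (@measurable_fun_fubini_tonelli_F _ _ _ _ _ mu f).
  - apply: IH => [|i]; last exact: measurable_upd.
    by apply: measurableT_comp => //; exact: measurable_fst.
  - by move=> z; exact: iint_ge0.
apply => [|i]; first exact: measurable_fst.
rewrite /upd; case: eqP => _; first exact: measurable_snd.
exact: measurable_cst.
Qed.

Definition tmeas2 (I J : eqType) (g : (I -> R) -> (J -> R) -> \bar R) : Prop :=
  forall d (T : measurableType d) (u : T -> I -> R) (v : T -> J -> R),
    (forall i, measurable_fun [set: T] (fun t => u t i)) ->
    (forall j, measurable_fun [set: T] (fun t => v t j)) ->
    measurable_fun [set: T] (fun t => g (u t) (v t)).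

Lemma tmeas2_swap (I J : eqType) (g : (I -> R) -> (J -> R) -> \bar R) :
  tmeas2 g -> tmeas2 (fun y x => g x y).
Proof. by move=> mg d T u v mu_ mv; exact: mg. Qed.

Lemma tmeas2_iint (I J : eqType) js (g : (I -> R) -> (J -> R) -> \bar R) :
  (forall x y, 0 <= g x y) -> tmeas2 g ->
  tmeas2 (fun x => iint js (g x)).
Proof.
move=> g0 mg; elim: js => [|j js IH] //= d T u v mu_ mv.
pose f := fun z : T * measurableTypeR R => iint js (g (u z.1)) (upd (v z.1) j z.2).
apply: (@measurable_fun_fubini_tonelli_F _ _ _ _ _ mu f).
- apply: IH => i; last exact: measurable_upd.
  exact: (measurableT_comp (mu_ i) measurable_fst).
- by move=> z; exact: iint_ge0.
Qed.

(** Needed to exchange the integral over the noise with the integral over the network parameters. *)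
Lemma iint_Fubini (I J : eqType) is_ js (g : (I -> R) -> (J -> R) -> \bar R) x0 y0 :
  (forall x y, 0 <= g x y) -> tmeas2 g ->
  iint is_ (fun x => iint js (g x) y0) x0 = iint js (fun y => iint is_ (g^~ y) x0) y0.
Proof.
move=> g0 mg; elim: is_ x0 => [|i is_ IH] x0 //=.
under eq_integral do rewrite IH.
rewrite (@iint_Fubini1 _ js (fun t y => iint is_ (g^~ y) (upd x0 i t)))//.
- by move=> t y; exact: iint_ge0.
- move=> d T v u mv mu_.
  apply: (@tmeas2_iint _ _ is_ (fun y x => g x y) (fun y x => g0 x y) (tmeas2_swap mg)) => //.
  by move=> k; rewrite /upd; case: eqP => _ //; exact: measurable_cst.
Qed.

Lemma iint_prod (I : eqType) js (phi : I -> R -> R) (c : I -> R) th :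
  uniq js -> (forall k, measurable_fun [set: R] (phi k)) -> (forall k t, (0 <= phi k t)%R) ->
  (forall k, k \in js -> \int[mu]_t (phi k t)%:E = (c k)%:E) ->
  iint js (fun x => (\prod_(k <- js) phi k (x k))%:E) th = (\prod_(k <- js) c k)%:E.
Proof.
move=> + mphi phi0.
(* Strengthened by a factor [a] that depends only on coordinates outside [js]: in the induction, the
   factor of the head coordinate is absorbed into [a]. *)
suff H : forall (a : (I -> R) -> R), uniq js ->
   (forall k, k \in js -> \int[mu]_t (phi k t)%:E = (c k)%:E) ->
   (forall x, 0 <= a x)%R ->
   (forall x y, (forall k, k \notin js -> x k = y k) -> a x = a y) ->
  iint js (fun x => (a x * \prod_(k <- js) phi k (x k))%:E) th = (a th * \prod_(k <- js) c k)%:E.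
  move=> ujs ic; rewrite -[in RHS](mul1r (\prod_(k <- js) c k)%R).
  rewrite -(H (fun=> 1%R))//; apply: eq_iint => x; by rewrite mul1r.
elim: js th => [|j js IH] th a /=; first by rewrite !big_nil.
move=> /andP[jjs ujs] ic a0 aE; rewrite big_cons.
transitivity (\int[mu]_t ((a th * \prod_(k <- js) c k)%:E * (phi j t)%:E)).
  apply: eq_integral => t _.
  under eq_iint do rewrite big_cons mulrA.
  rewrite (IH (upd th j t) (fun x => (a x * phi j (x j))%R) ujs).
  - have -> : a (upd th j t) = a th.
      by apply: aE => k; rewrite inE negb_or /upd => /andP[/negbTE ->].
    by rewrite {1}/upd eqxx -EFinM mulrAC.
  - by move=> k kjs; apply: ic; rewrite inE kjs orbT.
  - by move=> x; rewrite mulr_ge0.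
  - move=> x y xy; rewrite (aE x y) ?(xy j)// => k; rewrite inE negb_or => /andP[_]; exact: xy.
rewrite ge0_integralZl//.
- by rewrite ic ?mem_head// -EFinM mulrCA mulrC.
- by apply/measurable_EFinP; exact: mphi.
- by move=> t _; rewrite lee_fin.
- rewrite lee_fin mulr_ge0// big_seq; apply: prodr_ge0 => k kjs.
  rewrite -lee_fin -ic ?inE ?kjs ?orbT//.
  by apply: integral_ge0 => t _; rewrite lee_fin.
Qed.

End IteratedIntegral.

(** * Gaussian and uniform densities: exponential moments and tails *)

Section Gaussian.
Context {R : realType}.
Local Notation mu := (@lebesgue_measure R).
Implicit Types (t m c : R).

Lemma gauss_ge0 t : 0 <= gauss t.
Proof. by rewrite /gauss divr_ge0 ?expR_ge0 ?sqrtr_ge0. Qed.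

Lemma sqrt2pi_gt0 : 0 < Num.sqrt (2 * pi) :> R.
Proof. by rewrite sqrtr_gt0 mulr_gt0// pi_gt0. Qed.

Lemma gauss_gt0 t : 0 < gauss t.
Proof. by rewrite /gauss divr_gt0 ?expR_gt0 ?sqrt2pi_gt0. Qed.

Lemma gauss_normal_pdf t m : gauss (t - m) = normal_pdf m 1 t.
Proof.
rewrite normal_pdfE ?oner_neq0// /normal_peak /normal_fun /gauss mulrC expr1n mul1r.
by rewrite -(mulr_natl pi 2) -[1 *+ 2]/(2 : R).
Qed.

Lemma measurable_gauss : measurable_fun [set: R] (@gauss R).
Proof.
have -> : @gauss R = normal_pdf 0 1 by apply/funext => t; rewrite -gauss_normal_pdf subr0.
exact: measurable_normal_pdf.
Qed.

Lemma measurable_gauss_shift m : measurable_fun [set: R] (fun t => gauss (t - m)).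
Proof.
have -> : (fun t => gauss (t - m)) = normal_pdf m 1 by apply/funext => t; rewrite gauss_normal_pdf.
exact: measurable_normal_pdf.
Qed.

Lemma integral_gauss m : (\int[mu]_t (gauss (t - m))%:E = 1)%E.
Proof.
under eq_integral do rewrite gauss_normal_pdf.
by rewrite integral_normal_pdf ?oner_neq0.
Qed.

Lemma gauss_tilt t c : gauss t * expR (c * t) = expR (c ^+ 2 / 2) * gauss (t - c).
Proof.
rewrite /gauss mulrAC mulrA -!expRD; congr (expR _ / _); by field.
Qed.

Lemma integral_gauss_tilt m c :
  (\int[mu]_t (gauss (t - m) * expR (c * (t - m)))%:E = (expR (c ^+ 2 / 2))%:E)%E.
Proof.
under eq_integral => t _ do rewrite gauss_tilt -addrA -opprD EFinM.
rewrite ge0_integralZl//; last 2 first.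
- by apply/measurable_EFinP; exact: measurable_gauss_shift.
- by move=> t _; rewrite lee_fin gauss_ge0.
by rewrite integral_gauss mule1.
Qed.

Lemma gauss_lb b t : `|t| <= b -> expR (- b ^+ 2 / 2) / Num.sqrt (2 * pi) <= gauss t.
Proof.
move=> tb; rewrite /gauss ler_pM2r ?invr_gt0 ?sqrt2pi_gt0// ler_expR ler_pM2r// lerN2.
by rewrite -real_normK ?num_real// ler_sqr ?nnegrE// (le_trans _ tb).
Qed.

(** Chernoff: the indicator of |t| > b is at most exp(-b^2) (exp(b t) + exp(-b t)), and each
    exponential has Gaussian mean exp(b^2/2). *)
Lemma integral_gauss_tail (b : R) : 0 <= b ->
  (\int[mu]_t (gauss t * (b < `|t|)%R%:R)%:E <= (2 * expR (- b ^+ 2 / 2))%:E)%E.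
Proof.
move=> b0.
have E (c : R) : (\int[mu]_t (expR (- b ^+ 2) * (gauss t * expR (c * t)))%:E =
    (expR (- b ^+ 2) * expR (c ^+ 2 / 2))%:E)%E.
  under eq_integral => t _ do rewrite EFinM.
  rewrite ge0_integralZl ?lee_fin ?expR_ge0//.
  - rewrite EFinM -(integral_gauss_tilt 0 c); congr (_ * _)%E.
    by apply: eq_integral => t _; rewrite subr0.
  - apply/measurable_EFinP; apply: measurable_funM; first exact: measurable_gauss.
    by apply: measurableT_comp => //; exact: measurable_funM.
  - by move=> t _; rewrite lee_fin mulr_ge0 ?gauss_ge0 ?expR_ge0.
apply: (@le_trans _ _ (\int[mu]_t ((expR (- b ^+ 2) * (gauss t * expR (b * t)))%:E +
   (expR (- b ^+ 2) * (gauss t * expR ((- b) * t)))%:E)))%E.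
  apply: ge0_le_integralT => t; first by rewrite lee_fin mulr_ge0 ?gauss_ge0.
  rewrite -EFinD lee_fin -mulrDr -mulrDr mulrCA ler_wpM2l ?gauss_ge0//.
  rewrite mulrDr -!expRD; case: ltP => [bt|_]; last by rewrite addr_ge0 ?expR_ge0.
  have [t0|t0] := lerP 0 t.
    rewrite (le_trans _ (_ : expR (- b ^+ 2 + b * t) <= _)) ?lerDl ?expR_ge0//.
    rewrite -[leLHS]expR0 ler_expR; rewrite ger0_norm// in bt; nra.
  rewrite (le_trans _ (_ : expR (- b ^+ 2 + (- b) * t) <= _)) ?lerDr ?expR_ge0//.
  rewrite -[leLHS]expR0 ler_expR; rewrite ltr0_norm// in bt; nra.
have mE (c : R) : measurable_fun [set: R] (fun t => (expR (- b ^+ 2) * (gauss t * expR (c * t)))%:E).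
  apply/measurable_EFinP; apply: measurable_funM => //; apply: measurable_funM.
    exact: measurable_gauss.
  by apply: measurableT_comp => //; exact: measurable_funM.
have E0 (c : R) t : (0 <= (expR (- b ^+ 2) * (gauss t * expR (c * t)))%:E)%E.
  by rewrite lee_fin !mulr_ge0 ?gauss_ge0 ?expR_ge0.
rewrite ge0_integralD; [|exact: measurableT|by move=> *; exact: E0|exact: mE|by move=> *; exact: E0|exact: mE].
rewrite !E -EFinD lee_fin sqrrN -expRD.
have -> : - b ^+ 2 + b ^+ 2 / 2 = - b ^+ 2 / 2 by field.
lra.
Qed.

Definition udens t : R := 2^-1 * \1_(`[-1, 1]%classic) t.

Lemma udens_ge0 t : 0 <= udens t.
Proof. by rewrite /udens mulr_ge0. Qed.

Lemma measurable_udens : measurable_fun [set: R] udens.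
Proof. by apply: measurable_funM => //; exact: measurable_indic. Qed.

Lemma integral_udens : (\int[mu]_t (udens t)%:E = 1)%E.
Proof.
under eq_integral do rewrite /udens EFinM.
rewrite ge0_integralZl; [|exact: measurableT|
  by apply/measurable_EFinP; exact: measurable_indic|by move=> t _; rewrite lee_fin|by rewrite lee_fin].
rewrite integral_indic// setIT.
rewrite [X in (_ * X)%E](_ : _ = (2 : R)%:E).
  by rewrite -EFinM mulVf.
apply: etrans; first exact: (lebesgue_measure_itv `[(-1 : R), 1]).
rewrite /= lte_fin ltrNl (@lt_trans _ _ 0)//.
by rewrite -EFinD; congr (_%:E); lra.
Qed.

(** Every exponential moment in the union bound over exceptional noise events comes from this
    identity. *)
Lemma gauss_mgf n (m c : 'I_n -> R) Y0 :
  iint (enum 'I_n) (fun Y => (\prod_(i < n) gauss (Y i - m i) *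
      expR (\sum_(i < n) c i * (Y i - m i)))%:E) Y0 =
  (expR (\sum_(i < n) c i ^+ 2 / 2))%:E.
Proof.
transitivity (iint (enum 'I_n) (fun Y => (\prod_(i <- enum 'I_n)
    (fun t => gauss (t - m i) * expR (c i * (t - m i))) (Y i))%:E) Y0).
  by apply: eq_iint => Y; rewrite expR_sum -big_split/= big_enum.
rewrite (iint_prod (phi := fun i t => gauss (t - m i) * expR (c i * (t - m i))) (c := fun i => expR (c i ^+ 2 / 2))) ?enum_uniq//.
- by rewrite big_enum/= expR_sum.
- move=> i; apply: measurable_funM; first exact: measurable_gauss_shift.
  apply: measurableT_comp => //; apply: measurable_funM => //.
  exact: measurable_funB.
- by move=> i t; rewrite mulr_ge0 ?gauss_ge0 ?expR_ge0.
- by move=> i _; exact: integral_gauss_tilt.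
Qed.

Lemma iint_gauss n (m : 'I_n -> R) Y0 :
  (iint (enum 'I_n) (fun Y => (\prod_(i < n) gauss (Y i - m i))%:E) Y0 = 1)%E.
Proof.
have := gauss_mgf m (fun=> 0) Y0.
rewrite [in RHS]big1 ?expR0 => [<-|i _]; last by rewrite expr0n mul0r.
apply: eq_iint => Y; rewrite [X in expR X]big1 ?expR0 ?mulr1// => i _; by rewrite mul0r.
Qed.

End Gaussian.

(** * Size, Lipschitz dependence and measurability of networks *)

Section NetBounds.
Context {R : realType}.
Variables p w L : nat.
Implicit Types (th : Idx p w L -> R) (x : 'I_p -> R).

Lemma par_le (th : Idx p w L -> R) (B : R) l i j : 0 <= B ->
  (forall k, `|th k| <= B) -> `|par th l i j| <= B.
Proof.
move=> B0 thB; rewrite /par.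
case: insub => [l'|]; last by rewrite normr0.
case: insub => [i'|]; last by rewrite normr0.
case: j => [j0|]; last exact: thB.
by case: insub => [j'|]; rewrite ?normr0.
Qed.

Lemma par_dist (th th' : Idx p w L -> R) (B : R) l i j : 0 <= B ->
  (forall k, `|th k - th' k| <= B) -> `|par th l i j - par th' l i j| <= B.
Proof.
move=> B0 thB; rewrite /par.
case: insub => [l'|]; last by rewrite subrr normr0.
case: insub => [i'|]; last by rewrite subrr normr0.
case: j => [j0|]; last exact: thB.
by case: insub => [j'|]; rewrite ?subrr ?normr0.
Qed.

Lemma dim_leq_width l : (p <= w)%N -> (0 < w)%N -> (Defs.dim p w L l <= w)%N.
Proof. by move=> pw w0; rewrite /Defs.dim; case: (l == 0)%N => //; case: ifP. Qed.

Lemma relu_lip (a b : R) : `|relu a - relu b| <= `|a - b|.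
Proof.
rewrite /relu; case: (lerP a 0) => a0; case: (lerP b 0) => b0.
- by rewrite subrr normr0.
- by rewrite sub0r normrN (ger0_norm (ltW b0)) ler0_norm; lra.
- by rewrite subr0 (ger0_norm (ltW a0)) ger0_norm; lra.
- by [].
Qed.

Lemma relu_ge0 (a : R) : 0 <= relu a.
Proof. by rewrite /relu le_max lexx orbT. Qed.

Lemma relu_id (a : R) : 0 <= a -> relu a = a.
Proof. by move=> a0; rewrite /relu max_l. Qed.

Lemma relu_0 (a : R) : a <= 0 -> relu a = 0.
Proof. by move=> a0; rewrite /relu max_r. Qed.

Lemma layer_le th l (v : nat -> R) (B V : R) i :
  (p <= w)%N -> (0 < w)%N -> 0 <= B -> 1 <= V ->
  (forall k, `|th k| <= B) -> (forall j, `|v j| <= V) ->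
  `|layer th l v i| <= (w%:R + 1) * B * V.
Proof.
move=> pw w0 B0 V1 thB vV; rewrite /layer.
apply: (le_trans (ler_normD _ _)).
rewrite mulrAC mulrDl mul1r mulrDl; apply: lerD.
  apply: (le_trans (ler_norm_sum _ _ _)).
  apply: (@le_trans _ _ (\sum_(j < Defs.dim p w L l) (V * B))).
    apply: ler_sum => j _; rewrite normrM mulrC ler_pM// ?par_le//.
  rewrite sumr_const card_ord -[leLHS]mulr_natl -mulrA ler_wpM2r ?mulr_ge0 ?ler_nat ?dim_leq_width//.
  by rewrite (le_trans _ V1).
apply: (le_trans (par_le _ _ _ B0 thB)).
by rewrite ler_peMl.
Qed.

Lemma layer_dist th th' l (v v' : nat -> R) (B V eta D : R) i :
  (p <= w)%N -> (0 < w)%N -> 1 <= B -> 1 <= V -> 0 <= eta -> 0 <= D ->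
  (forall k, `|th' k| <= B) -> (forall k, `|th k - th' k| <= eta) ->
  (forall j, `|v j| <= V) -> (forall j, `|v j - v' j| <= D) ->
  `|layer th l v i - layer th' l v' i| <= (w%:R + 1) * B * (eta * V + D).
Proof.
move=> pw w0 B1 V1 eta0 D0 thB the vV vD; rewrite /layer opprD addrACA -sumrB.
have B0 : 0 <= B by lra.
apply: (le_trans (ler_normD _ _)).
have VD0 : 0 <= eta * V + D by rewrite addr_ge0 ?mulr_ge0//; lra.
rewrite -mulrA mulrDl mul1r; apply: lerD.
  apply: (le_trans (ler_norm_sum _ _ _)).
  apply: (@le_trans _ _ (\sum_(j < Defs.dim p w L l) (B * (eta * V + D)))).
    apply: ler_sum => j _.
    set a := par th _ _ _; set b := par th' _ _ _.
    have -> : a * v j - b * v' j = (a - b) * v j + b * (v j - v' j) by ring.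
    apply: (le_trans (ler_normD _ _)); rewrite !normrM.
    have ab : `|a - b| <= eta by exact: par_dist.
    have bB : `|b| <= B by exact: par_le.
    have := vV j; have := vD j => vDj vVj.
    apply: (@le_trans _ _ (eta * V + B * D)).
      by apply: lerD; apply: ler_pM.
    rewrite mulrDr lerD2r ler_peMl// mulr_ge0//; lra.
  rewrite sumr_const card_ord -[leLHS]mulr_natl ler_wpM2r ?ler_nat ?dim_leq_width//.
  by rewrite mulr_ge0.
apply: (@le_trans _ _ eta); first exact: par_dist.
rewrite (@le_trans _ _ (eta * V + D))//; last by rewrite ler_peMl.
rewrite (@le_trans _ _ (eta * V))// ?lerDl// ler_peMr//.
Qed.

Lemma hid_le th x (B : R) k i :
  (p <= w)%N -> (0 < w)%N -> 1 <= B -> (forall k, `|th k| <= B) -> cube x ->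
  `|hid th x k i| <= ((w%:R + 1) * B) ^+ k.
Proof.
move=> pw w0 B1 thB cx; elim: k i => [|k IH] i /=.
  rewrite expr0; case: insub => [j|]; last by rewrite normr0.
  by have /andP[x0 x1] := cx j; rewrite ger0_norm.
have := relu_lip (layer th k (hid th x k) i) 0; rewrite (@relu_0 0)// !subr0 => /le_trans; apply.
rewrite exprS; apply: layer_le => //; first lra.
rewrite exprn_ege1//.
have w1 : 0 <= w%:R :> R by []; nra.
Qed.

(* Lipschitz dependence of the network on parameters and input. *)
Lemma hid_dist th th' x x' (B eta D : R) k i :
  (p <= w)%N -> (0 < w)%N -> 1 <= B -> 0 <= eta -> 0 <= D ->
  (forall k, `|th k| <= B) -> (forall k, `|th' k| <= B) ->
  (forall k, `|th k - th' k| <= eta) -> cube x -> (forall j, `|x j - x' j| <= D) ->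
  `|hid th x k i - hid th' x' k i| <= (k%:R * eta + D) * ((w%:R + 1) * B) ^+ k.
Proof.
move=> pw w0 B1 eta0 D0 thB thB' the cx xD; elim: k i => [|k IH] i.
  rewrite mul0r add0r expr0 mulr1 /=; case: insub => [j|]; last by rewrite subrr normr0.
  exact: xD.
apply: (le_trans (relu_lip _ _)).
have U1 : 1 <= ((w%:R + 1) * B) ^+ k.
  rewrite exprn_ege1//; have w1 : 0 <= w%:R :> R by []; nra.
have Uk0 : 0 <= (k%:R * eta + D) * ((w%:R + 1) * B) ^+ k.
  rewrite mulr_ge0 ?addr_ge0 ?mulr_ge0//; lra.
apply: (le_trans (layer_dist _ _ pw w0 B1 U1 eta0 Uk0 thB' the (fun j => hid_le _ _ pw w0 B1 thB cx) IH)).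
by rewrite exprS -natr1 le_eqVlt; apply/orP; left; apply/eqP; ring.
Qed.

(** The constant is exponential in the depth. For [w] and [B] polynomial in n and [L] of order log n
    its logarithm is of order (log n)^2, which dictates the side of the grid used for parameters. *)
Lemma net_dist th th' x x' (B eta D : R) :
  (p <= w)%N -> (0 < w)%N -> 1 <= B -> 0 <= eta -> 0 <= D ->
  (forall k, `|th k| <= B) -> (forall k, `|th' k| <= B) ->
  (forall k, `|th k - th' k| <= eta) -> cube x -> (forall j, `|x j - x' j| <= D) ->
  `|net th x - net th' x'| <= (L.+1%:R * eta + D) * ((w%:R + 1) * B) ^+ L.+1.
Proof.
move=> pw w0 B1 eta0 D0 thB thB' the cx xD.
have U1 : 1 <= ((w%:R + 1) * B) ^+ L.
  rewrite exprn_ege1//; have w1 : 0 <= w%:R :> R by []; nra.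
have Uk0 : 0 <= (L%:R * eta + D) * ((w%:R + 1) * B) ^+ L.
  rewrite mulr_ge0 ?addr_ge0 ?mulr_ge0//; lra.
have H i := hid_dist L i pw w0 B1 eta0 D0 thB thB' the cx xD.
apply: (le_trans (layer_dist _ _ pw w0 B1 U1 eta0 Uk0 thB' the (fun j => hid_le _ _ pw w0 B1 thB cx) H)).
by rewrite exprS -natr1 le_eqVlt; apply/orP; left; apply/eqP; ring.
Qed.

Lemma net0 x : net (fun _ : Idx p w L => 0) x = 0.
Proof.
rewrite /net /layer.
have P l i j : par (fun _ : Idx p w L => 0 : R) l i j = 0.
  rewrite /par; do 2!(case: insub => // ?); case: j => // j0; by case: insub.
by rewrite P addr0 big1// => j _; rewrite P mul0r.
Qed.

Lemma measurable_par d (T : measurableType d) (u : T -> Idx p w L -> R) l i j :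
  (forall k, measurable_fun [set: T] (fun t => u t k)) ->
  measurable_fun [set: T] (fun t => par (u t) l i j).
Proof.
move=> mu_; rewrite /par.
case: insub => [l'|]; last exact: measurable_cst.
case: insub => [i'|]; last exact: measurable_cst.
case: j => [j0|]; last exact: mu_.
by case: insub => [j'|] //; exact: measurable_cst.
Qed.

Lemma measurable_layer d (T : measurableType d) (u : T -> Idx p w L -> R) (v : T -> nat -> R) l i :
  (forall k, measurable_fun [set: T] (fun t => u t k)) ->
  (forall k, measurable_fun [set: T] (fun t => v t k)) ->
  measurable_fun [set: T] (fun t => layer (u t) l (v t) i).
Proof.
move=> mu_ mv; apply: measurable_funD; last exact: measurable_par.
by apply: measurable_sum => j; apply: measurable_funM => //; exact: measurable_par.
Qed.

Lemma measurable_hid d (T : measurableType d) (u : T -> Idx p w L -> R) x k i :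
  (forall k, measurable_fun [set: T] (fun t => u t k)) ->
  measurable_fun [set: T] (fun t => hid (u t) x k i).
Proof.
move=> mu_; elim: k i => [|k IH] i /=; first exact: measurable_cst.
by apply: measurable_maxr => //; exact: measurable_layer.
Qed.

Lemma measurable_net d (T : measurableType d) (u : T -> Idx p w L -> R) x :
  (forall k, measurable_fun [set: T] (fun t => u t k)) ->
  measurable_fun [set: T] (fun t => net (u t) x).
Proof. by move=> mu_; apply: measurable_layer => // k; exact: measurable_hid. Qed.

(* By continuity of networks it suffices to test the sup bound on rational grid points. *)
Definition gridpt (m : nat) (k : {ffun 'I_p -> 'I_m.+2}) : 'I_p -> R :=
  fun i => (k i)%:R / m.+1%:R.

Lemma gridpt_cube m k : cube (@gridpt m k).
Proof.
move=> i; rewrite /gridpt divr_ge0//= ler_pdivrMr// mul1r ler_nat.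
by rewrite -ltnS.
Qed.

Lemma gridpt_near m x : cube x -> exists k, forall i, `|x i - @gridpt m k i| <= m.+1%:R^-1.
Proof.
move=> cx.
have tr i : (Num.trunc (x i * m.+1%:R) < m.+2)%N.
  have /andP[x0 x1] := cx i.
  rewrite ltnS -(ler_nat R); apply: (@le_trans _ _ (x i * m.+1%:R)).
    by rewrite Num.Theory.truncn_le// mulr_ge0.
  by rewrite ler_piMl.
exists [ffun i => Ordinal (tr i)] => i; rewrite /gridpt ffunE/=.
have /andP[x0 x1] := cx i.
have y0 : 0 <= x i * m.+1%:R by rewrite mulr_ge0.
have /andP[l u] := Num.Theory.truncn_itv y0.
have m0 : 0 < m.+1%:R :> R by [].
have -> : x i - (Num.trunc (x i * m.+1%:R))%:R / m.+1%:R =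
    (x i * m.+1%:R - (Num.trunc (x i * m.+1%:R))%:R) / m.+1%:R.
  by rewrite mulrBl mulfK ?gt_eqF.
rewrite normrM normfV (ger0_norm (ltW m0)) ler_piMl ?invr_ge0//.
by rewrite ger0_norm ?subr_ge0// lerBlDr (le_trans (ltW u))// -natr1 addrC.
Qed.

Lemma supbdd_grid (F : R) th : (p <= w)%N -> (0 < w)%N ->
  supbdd F th <-> forall m (k : {ffun 'I_p -> 'I_m.+2}), `|net th (gridpt k)| <= F.
Proof.
move=> pw w0; split=> [H m k|H x cx]; first exact/H/gridpt_cube.
pose B : R := 1 + \sum_k `|th k|.
have B1 : 1 <= B by rewrite lerDl sumr_ge0.
have thB k : `|th k| <= B.
  by rewrite /B (bigD1 k)//= addrCA lerDl addr_ge0// sumr_ge0.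
apply/ler_addgt0Pr => e e0.
pose U := ((w%:R + 1) * B) ^+ L.+1.
have U0 : 0 < U.
  have w1 : 0 < w%:R + 1 :> R by rewrite ltr_wpDl.
  by rewrite exprn_gt0// mulr_gt0//; lra.
pose m := Num.trunc (U / e).
have Ue : U / e < m.+1%:R.
  by have /andP[] := Num.Theory.truncn_itv (ltW (divr_gt0 U0 e0)).
have [k kx] := gridpt_near m cx.
have D0 : 0 <= m.+1%:R^-1 :> R by rewrite invr_ge0.
have nd : `|net th x - net th (gridpt k)| <= e.
  have the j : `|th j - th j| <= (0 : R) by rewrite subrr normr0.
  have Z := net_dist pw w0 B1 (lexx _) D0 thB thB the cx kx.
  apply: (le_trans Z).
  by rewrite mulr0 add0r -/U mulrC ler_pdivrMr// mulrC -ler_pdivrMr// ltW.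
rewrite -[net th x](subrK (net th (gridpt k))) addrC.
by apply: (le_trans (ler_normD _ _)); exact: lerD.
Qed.

Lemma measurable_supbdd d (T : measurableType d) (u : T -> Idx p w L -> R) (F : R) :
  (p <= w)%N -> (0 < w)%N ->
  (forall k, measurable_fun [set: T] (fun t => u t k)) ->
  measurable_fun [set: T] (fun t => \1_(supbdd F) (u t) : R).
Proof.
move=> pw w0 mu_.
have -> : (fun t => \1_(supbdd F) (u t) : R) =
    \1_(\bigcap_m \bigcap_(k : {ffun 'I_p -> 'I_m.+2}) [set t | `|net (u t) (gridpt k)| <= F]).
  apply/funext => t; rewrite !indicE; congr (_ : bool)%:R.
  apply/idP/idP; rewrite !inE => H.
    by move=> m _ k _; move/(supbdd_grid _ _ pw w0): H; apply.
  by apply/(supbdd_grid _ _ pw w0) => m k; exact: H.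
apply: measurable_indic; apply: bigcapT_measurable => m.
apply: fin_bigcap_measurable => // k _.
rewrite -[X in measurable X]setTI.
apply: (measurable_fun_le (f := fun t => `|net (u t) (gridpt k)|) (g := cst F)) => //.
by apply: measurableT_comp => //; exact: measurable_net.
Qed.

End NetBounds.

(** * Sparse networks as compositions of layers on finite index types, and their embedding into
    [net] *)

Section SparseNet.
Context {R : realType}.
Variable p : nat.
Local Notation X := ('I_p -> R).

(* One sparse ReLU layer on registers indexed by finite types: width at most [W], at most [c] parameters. *)
Definition flayer (W c : nat) (J : finType) (Psi : J -> X -> R) (I : finType) (Phi : I -> X -> R) : Prop :=
  exists (a : I -> J -> R) (b : I -> R),
    [/\ (#|I| <= W)%N, (forall i j, `|a i j| <= 1), (forall i, `|b i| <= 1),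
        (\sum_i \sum_j (a i j != 0%R) + #|I| <= c)%N &
        forall i x, Phi i x = relu (\sum_j a i j * Psi j x + b i)].

(* [feat W k c Phi]: the functions [Phi] are computed by [k.+1] hidden layers. *)
Fixpoint feat (W k c : nat) (I : finType) (Phi : I -> X -> R) {struct k} : Prop :=
  match k with
  | 0%N => flayer W c (fun (i : 'I_p) x => x i) Phi
  | k'.+1 => exists c1 c2 (J : finType) (Psi : J -> X -> R),
      [/\ feat W k' c1 Psi, flayer W c2 Psi Phi & (c1 + c2 <= c)%N]
  end.

Lemma flayer_mono W W' c c' (J : finType) (Psi : J -> X -> R) (I : finType) (Phi : I -> X -> R) :
  (W <= W')%N -> (c <= c')%N -> flayer W c Psi Phi -> flayer W' c' Psi Phi.
Proof.
move=> WW cc [a [b [h1 h2 h3 h4 h5]]]; exists a, b; split => //.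
- exact: leq_trans WW.
- exact: leq_trans cc.
Qed.

Lemma feat_mono W W' k c c' (I : finType) (Phi : I -> X -> R) :
  (W <= W')%N -> (c <= c')%N -> feat W k c Phi -> feat W' k c' Phi.
Proof.
move=> WW; elim: k c c' I Phi => [|k IH] c c' I Phi cc /=; first exact: flayer_mono.
move=> [c1 [c2 [J [Psi [h1 h2 h3]]]]]; exists c1, c2, J, Psi; split.
- exact: IH h1.
- exact: flayer_mono h2.
- exact: leq_trans cc.
Qed.

Lemma feat_layer W k c (I : finType) (Phi : I -> X -> R) :
  feat W k c Phi -> (#|I| <= W)%N /\ forall i x, 0 <= Phi i x.
Proof.
have H (J : finType) (Psi : J -> X -> R) c0 : flayer W c0 Psi Phi ->
    (#|I| <= W)%N /\ forall i x, 0 <= Phi i x.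
  by move=> [a [b [h1 _ _ _ h5]]]; split => // i x; rewrite h5 relu_ge0.
by case: k => [|k] /=; [exact: H|move=> [? [? [? [? [_ /H]]]]]].
Qed.

Lemma feat_step W k c c' (I J : finType) (Phi : I -> X -> R) (Psi : J -> X -> R) :
  feat W k c Phi -> flayer W c' Phi Psi -> feat W k.+1 (c + c') Psi.
Proof. by move=> h1 h2; exists c, c', I, Phi. Qed.

Lemma sum_pred1 (I : finType) (i : I) : (\sum_(j : I) (j == i))%N = 1%N.
Proof. by rewrite (bigD1 i)//= eqxx big1// => j /negbTE ->. Qed.

(** Features are outputs of ReLUs, hence nonnegative, and ReLU is the identity on them. So identity
    layers pass them on, at the price of one weight and one counted bias per unit. This stretches a
    network of bounded depth to any larger depth. *)
Lemma feat_carry W k c (I : finType) (Phi : I -> X -> R) t :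
  feat W k c Phi -> feat W (k + t) (c + t * (2 * W)) Phi.
Proof.
move=> fP; have [IW P0] := feat_layer fP.
elim: t => [|t IH]; first by rewrite addn0 mul0n addn0.
rewrite addnS mulSn (addnC (2 * W)%N) addnA; apply: feat_step IH _.
exists (fun i j => (j == i)%:R), (fun=> 0); split => //.
- by move=> i j; case: eqP => _; rewrite ?normr1 ?normr0.
- by move=> i; rewrite normr0.
- rewrite (eq_bigr (fun=> 1%N)).
    by rewrite sum_nat_const muln1 mul2n -addnn leq_add.
  move=> i _; rewrite -[RHS](sum_pred1 i); apply: eq_bigr => j _.
  by rewrite pnatr_eq0; case: (j == i).
- move=> i x; rewrite addr0 (bigD1 i)//= eqxx mul1r big1 ?addr0 ?relu_id// => j /negbTE ->.
  by rewrite mul0r.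
Qed.

Definition fsum (I J : finType) (Phi : I -> X -> R) (Psi : J -> X -> R) (z : I + J) : X -> R :=
  match z with inl i => Phi i | inr j => Psi j end.

Lemma card_sumT (I J : finType) : #|{: I + J}| = (#|I| + #|J|)%N.
Proof. exact: card_sum. Qed.

(** Two networks of equal depth run side by side, with block-diagonal weight matrices. *)
Lemma feat_par W1 W2 k c1 c2 (I J : finType) (Phi : I -> X -> R) (Psi : J -> X -> R) :
  feat W1 k c1 Phi -> feat W2 k c2 Psi -> feat (W1 + W2) k (c1 + c2) (fsum Phi Psi).
Proof.
elim: k c1 c2 I J Phi Psi => [|k IH] c1 c2 I J Phi Psi /=.
  move=> [a [b [h1 h2 h3 h4 h5]]] [a' [b' [h1' h2' h3' h4' h5']]].
  exists (fun z => match z with inl i => a i | inr i => a' i end),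
    (fun z => match z with inl i => b i | inr i => b' i end); split.
  - by rewrite card_sumT leq_add.
  - by case.
  - by case.
  - by rewrite big_sumType/= card_sumT addnACA leq_add.
  - by case => i x /=.
move=> [d1 [e1 [I1 [P1 [f1 l1 le1]]]]] [d2 [e2 [I2 [P2 [f2 l2 le2]]]]].
exists (d1 + d2)%N, (e1 + e2)%N, (I1 + I2)%type, (fsum P1 P2); split.
- exact: IH.
- move: l1 l2 => [a [b [h1 h2 h3 h4 h5]]] [a' [b' [h1' h2' h3' h4' h5']]].
  exists (fun z y => match z, y with inl i, inl j => a i j | inr i, inr j => a' i j | _, _ => 0 end),
    (fun z => match z with inl i => b i | inr i => b' i end); split.
  + by rewrite card_sumT leq_add.
  + by move=> [i|i] [j|j]; rewrite ?normr0.
  + by case.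
  + rewrite big_sumType/= card_sumT.
    rewrite (eq_bigr (fun i => \sum_j (a i j != 0%R))%N); last first.
      by move=> i _; rewrite big_sumType/= [X in (_ + X)%N]big1 ?addn0// => j _; rewrite eqxx.
    rewrite [X in (_ + X + _)%N](eq_bigr (fun i => \sum_j (a' i j != 0%R))%N); last first.
      by move=> i _; rewrite big_sumType/= [X in (X + _)%N]big1 ?add0n// => j _; rewrite eqxx.
    by rewrite addnACA leq_add.
  + move=> [i|i] x /=; rewrite big_sumType/=.
      by rewrite h5 [X in _ + X + _]big1 ?addr0// => j _; rewrite mul0r.
    by rewrite h5' [X in X + _ + _]big1 ?add0r// => j _; rewrite mul0r.
- by rewrite addnACA leq_add.
Qed.

Section Embed.
Variables w L : nat.

(** Parameters are prescribed by a total function of layer, row and column ([None] for the bias),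
    which avoids computing in the dependent index type [Idx]. *)
Definition mk (A : nat -> nat -> option nat -> R) (k : Idx p w L) : R :=
  A (val (tag k)) (val (tagged k).1) (omap val (tagged k).2).

Lemma par_mk A l i j : (l <= L)%N -> (i < Defs.dim p w L l.+1)%N ->
  (if j is Some j0 then (j0 < Defs.dim p w L l)%N else true) ->
  par (mk A) l i j = A l i j.
Proof.
rewrite -ltnS => lL iD jD; rewrite /par insubT/= insubT/=.
by case: j jD => [j0 jD|_] //; rewrite insubT.
Qed.

Lemma par_mk_ext A A' l : (forall i j, A l i j = A' l i j) ->
  forall i j, par (mk A) l i j = par (mk A') l i j.
Proof.
move=> AA i j; rewrite /par; case: insubP => // l' _ El; subst l; case: insubP => // i' _ _.
by case: j => [j0|]; [case: insubP => // j' _ _|]; exact: AA.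
Qed.

Lemma hid_mk_ext A A' x k : (forall l i j, (l < k)%N -> A l i j = A' l i j) ->
  hid (mk A) x k = hid (mk A') x k.
Proof.
elim: k => [|k IH] AA //=; apply/funext => i; congr relu.
rewrite /layer IH; last by move=> l i' j lk; apply: AA; exact: ltnW.
have H i' j := @par_mk_ext A A' k (fun i j => AA k i j (ltnSn k)) i' j.
by congr (_ + _); [apply: eq_bigr => j _; rewrite H|rewrite H].
Qed.

(** Layer [k] of [A] is overwritten by the weights [a] and biases [b], placed at the positions that
    [e] and [e'] assign to abstract units; all other entries of that layer become zero. *)
Definition setl (A : nat -> nat -> option nat -> R) (k : nat) (J I : finType) (e : J -> nat)
    (e' : I -> nat) (a : I -> J -> R) (b : I -> R) (l r : nat) (c : option nat) : R :=
  if l == k then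
    if [pick i | e' i == r] is Some i then
      if c is Some c0 then if [pick j | e j == c0] is Some j then a i j else 0 else b i
    else 0
  else A l r c.

Lemma pick_inj (I : finType) (e : I -> nat) i : injective e -> [pick i' | e i' == e i] = Some i.
Proof.
by move=> ie; case: pickP => [i' /eqP/ie -> //|/(_ i)]; rewrite eqxx.
Qed.

Lemma layer_embed A k (J I : finType) (e : J -> nat) (e' : I -> nat) a b (Psi : J -> X -> R) :
  (k <= L)%N -> injective e -> (forall j, (e j < Defs.dim p w L k)%N) ->
  injective e' -> (forall i, (e' i < Defs.dim p w L k.+1)%N) ->
  (forall x j, hid (mk A) x k (e j) = Psi j x) ->
  forall x i, layer (mk (setl A k e e' a b)) k (hid (mk (setl A k e e' a b)) x k) (e' i) =
    \sum_j a i j * Psi j x + b i.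
Proof.
move=> kL ie ed ie' ed' hA x i.
have hE : hid (mk (setl A k e e' a b)) x k = hid (mk A) x k.
  by apply: hid_mk_ext => l r c lk; rewrite /setl (ltn_eqF lk).
rewrite hE /layer par_mk// /setl eqxx (pick_inj i ie'); congr (_ + _).
rewrite (partition_big (fun j => Ordinal (ed j)) xpredT)//=.
apply: eq_bigr => c _; rewrite par_mk//= eqxx (pick_inj i ie').
case: pickP => [j /eqP ej|ne].
  rewrite (big_pred1 j) => [|j']; first by rewrite -hA -ej.
  apply/eqP/eqP => [/(congr1 val)/=|->]; last exact: val_inj.
  by rewrite -ej => /ie.
rewrite mul0r big_pred0// => j; apply/negbTE/eqP => /(congr1 val)/= ej.
Qed.

(** The list [S] contains the positions of all nonzero entries, so its length bounds the sparsity.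
    Vanishing of [A] above layer [k] leaves the next layers free to be written. *)
Lemma feat_embed W k c (I : finType) (Phi : I -> X -> R) :
  feat W k c Phi -> (k < L)%N -> (W <= w)%N ->
  exists (A : nat -> nat -> option nat -> R) (e : I -> nat) (S : seq (nat * nat * option nat)),
    [/\ injective e /\ (forall i, (e i < w)%N), (size S <= c)%N,
        (forall l i j, A l i j != 0 -> (l, i, j) \in S),
        (forall l i j, `|A l i j| <= 1) /\ (forall l i j, (k < l)%N -> A l i j = 0) &
        forall x i, hid (mk A) x k.+1 (e i) = Phi i x].
Proof.
(* One more layer is written. The values of layer [k0] are unchanged by it, because [hid] up to [k0]
   depends only on layers strictly below. *)
have step k0 c1 c2 (J : finType) (Psi : J -> X -> R) (I0 : finType) (Phi0 : I0 -> X -> R)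
    (A : nat -> nat -> option nat -> R) (e : J -> nat) (S : seq (nat * nat * option nat)) :
  injective e -> (forall i, (e i < Defs.dim p w L k0)%N) -> (size S <= c1)%N ->
  (forall l i j, A l i j != 0 -> (l, i, j) \in S) ->
  (forall l i j, `|A l i j| <= 1) -> (forall l i j, (k0 <= l)%N -> A l i j = 0) ->
  (forall x i, hid (mk A) x k0 (e i) = Psi i x) ->
  flayer W c2 Psi Phi0 -> (k0 < L)%N -> (W <= w)%N ->
  exists (A : nat -> nat -> option nat -> R) (e : I0 -> nat) (S : seq (nat * nat * option nat)),
    [/\ injective e /\ (forall i, (e i < w)%N), (size S <= c1 + c2)%N,
        (forall l i j, A l i j != 0 -> (l, i, j) \in S),
        (forall l i j, `|A l i j| <= 1) /\ (forall l i j, (k0 < l)%N -> A l i j = 0) &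
        forall x i, hid (mk A) x k0.+1 (e i) = Phi0 i x].
  move=> ie ed Sc AS A1 A0 hA [a [b [h1 h2 h3 h4 h5]]] kL Ww.
  pose e' (i : I0) : nat := enum_rank i.
  have ie' : injective e' by move=> i i' /val_inj/enum_rank_inj.
  have ew' i : (e' i < w)%N by rewrite (leq_trans _ Ww)// (leq_trans (ltn_ord _)).
  exists (setl A k0 e e' a b), e',
    (S ++ ([seq (k0, e' z.1, Some (e z.2)) | z <- enum [pred z : I0 * J | a z.1 z.2 != 0]] ++
      [seq (k0, e' i, None) | i <- enum I0])); split => //.
  - rewrite !size_cat leq_add// !size_map -!cardE (leq_trans _ h4)// leq_add//; last by rewrite cardT enumT.
    rewrite -sum1_card pair_bigA/= big_mkcond/=; apply: leq_sum => z _.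
    by rewrite inE; case: ifP.
  - move=> l i j; rewrite !mem_cat /setl; case: (l =P k0) => [->|_ /AS ->] //.
    case: pickP => [i0 /eqP <-|]; last by rewrite eqxx.
    case: j => [j|]; last first.
      by move=> _; rewrite (map_f (fun i => (k0, e' i, None))) ?orbT// mem_enum.
    case: pickP => [j0 /eqP <-|]; last by rewrite eqxx.
    by move=> aij; rewrite (map_f (fun z => (k0, e' z.1, Some (e z.2))) (x := (i0, j0))) ?orbT// mem_enum inE.
  - split=> l i j; rewrite /setl.
      case: (l =P k0) => // _; case: pickP => [i0 _|]; last by rewrite normr0.
      by case: j => // j; case: pickP => [j0 _|]; rewrite ?normr0.
    by move=> lk; rewrite (gtn_eqF lk) A0// ltnW.
  - move=> x i; rewrite h5 /=; congr relu; apply: layer_embed => //; first exact: ltnW.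
    by move=> i'; rewrite /Defs.dim/= kL.
elim: k c I Phi => [|k IH] c I Phi /= + kL Ww.
  move=> fl; rewrite -[c]add0n.
  have i1 : injective (fun i : 'I_p => nat_of_ord i) by move=> i j /val_inj.
  have i2 (i : 'I_p) : (i < Defs.dim p w L 0)%N by rewrite /Defs.dim/=.
  have i3 (x : X) (i : 'I_p) : hid (mk (fun _ _ _ => 0)) x 0 i = x i.
    by rewrite /= insubT//= => ip; congr x; exact: val_inj.
  apply: (step 0%N 0%N c _ _ _ _ (fun _ _ _ => 0) _ [::] i1 i2 _ _ _ _ i3 fl) => //.
    by move=> l i j; rewrite eqxx.
  by move=> l i j; rewrite normr0.
move=> [c1 [c2 [J [Psi [f1 fl cc]]]]].
have [A [e [S [[h1 h2] h3 h4 [h5 h6] h7]]]] := IH _ _ _ f1 (ltnW kL) Ww.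
have h2' i : (e i < Defs.dim p w L k.+1)%N by rewrite /Defs.dim/= (ltnW kL) h2.
have [A' [e' [S' [g1 g2 g3 g4 g5]]]] := step _ _ _ _ _ _ _ _ _ _ h1 h2' h3 h4 h5 h6 h7 fl kL Ww.
by exists A', e', S'; split => //; exact: leq_trans cc.
Qed.

Lemma vals_inj : injective (fun k : Idx p w L =>
  (val (tag k), val (tagged k).1, omap val (tagged k).2)).
Proof.
move=> [l [i j]] [l' [i' j']] /= [] /val_inj El; subst l' => /val_inj -> /=.
case: j j' => [j|] [j'|] //= [] /val_inj -> //.
Qed.

(** The linear read-out becomes the top layer. Its weights are bounded by [C] and not by 1, and they
    are left out of the count, as in the prior: Gaussian and fully connected at the top, uniform on
    [-1,1] below. *)
Lemma feat_net W k c (I : finType) (Phi : I -> X -> R) (al : I -> R) (al0 C : R) :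
  feat W k c Phi -> L = k.+1 -> (W <= w)%N -> 0 <= C ->
  (forall i, `|al i| <= C) -> `|al0| <= C ->
  exists th : Idx p w L -> R,
    [/\ forall x, net th x = \sum_i al i * Phi i x + al0,
        (#|[set k | ~~ top k & th k != 0%R]| <= c)%N,
        (forall k, ~~ top k -> `|th k| <= 1) & (forall k, top k -> `|th k| <= C)].
Proof.
move=> fP EL Ww C0 alC al0C.
have [|A [e [S [[h1 h2] h3 h4 [h5 h6] h7]]]] := feat_embed fP _ Ww; first by rewrite EL.
pose A' := setl A L e (fun _ : unit => 0%N) (fun _ => al) (fun _ => al0).
have A'E l i j : (l < L)%N -> A' l i j = A l i j by move=> lL; rewrite /A' /setl (ltn_eqF lL).
have topF (k0 : Idx p w L) : ~~ top k0 -> (tag k0 < L)%N.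
  by rewrite /top ltn_neqAle -ltnS ltn_ord andbT.
exists (mk A'); split.
- move=> x; rewrite /net.
  refine (@layer_embed A L I unit e (fun=> 0%N) (fun=> al) (fun=> al0) Phi (leqnn L) h1 _ _ _ _ x tt).
  + by move=> j; rewrite /Defs.dim EL/= leqnn h2.
  + by case=> [[]].
  + by move=> _; rewrite /Defs.dim/= ltnn.
  + by move=> x0 j; rewrite -h7 -EL.
- rewrite (leq_trans _ h3)// cardE.
  pose f := fun k : Idx p w L => (val (tag k), val (tagged k).1, omap val (tagged k).2).
  rewrite -(size_map f); apply: uniq_leq_size.
    by rewrite map_inj_uniq ?enum_uniq//; exact: vals_inj.
  move=> z /mapP[k0]; rewrite mem_enum inE => /andP[tk nz] ->.
  by apply: h4; move: nz; rewrite /mk A'E// topF.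
- by move=> k0 tk; rewrite /mk A'E ?topF.
- move=> k0; rewrite /top => /eqP tk; rewrite /mk /A' /setl tk eqxx.
  case: pickP => [_ _|]; last by rewrite normr0.
  by case: (omap _ _) => // j; case: pickP => [? _|]; rewrite ?normr0.
Qed.

End Embed.
End SparseNet.

(** * An algebra of quantities that small networks approximate at the design points *)

Section Cheap.
Context {R : realType}.
Variable p : nat.
Local Notation X := ('I_p -> R).
Variables (K : nat -> nat) (Xs : forall n, 'I_n -> X).
Hypothesis K0 : forall n, (0 < K n)%N.

(* Values at the design points that a network of depth O(1) and size O(K n) approximates
   to accuracy O(1 / K n). *)
Definition cheap (v : forall n, 'I_n -> R) : Prop :=
  exists (C : R) (d c n0 : nat), forall n, (n0 <= n)%N ->
    exists (I : finType) (Phi : I -> X -> R) (al : I -> R) (al0 : R),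
    [/\ feat (c * K n) d (c * K n) Phi, forall i, `|al i| <= C, `|al0| <= C,
        forall i, `|v n i| <= C &
        forall i, `|\sum_j al j * Phi j (Xs i) + al0 - v n i| <= C / (K n)%:R].

Lemma K0R n : 0 < (K n)%:R :> R. Proof. by rewrite ltr0n. Qed.

Lemma cheap_ext v v' : (forall n (i : 'I_n), v n i = v' n i) -> cheap v -> cheap v'.
Proof.
move=> vv [C [d [c [n0 H]]]]; exists C, d, c, n0 => n /H [I [Phi [al [al0 [h1 h2 h3 h4 h5]]]]].
exists I, Phi, al, al0; split => // i; rewrite -vv//.
Qed.

Lemma cheap_cst (a : R) : cheap (fun _ _ => a).
Proof.
exists `|a|, 0%N, 0%N, 0%N => n _.
exists 'I_0, (fun _ _ => 0), (fun _ => 0), a; split => //.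
- exists (fun _ _ => 0), (fun _ => 0); split => //; [by rewrite card_ord|by case|by case| |by case].
  by rewrite big_ord0 card_ord.
- by case.
- by move=> i; rewrite big_ord0 add0r subrr normr0 divr_ge0.
Qed.

Lemma cheap_scale v (a : R) : cheap v -> cheap (fun n i => a * v n i).
Proof.
move=> [C [d [c [n0 H]]]]; exists (`|a| * C), d, c, n0 => n /H [I [Phi [al [al0 [h1 h2 h3 h4 h5]]]]].
exists I, Phi, (fun i => a * al i), (a * al0); split => //.
- by move=> i; rewrite normrM ler_wpM2l.
- by rewrite normrM ler_wpM2l.
- by move=> i; rewrite normrM ler_wpM2l.
- move=> i; rewrite -mulrA.
  under eq_bigr do rewrite -mulrA.
  by rewrite -mulr_sumr -mulrDr -mulrBr normrM ler_wpM2l.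
Qed.

(** The two networks have different depths, so both are carried to depth index [d + d'] before being
    put in parallel. *)
Lemma cheap_add v w : cheap v -> cheap w -> cheap (fun n i => v n i + w n i).
Proof.
move=> [C [d [c [n0 H]]]] [C' [d' [c' [n0' H']]]].
exists (C + C'), (d + d')%N, ((c + d' * (2 * c)) + (c' + d * (2 * c')))%N, (maxn n0 n0') => n.
rewrite geq_max => /andP[/H [I [Phi [al [al0 [h1 h2 h3 h4 h5]]]]]].
move=> /H' [J [Psi [be [be0 [g1 g2 g3 g4 g5]]]]].
have C0 : 0 <= C by exact: le_trans h3.
have C0' : 0 <= C' by exact: le_trans g3.
exists (I + J)%type, (fsum Phi Psi), (fun z => match z with inl i => al i | inr j => be j end), (al0 + be0).
split.
- have f1 := feat_carry d' h1; have f2 := feat_carry d g1; rewrite (addnC d') in f2.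
  apply: (feat_mono _ _ (feat_par f1 f2)); nia.
- by move=> [i|j]; [apply: (le_trans (h2 i)); lra|apply: (le_trans (g2 j)); lra].
- by rewrite (le_trans (ler_normD _ _))// lerD.
- by move=> i; rewrite (le_trans (ler_normD _ _))// lerD.
- move=> i; rewrite big_sumType/= mulrDl.
  have -> : \sum_(i0 : I) al i0 * Phi i0 (Xs i) + \sum_(i0 : J) be i0 * Psi i0 (Xs i) + (al0 + be0) - (v n i + w n i) =
   (\sum_(i0 : I) al i0 * Phi i0 (Xs i) + al0 - v n i) + (\sum_(i0 : J) be i0 * Psi i0 (Xs i) + be0 - w n i) by ring.
  by rewrite (le_trans (ler_normD _ _))// lerD.
Qed.

(* y^2 = 2 int_0^1 (y - t)_+ dt as a Riemann sum. *)
Lemma riemann_sqr (k : nat) (y : R) : (0 < k)%N -> 0 <= y <= 1 ->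
  `|\sum_(i < k) 2 / k%:R * relu (y - i%:R / k%:R) - y ^+ 2| <= 1 / k%:R.
Proof.
move=> k0 /andP[y0 y1]; have k0R : 0 < k%:R :> R by rewrite ltr0n.
pose h (i : nat) := - (relu (y - i%:R / k%:R)) ^+ 2.
(* Squared positive parts at consecutive grid points telescope to y^2. Each increment differs from
   the matching Riemann term by at most 1/k^2. *)
have -> : y ^+ 2 = \sum_(i < k) (h i.+1 - h i).
  rewrite -(big_mkord xpredT (fun i => h i.+1 - h i)) telescope_sumr//.
  rewrite /h divff ?gt_eqF// relu_0 ?subr_le0// mul0r subr0 relu_id//.
  by rewrite expr0n oppr0 add0r opprK.
rewrite -sumrB (le_trans (ler_norm_sum _ _ _))//.
apply: (@le_trans _ _ (\sum_(i < k) (1 / k%:R) ^+ 2)); last first.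
  rewrite sumr_const card_ord -[leLHS]mulr_natl le_eqVlt; apply/orP; left; apply/eqP.
  by field; rewrite gt_eqF.
apply: ler_sum => i _; rewrite /h -[i.+1%:R]natr1 (mulrDl i%:R).
set e := 1 / k%:R; have e0 : 0 < e by rewrite divr_gt0.
have -> : 2 / k%:R = 2 * e by rewrite /e mul1r.
set s := i%:R / k%:R.
set z := y - s; have -> : y - (s + e) = z - e by rewrite /z; ring.
have [z0|z0] := leP z 0.
  rewrite (relu_0 z0) relu_0; last lra.
  have -> : 2 * e * 0 - (- 0 ^+ 2 - - 0 ^+ 2) = 0 by ring.
  by rewrite normr0 sqr_ge0.
have [ze|ze] := leP (z - e) 0.
  rewrite (relu_id (ltW z0)) (relu_0 ze) expr0n/= ler_norml; nra.
rewrite (relu_id (ltW z0)) (relu_id (ltW ze)) ler_norml; nra.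
Qed.

(** One unit computes an approximation of y = (v + M)/(2M), which lies in [0,1]; the next layer has
    k units relu(y - i/k), whose Riemann sum is y^2 up to O(1/k). Then v^2 = 4 M^2 (y^2 - y) + M^2.
    The Riemann sum is Lipschitz in y, so the error of the first unit does no harm. *)
Lemma cheap_sqr v : cheap v -> cheap (fun n i => v n i ^+ 2).
Proof.
move=> [C [d [c [n0 H]]]]; pose M : R := `|C| + 1.
have M1 : 1 <= M by rewrite lerDr.
exists (20 * M ^+ 2), d.+2, (c + (c + 1) + 2)%N, n0 => n /H [I [Phi [al [al0 [h1 h2 h3 h4 h5]]]]].
have C0 : 0 <= C by exact: le_trans h3.
have MC : M = C + 1 by rewrite /M ger0_norm.
pose k := K n; have k0 : (0 < k)%N := K0 n.
have k0R : 0 < k%:R :> R by rewrite ltr0n.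
have k1R : 1 <= k%:R :> R by rewrite ler1n.
have M2 : 0 < 2 * M by lra.
have M40 : 0 <= 4 * M ^+ 2 by have := sqr_ge0 M; lra.
pose phi (_ : unit) (x : X) : R := relu (\sum_j (al j / (2 * M)) * Phi j x + (al0 + M) / (2 * M)).
pose psi (i : 'I_k) (x : X) : R := relu (\sum_(j : unit) 1 * phi j x + - (i%:R / k%:R)).
have f1 : flayer ((c + 1) * k) ((c + 1) * k) Phi phi.
  exists (fun _ j => al j / (2 * M)), (fun _ => (al0 + M) / (2 * M)); split => //.
  - by rewrite card_unit; nia.
  - move=> _ j; rewrite normrM normfV (gtr0_norm M2) ler_pdivrMr// mul1r (le_trans (h2 j))//; lra.
  - move=> _; rewrite normrM normfV (gtr0_norm M2) ler_pdivrMr// mul1r.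
    by rewrite (le_trans (ler_normD _ _))// (ger0_norm (_ : 0 <= M)) ?(le_trans _ M1)//; lra.
  - rewrite card_unit big_const card_unit/= addn0.
    have cI : (#|I| <= c * k)%N by case: (feat_layer h1).
    apply: (@leq_trans (#|I| + 1)); last nia.
    rewrite leq_add2r -sum1_card; apply: leq_sum => j _; exact: leq_b1.
have f2 : flayer (2 * k) (2 * k) phi psi.
  exists (fun _ _ => 1), (fun i : 'I_k => - (i%:R / k%:R)); split => //.
  - by rewrite card_ord; nia.
  - by move=> *; rewrite normr1.
  - move=> i; rewrite normrN ger0_norm ?divr_ge0// ler_pdivrMr// mul1r ler_nat.
    exact/ltnW/ltn_ord.
  - rewrite card_ord (eq_bigr (fun=> 1%N)).
      by rewrite sum_nat_const card_ord; nia.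
    by move=> i _; rewrite big_const card_unit/= oner_neq0.
(* Unit 0 has threshold 0 and returns y itself, so lowering its coefficient by 1 subtracts the
   linear term y. *)
exists 'I_k, psi, (fun i : 'I_k => 4 * M ^+ 2 * (2 / k%:R - (val i == 0%N)%:R)), (M ^+ 2).
have ik : 0 <= (k%:R^-1 : R) <= 1 by rewrite invr_ge0 ltW// invf_le1.
have /andP[ik0 ik1] := ik.
split.
- have g0 : feat ((c + (c + 1) + 2) * K n) d (c * K n) Phi by apply: feat_mono h1 => //; rewrite leq_mul2r -addnA leq_addr orbT.
  have g1 : flayer ((c + (c + 1) + 2) * K n) ((c + 1) * k) Phi phi.
    by apply: flayer_mono f1 => //; rewrite leq_mul2r addnAC (addnC c) leq_addl orbT || rewrite /k; nia.
  have g2 : flayer ((c + (c + 1) + 2) * K n) (2 * k) phi psi.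
    by apply: flayer_mono f2 => //; rewrite /k; nia.
  by apply: (feat_mono (leqnn _) _ (feat_step (feat_step g0 g1) g2)); rewrite -!mulnDl.
- move=> i; rewrite normrM (ger0_norm M40).
  have H3 : `|2 / k%:R - (val i == 0%N)%:R| <= 3 :> R by case: (val i == 0%N) => /=; rewrite ler_norml; lra.
  have := sqr_ge0 M; nra.
- by rewrite ger0_norm ?sqr_ge0//; have := sqr_ge0 M; lra.
- move=> i; rewrite normrX; have := h4 i; have := normr_ge0 (v n i) => ? ?.
  rewrite (@le_trans _ _ (C ^+ 2))// ?lerXn2r ?nnegrE// MC; nra.
- move=> i; set x := Xs i.
  have := h5 i; rewrite -/x; set t := \sum_j al j * Phi j x + al0 => ht.
  pose y := (v n i + M) / (2 * M).
  have y01 : 0 <= y <= 1.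
    have := h4 i; rewrite ler_norml => /andP[? ?].
    by apply/andP; split; [rewrite divr_ge0//; lra|rewrite ler_pdivrMr//; lra].
  have phiE : phi tt x = relu ((t + M) / (2 * M)).
    rewrite /phi /t; congr relu; rewrite -addrA [RHS]mulrDl; congr (_ + _).
    by rewrite mulr_suml; apply: eq_bigr => j _; rewrite mulrAC.
  have phiy : `|phi tt x - y| <= (1 / 2) / k%:R.
    rewrite phiE -[y in X in X <= _]relu_id; last by case/andP: y01.
    rewrite (le_trans (relu_lip _ _))// /y -mulrBl opprD addrACA subrr addr0.
    rewrite normrM normfV (gtr0_norm M2) ler_pdivrMr// (le_trans ht)//.
    rewrite mulrAC ler_wpM2r//; lra.
  have psiE (j : 'I_k) : psi j x = relu (phi tt x - j%:R / k%:R).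
    by rewrite /psi (big_pred1 tt) ?mul1r// => -[].
  have -> : \sum_(j < k) 4 * M ^+ 2 * (2 / k%:R - (val j == 0%N)%:R) * psi j x =
      4 * M ^+ 2 * (\sum_(j < k) 2 / k%:R * relu (phi tt x - j%:R / k%:R) - phi tt x).
    have phi0 : phi tt x = \sum_(j < k) (val j == 0%N)%:R * relu (phi tt x - j%:R / k%:R).
      rewrite (bigD1 (Ordinal k0))//= mul0r subr0 mul1r big1 ?addr0.
        by rewrite relu_id// phiE relu_ge0.
      by move=> j jn; rewrite (_ : (val j == 0%N) = false) ?mul0r//; apply: contraNF jn => /eqP ?; apply/eqP/val_inj.
    rewrite {2}phi0 -sumrB mulr_sumr; apply: eq_bigr => j _.
    by rewrite psiE; ring.
  set S := \sum_(j < k) _.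
  have Sy : `|S - y ^+ 2| <= 2 / k%:R.
    have := riemann_sqr k0 y01; set S' := \sum_(j < k) _ => hS.
    have -> : S - y ^+ 2 = (S - S') + (S' - y ^+ 2) by ring.
    rewrite (le_trans (ler_normD _ _))//.
    have -> : 2 / k%:R = 1 / k%:R + 1 / k%:R :> R by rewrite -mulrDl.
    rewrite lerD// /S /S' -sumrB (le_trans (ler_norm_sum _ _ _))//.
    apply: (@le_trans _ _ (\sum_(j < k) (2 / k%:R) * ((1 / 2) / k%:R))).
      apply: ler_sum => j _; rewrite -mulrBr normrM (ger0_norm (_ : 0 <= 2 / k%:R)) ?divr_ge0//.
      rewrite ler_wpM2l ?divr_ge0// (le_trans (relu_lip _ _))//.
      by have -> : phi tt x - j%:R / k%:R - (y - j%:R / k%:R) = phi tt x - y by ring.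
    rewrite sumr_const card_ord -[leLHS]mulr_natl le_eqVlt; apply/orP; left; apply/eqP.
    by field; rewrite gt_eqF.
  have -> : 4 * M ^+ 2 * (S - phi tt x) + M ^+ 2 - v n i ^+ 2 =
     4 * M ^+ 2 * ((S - y ^+ 2) - (phi tt x - y)).
    have -> : v n i = 2 * M * y - M by rewrite /y mulrC divfK ?gt_eqF// addrK.
    ring.
  rewrite normrM (ger0_norm M40).
  have HS : `|S - y ^+ 2 - (phi tt x - y)| <= 3 * k%:R^-1.
    by rewrite (le_trans (ler_normB _ _))// (le_trans (lerD Sy phiy))// -mulrDl ler_wpM2r//; lra.
  have := sqr_ge0 M; nra.
Qed.

Lemma cheap_mul v w : cheap v -> cheap w -> cheap (fun n i => v n i * w n i).
Proof.
move=> cv cw.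
have c1 := cheap_sqr (cheap_add cv cw).
have c2 := cheap_scale (-1) (cheap_add (cheap_sqr cv) (cheap_sqr cw)).
apply: cheap_ext (cheap_scale (1 / 2) (cheap_add c1 c2)) => n i /=.
by field.
Qed.

Lemma cheap_sum (I : Type) (s : seq I) (P : pred I) (v : I -> forall n, 'I_n -> R) :
  (forall j, cheap (v j)) -> cheap (fun n i => \sum_(j <- s | P j) v j n i).
Proof.
move=> cv; elim: s => [|j s IH].
  by apply: cheap_ext (cheap_cst 0) => n i; rewrite big_nil.
case Pj : (P j); first by apply: cheap_ext (cheap_add (cv j) IH) => n i; rewrite big_cons Pj.
by apply: cheap_ext IH => n i; rewrite big_cons Pj.
Qed.

Lemma cheap_exp v k : cheap v -> cheap (fun n i => v n i ^+ k).
Proof.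
move=> cv; elim: k => [|k IH]; first exact: cheap_cst.
by apply: cheap_ext (cheap_mul cv IH) => n i; rewrite exprS.
Qed.

End Cheap.

(** * Taylor's formula with Hoelder remainder in one variable, one-sided at the endpoints *)

Section Taylor.
Context {R : realType}.
Implicit Types (phi psi : R -> R) (t s u : R).

(* [psi] is the derivative of [phi] on [0,1], one-sided at the endpoints. *)
Definition der phi psi : Prop := forall t e, 0 <= t <= 1 -> 0 < e ->
  exists2 d, 0 < d & forall s, 0 <= s <= 1 -> `|s - t| < d ->
    `|phi s - phi t - psi t * (s - t)| <= e * `|s - t|.

Lemma derB phi psi phi' psi' : der phi psi -> der phi' psi' ->
  der (fun t => phi t - phi' t) (fun t => psi t - psi' t).
Proof.
move=> H H' t e t01 e0; have e2 : 0 < e / 2 by rewrite divr_gt0.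
have [d d0 Hd] := H t (e / 2) t01 e2; have [d' d0' Hd'] := H' t (e / 2) t01 e2.
exists (Num.min d d'); first by rewrite lt_min d0.
move=> s s01; rewrite lt_min => /andP[/(Hd s s01) h /(Hd' s s01) h'].
have -> : phi s - phi' s - (phi t - phi' t) - (psi t - psi' t) * (s - t) =
  (phi s - phi t - psi t * (s - t)) - (phi' s - phi' t - psi' t * (s - t)) by ring.
by rewrite (le_trans (ler_normB _ _))//; lra.
Qed.

Lemma der_is_derive phi psi : (forall t, is_derive t 1 phi (psi t)) -> der phi psi.
Proof.
move=> H t e _ e0.
have [+ <-] := H t; rewrite /derivable /derive => /cvgrPdist_le/(_ e e0).
move/nbhs_ballP => [d d0 Hd]; exists d => // s _ st.
have [->|sne] := eqVneq s t; first by rewrite !subrr mulr0 subrr normr0 mulr0.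
have := Hd (s - t); rewrite /ball/= sub0r normrN subr_eq0 => /(_ st sne).
rewrite /GRing.scale/= mulr1 subrK distrC => h.
have st0 : 0 < `|s - t| by rewrite normr_gt0 subr_eq0.
rewrite -(ler_pM2r (x := `|s - t|^-1)) ?invr_gt0// mulfK ?gt_eqF// (le_trans _ h)//.
rewrite -normfV -normrM le_eqVlt; apply/orP; left; apply/eqP; congr `|_|.
set l := lim _; rewrite mulrBl mulfK ?subr_eq0// mulrC.
by congr (_ - _).
Qed.

Lemma derD phi psi phi' psi' : der phi psi -> der phi' psi' ->
  der (fun t => phi t + phi' t) (fun t => psi t + psi' t).
Proof.
move=> H H' t e t01 e0; have e2 : 0 < e / 2 by rewrite divr_gt0.
have [d d0 Hd] := H t (e / 2) t01 e2; have [d' d0' Hd'] := H' t (e / 2) t01 e2.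
exists (Num.min d d'); first by rewrite lt_min d0.
move=> s s01; rewrite lt_min => /andP[/(Hd s s01) h /(Hd' s s01) h'].
have -> : phi s + phi' s - (phi t + phi' t) - (psi t + psi' t) * (s - t) =
  (phi s - phi t - psi t * (s - t)) + (phi' s - phi' t - psi' t * (s - t)) by ring.
by rewrite (le_trans (ler_normD _ _))//; lra.
Qed.

Lemma der_taylor (c : nat -> R) (x : R) k :
  der (fun v => \sum_(i < k.+1) c i * ((v - x) ^+ i / i`!%:R))
      (fun v => \sum_(i < k) c i.+1 * ((v - x) ^+ i / i`!%:R)).
Proof.
elim: k => [|k IH].
  apply: der_is_derive => v; rewrite big_ord0.
  under [X in is_derive _ _ X _]eq_fun do rewrite big_ord1 expr0.
  exact: is_derive_cst.
pose f j v := c j * ((v - x) ^+ j / j`!%:R).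
have -> : (fun v => \sum_(i < k.+2) c i * ((v - x) ^+ i / i`!%:R)) =
    (fun v => \sum_(i < k.+1) c i * ((v - x) ^+ i / i`!%:R) + f k.+1 v).
  by apply/funext => v; rewrite big_ord_recr.
have -> : (fun v => \sum_(i < k.+1) c i.+1 * ((v - x) ^+ i / i`!%:R)) =
    (fun v => \sum_(i < k) c i.+1 * ((v - x) ^+ i / i`!%:R) + c k.+1 * ((v - x) ^+ k / k`!%:R)).
  by apply/funext => v; rewrite big_ord_recr.
apply: derD IH _; apply: der_is_derive => v; rewrite /f.
have -> : (fun v => c k.+1 * ((v - x) ^+ k.+1 / (k.+1)`!%:R)) =
    (c k.+1 / (k.+1)`!%:R) *: ((fun v => v - x) ^+ k.+1).
  apply/funext => w; rewrite exprfctE; change (c k.+1 * ((w - x) ^+ k.+1 / (k.+1)`!%:R) = (c k.+1 / (k.+1)`!%:R) * (w - x) ^+ k.+1); ring.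
have dx : is_derive v 1 (fun v : R => v - x) 1.
  by apply: is_derive_eq; rewrite subr0.
apply: is_derive_eq; rewrite factS natrM /GRing.scale/= mulr1.
field; rewrite pnatr_eq0 -lt0n fact_gt0/=.
by rewrite ?nat1r ?natr1 pnatr_eq0.
Qed.

Lemma der_derive phi psi t : der phi psi -> 0 < t < 1 -> is_derive t 1 phi (psi t).
Proof.
move=> H /andP[t0 t1].
have cv : (fun h => h^-1 *: (phi (h *: 1 + t) - phi t)) @ 0^' --> psi t.
  apply/cvgrPdist_le => e e0.
  have [|d d0 Hd] := H t e _ e0; first by rewrite !ltW.
  have t10 : 0 < 1 - t by rewrite subr_gt0.
  have m0 : 0 < Num.min d (Num.min t (1 - t)) by rewrite !lt_min d0 t0.
  near=> h.
  have h0 : h != 0 by near: h; exact: nbhs_dnbhs_neq.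
  have : `|h| < Num.min d (Num.min t (1 - t)) by near: h; exact: dnbhs0_lt.
  rewrite !lt_min => /and3P[hd ht ht1].
  have := Hd (h + t); rewrite addrK => /(_ _ hd) hh.
  have {hh} : `|phi (h + t) - phi t - psi t * h| <= e * `|h|.
    by apply: hh; move: ht ht1; rewrite !ltr_norml; lra.
  rewrite /GRing.scale/= mulr1 => hh.
  have h1 : 0 < `|h| by rewrite normr_gt0.
  rewrite distrC -(ler_pM2r h1) -normrM mulrBl mulrAC mulVf// mul1r.
  by [].
have := @DeriveDef _ _ _ t 1 phi (psi t); apply.
- by apply/cvg_ex; exists (psi t).
- exact/cvg_lim.
Unshelve. all: by end_near. Qed.

Lemma mvt_ineq_lt phi psi a b (M : R) : der phi psi -> 0 <= a -> a < b -> b <= 1 ->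
  (forall u, a <= u <= b -> `|psi u| <= M) -> `|phi b - phi a| <= M * (b - a).
Proof.
move=> H a0 ab b1 HM.
have cont t : 0 <= t <= 1 -> forall e, 0 < e -> exists2 d, 0 < d & forall s, 0 <= s <= 1 -> `|s - t| < d ->
    `|phi t - phi s| <= e.
  move=> t01 e e0; have [d d0 Hd] := H t 1 t01 ltr01.
  have M0 : 0 < `|psi t| + 1 by rewrite ltr_wpDl.
  exists (Num.min d (e / (`|psi t| + 1))); first by rewrite lt_min d0 divr_gt0.
  move=> s s01; rewrite lt_min => /andP[/(Hd s s01) h].
  rewrite ltr_pdivlMr// => h2; rewrite distrC -[phi s - phi t](subrK (psi t * (s - t))).
  rewrite (le_trans (ler_normD _ _))//.
  rewrite mul1r in h; apply: (le_trans _ (ltW h2)).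
  by rewrite (mulrDr `|s - t|) mulr1 addrC lerD// normrM mulrC.
have [||c /[!in_itv]/= cab ->] := @MVT _ phi psi a b ab.
- move=> t; rewrite in_itv/= => /andP[at_ tb]; apply: der_derive => //.
  by rewrite (le_lt_trans a0)//= (lt_le_trans tb).
- apply/continuous_within_itvP => //; split.
  + move=> t; rewrite in_itv/= => /andP[at_ tb].
    have : is_derive t 1 phi (psi t).
      by apply: der_derive => //; rewrite (le_lt_trans a0)//= (lt_le_trans tb).
    by case=> /derivable1_diffP/differentiable_continuous.
  + apply/cvgrPdist_le => e e0; have [|d d0 Hd] := cont a _ e e0; first by apply/andP; split => //; lra.
    near=> s; have sa : a < s by near: s; exact: nbhs_right_gt.
    have sb : s < b by near: s; exact: nbhs_right_lt.
    have sd : s < a + d by near: s; apply: nbhs_right_lt; rewrite ltrDl.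
    by apply: Hd; [apply/andP; split; lra|rewrite gtr0_norm ?subr_gt0//; lra].
  + apply/cvgrPdist_le => e e0; have [|d d0 Hd] := cont b _ e e0; first by apply/andP; split => //; lra.
    near=> s; have sa : a < s by near: s; exact: nbhs_left_gt.
    have sb : s < b by near: s; exact: nbhs_left_lt.
    have sd : b - d < s by near: s; apply: nbhs_left_gt; rewrite ltrBlDr ltrDl.
    by apply: Hd; [apply/andP; split; lra|rewrite ltr0_norm ?subr_lt0//; lra].
- by rewrite normrM (gtr0_norm (_ : 0 < b - a)) ?subr_gt0// ler_wpM2r ?subr_ge0 ?(ltW ab)//; apply: HM; move: cab; rewrite ?in_itv/= => /andP[? ?]; rewrite !ltW.
Unshelve. all: by end_near. Qed.

Lemma mvt_ineq phi psi x u (M : R) : der phi psi -> 0 <= x <= 1 -> 0 <= u <= 1 ->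
  (forall v, 0 <= v <= 1 -> `|v - x| <= `|u - x| -> `|psi v| <= M) ->
  `|phi u - phi x| <= M * `|u - x|.
Proof.
move=> H /andP[x0 x1] /andP[u0 u1] HM.
case: (ltgtP u x) => [ux|xu|->]; last by rewrite !subrr normr0 mulr0.
  rewrite distrC (ltr0_norm (_ : u - x < 0)) ?subr_lt0// opprB; apply: (mvt_ineq_lt H) => // v /andP[? ?].
  by apply: HM; [apply/andP; split; lra|rewrite !ler0_norm; lra].
rewrite (gtr0_norm (_ : 0 < u - x)) ?subr_gt0//; apply: (mvt_ineq_lt H) => // v /andP[? ?].
by apply: HM; [apply/andP; split; lra|rewrite !ger0_norm; lra].
Qed.

(** Induction on the order: the derivative of [phi 0] minus its Taylor polynomial is the same
    difference for [phi 1] at lower order, and the mean value inequality contributes one factor |u -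
    x|. No factorial is gained in the remainder, and none is needed. *)
Lemma taylor1 r (phi : nat -> R -> R) (x beta H : R) :
  0 <= x <= 1 -> 0 <= beta -> 0 <= H ->
  (forall i, (i < r)%N -> der (phi i) (phi i.+1)) ->
  (forall u, 0 <= u <= 1 -> `|phi r u - phi r x| <= H * powR `|u - x| beta) ->
  forall u, 0 <= u <= 1 ->
  `|phi 0%N u - \sum_(i < r.+1) phi i x * ((u - x) ^+ i / i`!%:R)| <= H * (`|u - x| ^+ r * powR `|u - x| beta).
Proof.
move=> x01 b0 H0; elim: r phi => [|r IH] phi Hd Hr u u01.
  by rewrite big_ord1 !expr0 fact0 divr1 mulr1 mul1r; exact: Hr.
pose P := fun v => \sum_(i < r.+2) phi i x * ((v - x) ^+ i / i`!%:R).
pose P' := fun v => \sum_(i < r.+1) phi i.+1 x * ((v - x) ^+ i / i`!%:R).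
have dP : der P P' by exact: (der_taylor (phi^~ x)).
have PxE : P x = phi 0%N x.
  rewrite /P big_ord_recl subrr expr0 fact0 divr1 mulr1 big1 ?addr0// => i _.
  by rewrite expr0n/= mul0r mulr0.
have := @mvt_ineq (fun v => phi 0%N v - P v) (fun v => phi 1%N v - P' v) x u
  (H * (`|u - x| ^+ r * powR `|u - x| beta)) (derB (Hd 0%N isT) dP) x01 u01.
rewrite PxE subrr subr0 exprS -!mulrA => HH.
rewrite (le_trans (HH _))//; last first.
  by rewrite le_eqVlt; apply/orP; left; apply/eqP; ring.
move=> v v01 vu.
rewrite (le_trans (IH (fun i => phi i.+1) (fun i ir => Hd i.+1 ir) Hr v v01))//.
rewrite ler_wpM2l// ler_pM ?exprn_ge0 ?powR_ge0// ?lerXn2r ?nnegrE//.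
by rewrite ge0_ler_powR// nnegrE.
Qed.

End Taylor.

(** * Taylor expansion in several variables, one coordinate at a time *)

Section MultiTaylor.
Context {R : realType}.
Variable p : nat.
Local Notation X := ('I_p -> R).

Definition setc (z : X) (j : 'I_p) (u : R) : X := fun i => if i == j then u else z i.

Definition mix (x y : X) (js : seq 'I_p) : X := fun i => if i \in js then y i else x i.

Lemma mabs_iter i (b : 'I_p -> nat) j : mabs (iter i (fun b => mbump b j) b) = (mabs b + i)%N.
Proof.
elim: i => [|i IH]; first by rewrite addn0.
rewrite iterS addnS -IH /mabs /mbump big_split/= -[RHS]addn1; congr (_ + _)%N.
by rewrite (bigD1 j)//= eqxx big1// => k /negbTE ->.
Qed.

(* Taylor polynomial of [g b] at base point [x], expanded one coordinate at a time. *)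
Fixpoint tay (g : ('I_p -> nat) -> X -> R) (x y : X) (js : seq 'I_p) (r : nat) (b : 'I_p -> nat) : R :=
  match js with
  | [::] => g b x
  | j :: js' => \sum_(i < r.+1)
      tay g x y js' (r - i) (iter i (fun b => mbump b j) b) * ((y j - x j) ^+ i / i`!%:R)
  end.

Lemma cube_setc (z : X) j u : cube z -> 0 <= u <= 1 -> cube (setc z j u).
Proof. by move=> cz u01 i; rewrite /setc; case: eqP. Qed.

Lemma cube_mix (x y : X) js : cube x -> cube y -> cube (mix x y js).
Proof. by move=> cx cy i; rewrite /mix; case: ifP. Qed.

Lemma dist_setc (z : X) j u v : dist_inf (setc z j u) (setc z j v) <= `|u - v|.
Proof.
rewrite /dist_inf; apply: bigmax_le => // i _; rewrite /setc; case: eqP => // _.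
by rewrite subrr normr0.
Qed.

Lemma dist_inf_ge0 (x y : X) : 0 <= dist_inf x y.
Proof. by rewrite /dist_inf; apply: bigmax_ge_id. Qed.

Lemma der_coord (g g' : X -> R) (z : X) j : cube z ->
  (forall x, cube x -> (fun h => (g (Defs.shift x j h) - g x) / h)
     @ within (fun h : R => cube (Defs.shift x j h)) (0 : R)^' --> g' x) ->
  der (fun u => g (setc z j u)) (fun u => g' (setc z j u)).
Proof.
move=> cz H t e t01 e0.
have := H _ (cube_setc j cz t01) => /cvgrPdist_le/(_ e e0).
rewrite near_withinE => /nbhs_ballP[d d0 Hd]; exists d => // s s01 st.
have [->|sne] := eqVneq s t; first by rewrite !subrr mulr0 subrr normr0 mulr0.
have E : Defs.shift (setc z j t) j (s - t) = setc z j s.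
  by apply/funext => i; rewrite /Defs.shift /setc; case: eqP => // _; rewrite addrC subrK.
have := Hd (s - t); rewrite /ball/= sub0r normrN subr_eq0 => /(_ st sne).
rewrite E => /(_ (cube_setc j cz s01)) h.
have st0 : 0 < `|s - t| by rewrite normr_gt0 subr_eq0.
rewrite -(ler_pM2r (x := `|s - t|^-1)) ?invr_gt0// mulfK ?gt_eqF// (le_trans _ h)//.
rewrite -normfV -normrM -normrN le_eqVlt; apply/orP; left; apply/eqP; congr `|_|.
by rewrite mulrBl mulfK ?subr_eq0// opprB.
Qed.

Section Bound.
Variables (m : nat) (g : ('I_p -> nat) -> X -> R) (K beta : R).
Hypothesis K0 : 0 <= K.
Hypothesis beta0 : 0 < beta.
Hypothesis gder : forall b j x, (mabs b < m)%N -> cube x ->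
  (fun h => (g b (Defs.shift x j h) - g b x) / h)
    @ within (fun h : R => cube (Defs.shift x j h)) (0 : R)^' --> g (mbump b j) x.
Hypothesis ghol : forall b x y, mabs b = m -> cube x -> cube y ->
  `|g b x - g b y| <= K * powR (dist_inf x y) beta.

(** Error constant after [n] coordinates: [K] for the one-dimensional remainder of the new
    coordinate, plus the earlier constant once for each of at most [m.+1] coefficients. *)
Definition tayC n : R := iter n (fun C => K + m.+1%:R * C) 0.

Lemma tayC_ge0 n : 0 <= tayC n.
Proof. by elim: n => //= n IH; rewrite addr_ge0// mulr_ge0. Qed.

(** The coordinates of [x] are switched to those of [y] one by one. Each switch is a one-dimensional
    expansion whose coefficients are derivatives at the previous mixed point, and these are expanded
    further by the induction hypothesis. *)
Lemma tay_bound (x y : X) (d : R) js r b : cube x -> cube y -> uniq js -> 0 <= d ->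
  (forall i, `|y i - x i| <= d) -> (mabs b + r = m)%N ->
  `|g b (mix x y js) - tay g x y js r b| <= tayC (size js) * (d ^+ r * powR d beta).
Proof.
move=> cx cy + d0 xyd; elim: js r b => [|j js IH] r b /=.
  move=> _ _; have -> : mix x y [::] = x by apply/funext => i.
  by rewrite subrr normr0 mul0r.
move=> /andP[jjs ujs] br.
set z := mix x y js; have cz : cube z by exact: cube_mix.
have zj : setc z j (x j) = z.
  by apply/funext => i; rewrite /setc; case: eqP => // ->; rewrite /z /mix (negbTE jjs).
have zy : setc z j (y j) = mix x y (j :: js).
  by apply/funext => i; rewrite /setc /z /mix inE; case: eqP => // ->.
pose phi i u := g (iter i (fun b => mbump b j) b) (setc z j u).
have dphi i : (i < r)%N -> der (phi i) (phi i.+1).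
  move=> ir; apply: (@der_coord (g (iter i (fun b => mbump b j) b)) (g (iter i.+1 (fun b => mbump b j) b)) z j cz) => w cw; apply: gder => //.
  by rewrite mabs_iter -br ltn_add2l.
have hphi u : 0 <= u <= 1 -> `|phi r u - phi r (x j)| <= K * powR `|u - x j| beta.
  move=> u01; have cxj := cx j.
  rewrite (le_trans (ghol _ _ _)) ?mabs_iter//; try exact: cube_setc.
  rewrite ler_wpM2l// ge0_ler_powR ?(ltW beta0)// ?nnegrE ?dist_inf_ge0//.
  exact: dist_setc.
have := taylor1 (cx j) (ltW beta0) K0 dphi hphi (cy j).
rewrite /phi/= zy => h1.
have h2 : `|\sum_(i < r.+1) g (iter i (fun b => mbump b j) b) (setc z j (x j)) * ((y j - x j) ^+ i / i`!%:R)
    - \sum_(i < r.+1) tay g x y js (r - i) (iter i (fun b => mbump b j) b) * ((y j - x j) ^+ i / i`!%:R)| <=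
    m.+1%:R * tayC (size js) * (d ^+ r * powR d beta).
  rewrite -sumrB zj (le_trans (ler_norm_sum _ _ _))//.
  apply: (@le_trans _ _ (\sum_(i < r.+1) tayC (size js) * (d ^+ r * powR d beta))).
    apply: ler_sum => i _; rewrite -mulrBl normrM.
    have ir : (i <= r)%N by rewrite -ltnS.
    have bi : (mabs (iter i (fun b => mbump b j) b) + (r - i) = m)%N.
      by rewrite mabs_iter -addnA subnKC.
    have := IH (r - i)%N _ ujs bi => h.
    apply: (@le_trans _ _ (tayC (size js) * (d ^+ (r - i) * powR d beta) * d ^+ i)).
      apply: ler_pM => //.
      rewrite normrM normfV normrX (ger0_norm (_ : 0 <= i`!%:R))//.
      rewrite ler_pdivrMr ?ltr0n ?fact_gt0//.
      rewrite -[leLHS]mulr1 ler_pM// ?exprn_ge0//; first by rewrite lerXn2r ?nnegrE.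
      by rewrite ler1n fact_gt0.
    by rewrite -[in leRHS](subnK ir) exprD le_eqVlt; apply/orP; left; apply/eqP; ring.
  rewrite sumr_const card_ord -[leLHS]mulr_natl -mulrA ler_wpM2r//.
    by rewrite mulr_ge0 ?tayC_ge0// mulr_ge0 ?exprn_ge0 ?powR_ge0.
  by rewrite ler_nat ltnS -br leq_addl.
have h3 : K * (`|y j - x j| ^+ r * powR `|y j - x j| beta) <= K * (d ^+ r * powR d beta).
  rewrite ler_wpM2l// ler_pM ?exprn_ge0 ?powR_ge0// ?lerXn2r ?nnegrE//.
  by rewrite ge0_ler_powR ?(ltW beta0)// nnegrE.
have := lerD (le_trans h1 h3) h2; rewrite -mulrDl; apply: le_trans; exact: ler_distD.
Qed.

End Bound.

(** The Taylor polynomial is a sum of products of coefficients and increments, the number of terms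
    not depending on n; closure under sums, products and powers applies. *)
Lemma cheap_tay (K : nat -> nat) (Xs xb : forall n, 'I_n -> X) (g : ('I_p -> nat) -> X -> R) m js r b :
  (forall n, (0 < K n)%N) ->
  (forall b, (mabs b <= m)%N -> cheap K Xs (fun n i => g b (xb n i))) ->
  (forall j, cheap K Xs (fun n i => Xs n i j - xb n i j)) ->
  (mabs b + r <= m)%N ->
  cheap K Xs (fun n i => tay g (xb n i) (Xs n i) js r b).
Proof.
move=> K0 gC xC; elim: js r b => [|j js IH] r b br.
  by apply: gC; apply: leq_trans br; exact: leq_addr.
apply: cheap_sum => // i; apply: cheap_mul => //.
  by apply: IH; rewrite mabs_iter -addnA subnKC// -ltnS.
apply: (cheap_ext (v := fun n k => (i`!%:R)^-1 * (Xs n k j - xb n k j) ^+ i)) => [n k|].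
  by rewrite mulrC.
by apply: cheap_scale; apply: cheap_exp.
Qed.

End MultiTaylor.

(** * Steep slopes in constant depth, and thresholds that avoid the design points *)

Section Leaves.
Context {R : realType}.
Variable p : nat.
Local Notation X := ('I_p -> R).

Lemma flayer_nnz W c e (J I : finType) (Psi : J -> X -> R) (a : I -> J -> R) (b : I -> R) Phi :
  (#|I| <= W)%N -> (forall i j, `|a i j| <= 1) -> (forall i, `|b i| <= 1) ->
  (forall i, \sum_j (a i j != 0%R) <= e)%N -> (#|I| * e.+1 <= c)%N ->
  (forall i x, Phi i x = relu (\sum_j a i j * Psi j x + b i)) ->
  flayer W c Psi Phi.
Proof.
move=> h1 h2 h3 h4 h5 h6; exists a, b; split => //.
rewrite (leq_trans _ h5)// mulnS addnC leq_add2l -sum_nat_const.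
by apply: leq_sum => i _.
Qed.

Lemma sum_nnz_le (J : finType) (a : J -> R) : (\sum_j (a j != 0%R) <= #|J|)%N.
Proof. by rewrite -[leqRHS]muln1 -sum_nat_const; apply: leq_sum => j _; exact: leq_b1. Qed.

(** The index [None] carries the amplified constant [S], so that S (x_j - t) is a combination of two
    features with weights 1 and -t, all bounded by 1. *)
Definition ampf (S : R) (o : option 'I_p) (x : X) : R :=
  if o is Some j then S * relu (x j) else S.

(* Constant depth suffices to amplify by a power of K, since each sum of K copies gains a factor K. *)
Lemma feat_amp (K a : nat) : (0 < K)%N ->
  feat ((p.+1 ^ 2 * 3) * K) (2 * a) ((p.+1 ^ 2 * (3 + 6 * a)) * K) (ampf (K ^ a)%:R).
Proof.
move=> K0; elim: a => [|a IH].
  rewrite muln0 /=; apply: (@flayer_nnz _ _ p 'I_p _ _ (fun o i => if o is Some j then (i == j)%:R else 0)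
    (fun o => if o is Some j then 0 else 1)).
  - rewrite card_option card_ord; nia.
  - by move=> [j|] i; rewrite ?normr0//; case: (i == j); rewrite ?normr1 ?normr0.
  - by move=> [j|]; rewrite ?normr1 ?normr0.
  - by move=> o; rewrite (leq_trans (sum_nnz_le _))// card_ord.
  - by rewrite card_option card_ord; nia.
  - move=> [j|] x; rewrite /ampf expn0.
      rewrite (bigD1 j)//= eqxx mul1r mul1r big1 ?addr0// => i /negbTE ->; by rewrite mul0r.
    by rewrite big1 ?add0r ?relu_id// => i _; rewrite mul0r.
have S0 : 0 <= (K ^ a)%:R :> R by [].
have amp0 o x : 0 <= ampf (K ^ a)%:R o x.
  by case: o => [j|] //=; rewrite mulr_ge0 ?relu_ge0.
pose cp (z : option 'I_p * 'I_K) (x : X) : R := ampf (K ^ a)%:R z.1 x.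
have f1 : flayer ((p.+1 ^ 2 * 3) * K) (p.+1 ^ 2 * 2 * K) (ampf (K ^ a)%:R) cp.
  apply: (@flayer_nnz _ _ 1 _ _ _ (fun z o => (o == z.1)%:R) (fun=> 0)).
  - rewrite card_prod card_option !card_ord; nia.
  - by move=> z o; case: (o == z.1); rewrite ?normr1 ?normr0.
  - by move=> z; rewrite normr0.
  - move=> z; rewrite -[leqRHS](sum_pred1 z.1); apply: leq_sum => o _.
    by case: (o == z.1); rewrite /= ?eqxx ?oner_neq0.
  - by rewrite card_prod card_option !card_ord; nia.
  - move=> z x; rewrite addr0 (bigD1 z.1)//= eqxx mul1r big1 ?addr0 ?relu_id//.
    by move=> o /negbTE ->; rewrite mul0r.
have f2 : flayer ((p.+1 ^ 2 * 3) * K) (p.+1 ^ 2 * 4 * K) cp (ampf (K ^ a.+1)%:R).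
  apply: (@flayer_nnz _ _ (p.+1 * K) _ _ _ (fun o z => (z.1 == o)%:R) (fun=> 0)).
  - rewrite card_option !card_ord; nia.
  - by move=> o z; case: (z.1 == o); rewrite ?normr1 ?normr0.
  - by move=> z; rewrite normr0.
  - by move=> o; rewrite (leq_trans (sum_nnz_le _))// card_prod card_option !card_ord.
  - by rewrite card_option !card_ord; nia.
  - move=> o x; rewrite addr0.
    rewrite -(pair_bigA _ (fun o' (k : 'I_K) => (o' == o)%:R * cp (o', k) x))/=.
    rewrite (bigD1 o)//= [X in _ + X]big1 ?addr0; last first.
      by move=> o' /negbTE ->; rewrite big1// => k _; rewrite mul0r.
    rewrite eqxx; under eq_bigr do rewrite mul1r /cp/=.
    rewrite sumr_const card_ord relu_id ?mulrn_wge0// -[RHS]mulr_natl.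
    by case: o => [j|] /=; rewrite expnS natrM ?mulrA.
have := feat_step (feat_step IH f1) f2.
rewrite (_ : (2 * a).+2 = 2 * a.+1)%N; last by rewrite mulnS addnC addn2.
apply: feat_mono => //; nia.
Qed.

(** Pigeonhole: [n] points cannot meet all of [n.+1] disjoint open intervals. *)
Lemma gap_exists n (y : 'I_n -> R) (a w : R) : 0 < w ->
  exists r : 'I_n.+1, forall l, ~ (a + r%:R * w < y l < a + r.+1%:R * w).
Proof.
move=> w0; apply: contrapT => H.
have H' (r : 'I_n.+1) : exists l, a + r%:R * w < y l < a + r.+1%:R * w.
  apply: contrapT => H'; apply: H; exists r => l Hl; apply: H'; by exists l.
pose f r := projT1 (cid (H' r)).
have fP (r : 'I_n.+1) : a + r%:R * w < y (f r) < a + r.+1%:R * w by exact: projT2 (cid (H' r)).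
have fi : injective f.
  move=> r r' E; apply/val_inj/eqP.
  have := fP r; rewrite E; move: (y (f r')) (fP r') => z /andP[h1 h2] /andP[h3 h4].
  have lt1 (i j : nat) : a + i%:R * w < z -> z < a + j.+1%:R * w -> (i <= j)%N.
    by move=> /lt_trans/[apply]; rewrite ltrD2l ltr_pM2r// ltr_nat ltnS.
  by rewrite eqn_leq !(lt1 _ _ h1, lt1 _ _ h3)//.
by have := leq_card f fi; rewrite !card_ord ltnn.
Qed.

Lemma step_index (P : pred nat) q : (0 < q)%N -> P 0%N -> ~~ P q ->
  (forall i, (i < q)%N -> P i.+1 -> P i) ->
  exists2 k, (k < q)%N & forall i, (i <= q)%N -> P i = (i <= k)%N.
Proof.
move=> + P0; elim: q => // q IH _ Pq Pd.
case Pq' : (P q).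
  exists q => // i; rewrite leq_eqVlt => /orP[/eqP ->|]; first by rewrite (negbTE Pq) ltnn.
  rewrite ltnS => iq; rewrite iq; apply/idP.
  have : forall j, (j <= q)%N -> P (q - j)%N.
    elim=> [|j IHj] jq; first by rewrite subn0 Pq'.
    apply: Pd; first by rewrite ltnS leq_subr.
    by rewrite -subSn// subSS IHj// ltnW.
  by move=> /(_ (q - i)%N (leq_subr _ _)); rewrite subKn.
have q0 : (0 < q)%N by case: q Pq' {IH Pq Pd} => //; rewrite P0.
have [|i iq|k kq kP] := IH q0; first by rewrite Pq'.
  by apply: Pd; exact: ltnW.
exists k => [|i]; first exact: ltnW.
rewrite leq_eqVlt => /orP[/eqP ->|]; last by rewrite ltnS; exact: kP.
by rewrite (negbTE Pq) leqNgt ltnW.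
Qed.

(* Grid thresholds perturbed so that no design point falls in the region where a steep step is neither 0 nor 1. *)
Lemma thresholds n (y : 'I_n -> X) (q : nat) (S : R) : (0 < q)%N -> (q * n.+1)%:R <= S ->
  (forall l, cube (y l)) ->
  exists (t : 'I_p -> nat -> R) (kap : 'I_n -> {ffun 'I_p -> 'I_q}),
    [/\ forall j i, (i <= q)%N -> `|t j i| <= 1,
        (forall l j i, (i <= q)%N -> (i <= kap l j)%N -> S * (y l j - t j i) >= 1),
        (forall l j i, (i <= q)%N -> ~~ (i <= kap l j)%N -> S * (y l j - t j i) <= 0) &
        forall l j, (kap l j)%:R / q%:R <= y l j <= (kap l j)%:R / q%:R + 2 / q%:R].
Proof.
move=> q0 qS cy; have q0R : 0 < q%:R :> R by rewrite ltr0n.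
(* Each cell side 1/q is divided into [n.+1] intervals of width [w]; the slope [S] is large enough
   for a ramp to climb from 0 to 1 within one of them. *)
pose w : R := 1 / (q * n.+1)%:R.
have w0 : 0 < w by rewrite divr_gt0// ltr0n muln_gt0 q0.
have S0 : 0 < S by apply: lt_le_trans qS; rewrite ltr0n muln_gt0 q0.
have Sw : 1 <= S * w by rewrite /w mulrA mulr1 ler_pdivlMr ?mul1r// ltr0n muln_gt0 q0.
have nw : n.+1%:R * w = 1 / q%:R.
  by rewrite /w natrM mul1r mul1r invfM mulrCA divff ?mulr1.
pose r j i := projT1 (cid (gap_exists (fun l => y l j) (i%:R / q%:R) w0)).
have rP j i l : ~ (i%:R / q%:R + (r j i)%:R * w < y l j < i%:R / q%:R + (r j i).+1%:R * w).
  exact: projT2 (cid (gap_exists (fun l => y l j) (i%:R / q%:R) w0)) l.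
(* The extreme thresholds -1 and 1 are conventions for points of [0,1]: threshold 0 is always passed
   and threshold [q] never. *)
pose t j i : R := if i == 0%N then -1 else if (i < q)%N then i%:R / q%:R + (r j i)%:R * w else 1.
have tmid j i : (0 < i < q)%N -> i%:R / q%:R <= t j i /\ t j i + w <= i.+1%:R / q%:R.
  case/andP => i0 iq; rewrite /t gtn_eqF// iq; split.
    by rewrite lerDl mulr_ge0// ltW.
  rewrite -addrA -{2}[w]mul1r -mulrDl -[i.+1%:R]natr1 (mulrDl i%:R) lerD2l -nw ler_wpM2r ?(ltW w0)//.
  by rewrite natr1 ler_nat.
have gap l j i : (i <= q)%N -> (t j i < y l j)%R -> t j i + w <= y l j.
  move=> iq; rewrite leNgt => H; apply/negP => H2; move: H H2 (rP j i l).
  have /andP[y0 y1] := cy l j.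
  rewrite /t; case: eqP => [_ _ H|_].
    have w1 : w <= 1.
      by rewrite /w ler_pdivrMr ?mul1r ?ler1n ?ltr0n muln_gt0 q0.
    by move: H; lra.
  case: ifP => _ h1 h2; last by move: h1; lra.
  apply; rewrite h1/= (lt_le_trans h2)// -addrA -{2}[w]mul1r -mulrDl natr1.
  by [].
have kE l j : exists2 k, (k < q)%N & forall i, (i <= q)%N -> (t j i < y l j) = (i <= k)%N.
  have /andP[y0 y1] := cy l j.
  apply: (step_index (P := fun i => t j i < y l j)) => //.
  - by rewrite /t eqxx (lt_le_trans _ y0)// oppr_lt0.
  - by rewrite /t gtn_eqF// ltnn -leNgt.
  - move=> i iq; apply: le_lt_trans.
    have [->|i0] := posnP i.
      rewrite {1}/t eqxx; have [q1|q1] := ltnP 1 q.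
        by have [h _] := tmid j 1%N q1; rewrite (le_trans _ h)// (@le_trans _ _ 0)// ?oppr_le0// divr_ge0.
      by rewrite /t/= ltnNge q1/= (@le_trans _ _ 0)// oppr_le0.
    have [_ h] := tmid j i (introT andP (conj i0 iq)).
    have [i1q|i1q] := ltnP i.+1 q.
      have [h' _] := tmid j i.+1 i1q; rewrite (le_trans _ h')// (le_trans _ h)// lerDl; exact: ltW.
    have E : i.+1 = q by apply/eqP; rewrite eqn_leq iq.
    rewrite {2}/t E ltnn gtn_eqF//; rewrite E divff ?gt_eqF// in h.
    by rewrite (le_trans _ h)// lerDl ltW.
pose k l j := projT1 (cid2 (kE l j)).
have kq l j : (k l j < q)%N by rewrite /k; case: (cid2 _).
have kP l j i : (i <= q)%N -> (t j i < y l j) = (i <= k l j)%N by rewrite /k; case: (cid2 _) => /= ? ? ; apply.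
exists t, (fun l => [ffun j => Ordinal (kq l j)]); split.
- move=> j i iq; have [i0|i0] := posnP i; first by rewrite /t i0 eqxx normrN normr1.
  have [iq'|iq'] := ltnP i q; last by rewrite /t gtn_eqF// ltnNge iq' normr1.
  have [h1 h2] := tmid j i (introT andP (conj i0 iq')).
  rewrite ger0_norm ?(le_trans _ h1) ?divr_ge0//.
  have : i.+1%:R / q%:R <= 1 :> R by rewrite ler_pdivrMr// mul1r ler_nat.
  lra.
- move=> l j i iq; rewrite ffunE/= -kP// => h.
  rewrite (le_trans Sw)// ler_wpM2l ?(ltW S0)//.
  have := gap l j i iq h; lra.
- move=> l j i iq; rewrite ffunE/= -kP// -leNgt => h.
  by rewrite mulr_ge0_le0 ?(ltW S0)// subr_le0.
- move=> l j; rewrite ffunE/=; have /andP[y0 y1] := cy l j; apply/andP; split.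
    have [->|k0] := posnP (k l j); first by rewrite mul0r.
    have [h _] := tmid j (k l j) (introT andP (conj k0 (kq l j))).
    by rewrite (le_trans h)// ltW// kP// ltnW.
  rewrite -mulrDl; have [E|E] := ltnP (k l j).+1 q.
    have [_ h] := tmid j (k l j).+1 E.
    have : ~~ (t j (k l j).+1 < y l j) by rewrite kP ?ltnn// ltnW.
    rewrite -leNgt => h2; rewrite (le_trans h2)//.
    rewrite -(addn2 (k l j)) natrD in h.
    by apply: le_trans h; rewrite lerDl ltW.
  rewrite (le_trans y1)// ler_pdivlMr// mul1r -natrD ler_nat addn2.
  by rewrite (leq_trans E).
Unshelve. all: try exact: 0. Qed.

End Leaves.

(** * Piecewise Taylor approximation of a Hoelder function at the design points *)

Section Approximation.
Context {R : realType}.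
Variable p : nat.
Local Notation X := ('I_p -> R).
Hypothesis p0 : (0 < p)%N.
Variables (q : nat -> nat) (Xs : forall n, 'I_n -> X) (a n1 : nat).
Hypothesis q0 : forall n, (0 < q n)%N.
Hypothesis cX : forall n (i : 'I_n), cube (Xs i).
Hypothesis qa : forall n, (n1 <= n)%N -> (q n * n.+1 <= (q n ^ p) ^ a)%N.
Let K n := (q n ^ p)%N.

Lemma sum_pairE (I J : finType) (f : I * J -> R) : \sum_z f z = \sum_i \sum_j f (i, j).
Proof. by rewrite pair_bigA/=; apply: eq_bigr => -[]. Qed.

Lemma nsum_pairE (I J : finType) (f : I * J -> nat) :
  (\sum_z f z = \sum_i \sum_j f (i, j))%N.
Proof. by rewrite pair_bigA/=; apply: eq_bigr => -[]. Qed.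

Lemma sum_leq_ord c N : (c < N)%N -> (\sum_(k < N) (k <= c))%N = c.+1.
Proof.
move=> cN; rewrite -[RHS]card_ord -sum1_card (big_ord_widen N (fun=> 1%N))// [RHS]big_mkcond.
by apply: eq_bigr => k _; rewrite ltnS; case: (k <= c)%N.
Qed.

Lemma Kpos n : (0 < K n)%N. Proof. by rewrite expn_gt0 q0. Qed.

Lemma qK n : (q n <= K n)%N.
Proof. by rewrite /K -[leqLHS]expn1 leq_pexp2l. Qed.

(** Stated for every [n], with arbitrary values below [n1], so that thresholds and cells can be
    chosen as total functions of [n]. *)
Lemma thr_ex n : exists tk : ('I_p -> nat -> R) * ('I_n -> {ffun 'I_p -> 'I_(q n)}),
  (n1 <= n)%N ->
    [/\ forall j i, (i <= q n)%N -> `|tk.1 j i| <= 1,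
        (forall l j i, (i <= q n)%N -> (i <= tk.2 l j)%N -> (K n ^ a)%:R * (Xs l j - tk.1 j i) >= 1),
        (forall l j i, (i <= q n)%N -> ~~ (i <= tk.2 l j)%N -> (K n ^ a)%:R * (Xs l j - tk.1 j i) <= 0) &
        forall l j, (tk.2 l j)%:R / (q n)%:R <= Xs l j <= (tk.2 l j)%:R / (q n)%:R + 2 / (q n)%:R].
Proof.
have [nn|nn] := leqP n1 n; last first.
  by exists (fun _ _ => 0, fun _ => [ffun _ => Ordinal (q0 n)]).
have [|t [k H]] := @thresholds R p n (@Xs n) (q n) (K n ^ a)%:R (q0 n) _ (@cX n).
  by rewrite ler_nat; exact: qa.
by exists (t, k).
Qed.

Definition thr n := (projT1 (cid (thr_ex n))).1.
Definition cell n := (projT1 (cid (thr_ex n))).2.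
Definition base n (l : 'I_n) : X := fun j => (cell l j)%:R / (q n)%:R.

Lemma base_cube n l : cube (@base n l).
Proof.
move=> j; rewrite /base divr_ge0//= ler_pdivrMr ?ltr0n// mul1r ler_nat.
exact/ltnW/ltn_ord.
Qed.

Lemma base_near n (l : 'I_n) j : (n1 <= n)%N -> `|Xs l j - base l j| <= 2 / (q n)%:R.
Proof.
move=> nn; have [_ _ _ /(_ l j)/andP[h1 h2]] := projT2 (cid (thr_ex n)) nn.
by rewrite /base /cell ger0_norm ?subr_ge0// lerBlDl.
Qed.

(** For each coordinate and threshold there are two units, relu(S (x_j - t)) and relu(S (x_j - t) -
    1). Their difference is a ramp clipped to [0,1], which takes only the values 0 and 1 at design
    points. *)
Definition stepf n (z : ('I_p * 'I_(q n).+1) * bool) (x : X) : R :=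
  relu (\sum_o (if o is Some j then (j == z.1.1)%:R else - thr n z.1.1 z.1.2) *
    ampf (K n ^ a)%:R o x + - z.2%:R).

Lemma stepf_diff n (l : 'I_n) j (i : 'I_(q n).+1) : (n1 <= n)%N ->
  stepf ((j, i), false) (Xs l) - stepf ((j, i), true) (Xs l) = (i <= cell l j)%:R.
Proof.
move=> nn; have [_ h1 h2 _] := projT2 (cid (thr_ex n)) nn.
have E b : stepf ((j, i), b) (Xs l) = relu ((K n ^ a)%:R * (Xs l j - thr n j i) - b%:R).
  rewrite /stepf; congr (relu (_ - _)).
  rewrite (bigD1 None)//= (bigD1 (Some j))//= eqxx big1 ?addr0; last first.
    move=> [j'|]//= jj; have -> : (j' == j) = false by apply: contraNF jj => /eqP ->.
    by rewrite mul0r.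
  by rewrite relu_id; [rewrite (_ : true%:R = 1 :> R)//; ring|have /andP[] := cX l j].
rewrite !E subr0; have [ik|ik] := boolP (i <= cell l j)%N.
  have := h1 l j i (ltn_ord i) ik; rewrite -/(thr n) => h.
  by rewrite !relu_id ?subr_ge0// ?(le_trans _ h)// opprB addrC subrK.
have := h2 l j i (ltn_ord i) ik; rewrite -/(thr n) => h.
by rewrite !relu_0 ?subrr// subr_le0 (le_trans h).
Qed.

Let c1 := (p.+1 ^ 2 * (3 + 6 * a) + 8 * p.+1 ^ 2)%N.

Lemma feat_stepf n : (n1 <= n)%N -> feat (c1 * K n) (2 * a).+1 (c1 * K n) (@stepf n).
Proof.
move=> nn; have [h0 _ _ _] := projT2 (cid (thr_ex n)) nn.
have k0 := Kpos n; have qk := qK n; have q1 := q0 n.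
have f1 : feat (c1 * K n) (2 * a) ((p.+1 ^ 2 * (3 + 6 * a)) * K n) (ampf (R := R) (p := p) (K n ^ a)%:R).
  by apply: feat_mono (feat_amp _ _ k0) => //; rewrite leq_mul2r /c1; apply/orP; right; nia.
have E : (c1 * K n = (p.+1 ^ 2 * (3 + 6 * a)) * K n + (8 * p.+1 ^ 2) * K n)%N by rewrite -mulnDl.
rewrite {2}E; apply: feat_step f1 _.
apply: (@flayer_nnz _ _ _ _ p.+1 (option 'I_p) _ _
  (fun (z : 'I_p * 'I_(q n).+1 * bool) (o : option 'I_p) =>
    if o is Some j then (j == z.1.1)%:R else - thr n z.1.1 z.1.2)
  (fun z => - z.2%:R)) => //.
- rewrite !card_prod !card_ord card_bool /c1.
  have : (p * (q n).+1 * 2 <= 4 * p * K n)%N by nia.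
  by move/leq_trans; apply; rewrite leq_mul2r; apply/orP; right; nia.
- move=> z [j|]; first by case: (_ == _); rewrite ?normr1 ?normr0.
  by rewrite normrN; apply: h0; rewrite -ltnS.
- by move=> [[j i] []]; rewrite normrN ?normr1 ?normr0.
- by move=> z; rewrite (leq_trans (sum_nnz_le _))// card_option card_ord.
- rewrite !card_prod !card_ord card_bool.
  have : (p * (q n).+1 * 2 <= 4 * p * K n)%N by nia.
  move=> h; apply: (@leq_trans (4 * p * K n * p.+2)); first by rewrite leq_mul2r h orbT.
  by rewrite mulnAC leq_mul2r; apply/orP; right; nia.
Qed.

Lemma cheap_coord j : cheap K (@Xs) (fun n i => Xs i j).
Proof.
exists 1, 0%N, 2%N, 0%N => n _.
exists unit, (fun _ x => relu (\sum_i (i == j)%:R * x i + 0)), (fun _ => 1), 0.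
have E (x : X) : \sum_i (i == j)%:R * x i = x j.
  by rewrite (bigD1 j)//= eqxx mul1r big1 ?addr0// => i /negbTE ->; rewrite mul0r.
split.
- apply: (@flayer_nnz _ _ _ _ 1 _ _ _ (fun _ i => (i == j)%:R) (fun=> 0)) => //.
  + by rewrite card_unit muln_gt0 Kpos.
  + by move=> _ i; case: (_ == _); rewrite ?normr1 ?normr0.
  + by move=> _; rewrite normr0.
  + move=> _; rewrite -[leqRHS](sum_pred1 j); apply: leq_sum => i _.
    by case: (i == j); rewrite /= ?eqxx ?oner_neq0.
  + by rewrite card_unit mul1n leq_pmulr// Kpos.
- by move=> _; rewrite normr1.
- by rewrite normr0.
- by move=> i; have /andP[h1 h2] := cX i j; rewrite ger0_norm.
- move=> i; rewrite (big_pred1 tt) => [|[]//]; rewrite E !addr0 mul1r relu_id ?subrr ?normr0 ?divr_ge0//.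
  by have /andP[] := cX i j.
Qed.

(** The number of thresholds passed in coordinate [j] is the cell index plus one, because threshold
    0 is always passed; hence the constant term -1/q. *)
Lemma cheap_base j : cheap K (@Xs) (fun n i => base i j).
Proof.
exists 1, (2 * a).+1, c1, n1 => n nn; have q1 := q0 n.
have q0R : 0 < (q n)%:R :> R by rewrite ltr0n.
have q1R : `|1 / (q n)%:R| <= 1 :> R.
  by rewrite ger0_norm ?divr_ge0// ler_pdivrMr// mul1r ler1n.
exists _, (@stepf n), (fun z => (z.1.1 == j)%:R * (if z.2 then -1 else 1) * (1 / (q n)%:R)), (- (1 / (q n)%:R)).
split.
- exact: feat_stepf.
- move=> z; rewrite normrM (le_trans _ q1R)// ler_piMl//.
  by case: (_ == _); case: z.2; rewrite ?mul0r ?mul1r ?normrN ?normr1 ?normr0.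
- by rewrite normrN.
- by move=> i; have /andP[? ?] := base_cube i j; rewrite ger0_norm.
- move=> i.
  have -> : \sum_z (z.1.1 == j)%:R * (if z.2 then -1 else 1) * (1 / (q n)%:R) * @stepf n z (Xs i) =
     (cell i j).+1%:R * (1 / (q n)%:R).
    rewrite !sum_pairE.
    rewrite (bigD1 j)//= [X in _ + X]big1 ?addr0; last first.
      move=> j' /negbTE ->; rewrite big1// => k _; rewrite big1// => b _.
      by rewrite !mul0r.
    transitivity (\sum_(k < (q n).+1) (k <= cell i j)%:R * (1 / (q n)%:R) : R).
      apply: eq_bigr => k _; rewrite -stepf_diff// big_bool/= eqxx (_ : true%:R = 1 :> R)//; ring.
    by rewrite -mulr_suml -natr_sum sum_leq_ord// ltnS ltnW.
  have E : (cell i j).+1%:R * (1 / (q n)%:R) - 1 / (q n)%:R - base i j = 0.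
    by rewrite /base -natr1; ring.
  by rewrite E normr0 divr_ge0.
Qed.


Lemma sum_pick N (c : 'I_N) (f : 'I_N -> R) : \sum_i (val i == val c)%:R * f i = f c.
Proof.
rewrite (bigD1 c)//= eqxx mul1r big1 ?addr0// => i ic.
by rewrite (_ : (val i == val c) = false) ?mul0r//; apply: contraNF ic => /eqP/val_inj ->.
Qed.

Lemma sum_nat_eq_le N c : (\sum_(i < N) (val i == c) <= 1)%N.
Proof.
have [cN|cN] := ltnP c N.
  rewrite -[leqRHS](sum_pred1 (Ordinal cN)); apply: leq_sum => i _.
  by rewrite -val_eqE.
by rewrite big1// => i _; rewrite ltn_eqF// (leq_trans (ltn_ord i)).
Qed.

(** The steps at thresholds k_j and k_j + 1 differ by the indicator that coordinate j lies in cell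
    k_j. The factor z.2 selects the sign inside a ramp pair, and division by [p] keeps the weights
    at most 1 in absolute value. *)
Definition cellw n (k : {ffun 'I_p -> 'I_(q n)}) (z : ('I_p * 'I_(q n).+1) * bool) : R :=
  (if z.2 then -1 else 1) *
  ((val z.1.2 == k z.1.1)%:R - (val z.1.2 == (k z.1.1).+1)%:R) / p%:R.

(** A conjunction gate: the average of [p] indicators minus (p-1)/p is positive, and then equal to
    1/p, only when all of them are 1. *)
Definition cellf n (k : {ffun 'I_p -> 'I_(q n)}) (x : X) : R :=
  relu (\sum_z cellw k z * @stepf n z x + - (p.-1%:R / p%:R)).

Let p0R : 0 < p%:R :> R. Proof. by rewrite ltr0n. Qed.

Lemma cellf_val n (l : 'I_n) k : (n1 <= n)%N -> cellf k (Xs l) = (k == cell l)%:R / p%:R.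
Proof.
move=> nn; rewrite /cellf.
have -> : \sum_z cellw k z * @stepf n z (Xs l) = (\sum_j (k j == cell l j)%:R) / p%:R.
  rewrite !sum_pairE mulr_suml; apply: eq_bigr => j _.
  have kq := ltn_ord (k j).
  pose D (i : 'I_(q n).+1) : R := (i <= cell l j)%:R.
  have h1 : (k j < (q n).+1)%N by exact: ltnW.
  have h2 : ((k j).+1 < (q n).+1)%N by [].
  transitivity ((\sum_i (val i == val (Ordinal h1))%:R * D i -
     \sum_i (val i == val (Ordinal h2))%:R * D i) / p%:R).
    rewrite -sumrB mulr_suml; apply: eq_bigr => i _.
    rewrite big_bool/= /cellw/= /D -stepf_diff//; ring.
  rewrite !sum_pick /D/= -natrB; last first.
    by case: (leqP (k j) (cell l j)) => [_|h]; [exact: leq_b1|rewrite [(k j < _)%N]ltnNge (ltnW h)].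
  congr (_%:R / _); rewrite -val_eqE/= eqn_leq.
  by case: (ltngtP (k j) (cell l j)).
have [->|ne] := eqVneq k (cell l).
  rewrite (eq_bigr (fun=> 1)) => [|j _]; last by rewrite eqxx.
  rewrite sumr_const card_ord -mulrBl -natrB ?leq_pred// relu_id ?divr_ge0//.
  by rewrite -subn1 subKn.
rewrite mul0r relu_0// -mulrBl pmulr_lle0 ?invr_gt0// subr_le0 -natr_sum ler_nat.
have [j kj] : exists j, k j != cell l j.
  apply: contrapT => H; move/eqP: ne; apply; apply/ffunP => j; apply/eqP.
  by apply: contrapT => /negP kj; apply: H; exists j.
rewrite (bigD1 j)//= (negbTE kj) add0n.
apply: (@leq_trans (\sum_(i | i != j) 1)%N); first by apply: leq_sum => i _; exact: leq_b1.
by have := cardC1 j; rewrite card_ord sum1_card => <-.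
Qed.

Lemma feat_cellf n : (n1 <= n)%N ->
  feat ((c1 + 5 * p) * K n) (2 * a).+2 ((c1 + 5 * p) * K n) (@cellf n).
Proof.
move=> nn; rewrite {2}mulnDl; apply: feat_step.
  by apply: feat_mono (feat_stepf nn) => //; rewrite leq_mul2r leq_addr orbT.
have cK : #|{: {ffun 'I_p -> 'I_(q n)}}| = K n by rewrite card_ffun !card_ord.
apply: (@flayer_nnz _ _ _ _ (4 * p) _ _ _ (@cellw n) (fun=> - (p.-1%:R / p%:R))) => //.
- by rewrite cK leq_pmull// addn_gt0 muln_gt0 p0 orbT.
- move=> k z; rewrite /cellw !normrM normfV (gtr0_norm p0R) ler_pdivrMr// mul1r.
  rewrite (@le_trans _ _ 1) ?ler1n//.
  have -> : `|if z.2 then -1 else 1| = 1 :> R by case: z.2; rewrite ?normrN normr1.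
  rewrite mul1r; do 2 case: (_ == _); rewrite ?subrr ?subr0 ?sub0r ?normrN ?normr1 ?normr0//.
- move=> _; rewrite normrN ger0_norm ?divr_ge0// ler_pdivrMr// mul1r ler_nat leq_pred.
  by [].
- move=> k.
  apply: (@leq_trans (\sum_(j : 'I_p) 4)%N); last by rewrite sum_nat_const card_ord mulnC.
  rewrite !nsum_pairE; apply: leq_sum => j _.
  apply: (@leq_trans (\sum_(i < (q n).+1) 2 * ((val i == k j) + (val i == (k j).+1)))%N).
    apply: leq_sum => i _; rewrite mulSn mul1n big_bool/=; apply: leq_add;
    rewrite /cellw/=; case: (i == k j :> nat); case: (i == (k j).+1 :> nat) => //=; rewrite ?leq_b1//;
    by rewrite subrr mulr0 mul0r eqxx.
  rewrite -big_distrr/= big_split/= -[4%N]/(2 * (1 + 1))%N leq_mul2l/=.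
  by apply: leq_add; exact: sum_nat_eq_le.
- by rewrite cK mulnC leq_mul2r; apply/orP; right; lia.
Qed.

(** A lookup table without error: at a design point exactly one of the K cell units is active, so
    the read-out returns [p * v n k] times 1/p. *)
Lemma cheap_cell (v : forall n, {ffun 'I_p -> 'I_(q n)} -> R) C :
  (forall n k, `|v n k| <= C) -> cheap K (@Xs) (fun n i => v n (cell i)).
Proof.
move=> vC; have C0 : 0 <= C.
  by apply: le_trans (vC 0%N [ffun _ => Ordinal (q0 0%N)]).
have p1R : 1 <= p%:R :> R by rewrite ler1n.
exists (p%:R * C), (2 * a).+2, (c1 + 5 * p)%N, n1 => n nn.
exists _, (@cellf n), (fun k => p%:R * v n k), 0; split.
- exact: feat_cellf.
- by move=> k; rewrite normrM (gtr0_norm p0R) ler_wpM2l// ltW.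
- by rewrite normr0 mulr_ge0// ltW.
- by move=> i; rewrite (le_trans (vC _ _))// ler_peMl.
- move=> i; rewrite addr0 (bigD1 (cell i))//= big1 ?addr0; last first.
    by move=> k /negbTE kc; rewrite cellf_val// kc mul0r mulr0.
  rewrite cellf_val// eqxx mul1r mulrAC divff ?gt_eqF// mul1r subrr normr0 divr_ge0//.
  by rewrite mulr_ge0// ltW.
Qed.

(* Approximation at the design points only, by networks clipped to [-F, F] everywhere. *)
Lemma holder_approx (f0 : X -> R) (alpha F : R) : 0 < F -> alpha <= p%:R -> holder alpha f0 ->
  (forall x, cube x -> `|f0 x| <= F) ->
  exists (C : R) (d c n2 : nat), 0 <= C /\ forall n, (n2 <= n)%N ->
    exists Phi : bool -> X -> R,
    [/\ feat (c * K n) d (c * K n) Phi,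
        forall x, `|C * Phi true x - C * Phi false x - F| <= F &
        forall i : 'I_n, `|C * Phi true (Xs i) - C * Phi false (Xs i) - F - f0 (Xs i)| <=
          C * powR ((q n)%:R^-1) alpha].
Proof.
move=> F0 ap [m [g [H [/andP[ma am] g0 gd gb gh]]]] f0F.
have H0 : 0 <= H.
  have cz : cube (fun _ : 'I_p => 0 : R) by move=> i; rewrite lexx ler01.
  by apply: le_trans (gb (fun=> 0%N) _ _ cz); rewrite // /mabs big1.
have a0 : 0 < alpha by exact: le_lt_trans ma.
have be0 : 0 < alpha - m%:R by rewrite subr_gt0.
pose js := enum 'I_p.
have cg b : (mabs b <= m)%N -> cheap K (@Xs) (fun n i => g b (base i)).
  move=> bm.
  apply: (@cheap_cell (fun n k => g b (fun j => (k j)%:R / (q n)%:R)) H) => n k.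
  apply: gb => // j; rewrite divr_ge0//= ler_pdivrMr ?ltr0n// mul1r ler_nat.
  exact/ltnW/ltn_ord.
have cu j : cheap K (@Xs) (fun n i => Xs i j - base i j).
  apply: (cheap_ext (v := fun n i => Xs i j + (-1) * base i j)) => [n i|].
    by rewrite mulN1r.
  apply: cheap_add; first exact: cheap_coord.
  by apply: cheap_scale; exact: cheap_base.
have z0 : mabs (fun _ : 'I_p => 0%N) = 0%N by rewrite /mabs big1.
have [|C [d [c [n2 HC]]]] := @cheap_tay R p K (@Xs) (@base) g m js m (fun=> 0%N) Kpos cg cu.
  by rewrite z0.
pose C2 := tayC m H (size js) * powR 2 alpha.
have C20 : 0 <= C2 by rewrite mulr_ge0 ?tayC_ge0 ?powR_ge0.
pose M : R := `|C| + F + C2.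
have M0 : 0 < M by rewrite /M; have := normr_ge0 C; lra.
exists M, d.+1, (c + (2 + 2 * c))%N, (maxn n1 n2); split; first exact: ltW.
move=> n; rewrite geq_max => /andP[nn1 nn2].
have [I [Phi [al [al0 [h1 h2 h3 h4 h5]]]]] := HC n nn2.
have C0 : 0 <= C by exact: le_trans h3.
have CM : C + F <= M by rewrite /M ger0_norm// lerDl.
pose t x := \sum_j al j * Phi j x + al0.
pose sF (b : bool) := if b then F else - F.
(* The difference relu(t + F) - relu(t - F) - F clips t to [-F, F], which can only bring it closer
   to [f0]. Division by [M] makes the weights admissible and is undone in the read-out. *)
pose Psi (b : bool) (x : X) := relu (\sum_j (al j / M) * Phi j x + (al0 + sF b) / M).
have PsiE b x : M * Psi b x = relu (t x + sF b).
  rewrite /Psi /relu maxr_pMr ?ltW// mulr0; congr (Num.max _ _).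
  rewrite mulrDr mulr_sumr [M * _ in X in _ + X]mulrC divfK ?gt_eqF// /t -addrA; congr (_ + _).
  by apply: eq_bigr => j _; field; rewrite gt_eqF.
exists Psi; split.
- have k0 := Kpos n.
  apply: (feat_mono (leqnn _) (_ : c * K n + (2 + 2 * c) * K n <= _)%N); first by rewrite -mulnDl.
  apply: feat_step; first by apply: feat_mono h1 => //; rewrite leq_mul2r leq_addr orbT.
  have [cI _] := feat_layer h1.
  apply: (@flayer_nnz _ _ _ _ #|I| _ _ _ (fun _ j => al j / M) (fun b => (al0 + sF b) / M)) => //.
  + by rewrite card_bool; apply: (@leq_trans (2 * K n)); [by rewrite mul2n -addnn (leq_add k0 k0)|by rewrite leq_mul2r addnCA leq_addr orbT].
  + move=> b j; rewrite normrM normfV (gtr0_norm M0) ler_pdivrMr// mul1r (le_trans (h2 j))//.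
    by rewrite (le_trans _ CM)// lerDl ltW.
  + move=> b; rewrite normrM normfV (gtr0_norm M0) ler_pdivrMr// mul1r.
    rewrite (le_trans (ler_normD _ _))// (le_trans _ CM)// lerD//.
    by rewrite /sF; case: b; rewrite ?normrN gtr0_norm.
  + by move=> b; exact: sum_nnz_le.
  + by rewrite card_bool mulnDl -mulnA -mulnDr leq_mul2l/= -add1n leq_add.
- move=> x; rewrite !PsiE /sF /relu.
  by case: (lerP (t x + F) 0) => ?; case: (lerP (t x - F) 0) => ?; rewrite ler_norml; lra.
move=> i; rewrite !PsiE.
have clip : `|relu (t (Xs i) + F) - relu (t (Xs i) - F) - F - f0 (Xs i)| <= `|t (Xs i) - f0 (Xs i)|.
  have := f0F _ (cX i); rewrite ler_norml => /andP[? ?].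
  rewrite /relu; case: (lerP (t (Xs i) + F) 0) => ?; case: (lerP (t (Xs i) - F) 0) => ?;
   rewrite ler_norml; have := ler_norm (t (Xs i) - f0 (Xs i)); have := ler_norm (- (t (Xs i) - f0 (Xs i)));
   rewrite normrN; lra.
apply: (le_trans clip).
have := h5 i; rewrite -/(t (Xs i)) => h.
have qn0 : 0 < (q n)%:R :> R by rewrite ltr0n.
have d0 : 0 <= 2 / (q n)%:R :> R by rewrite divr_ge0.
have := @tay_bound R p m g H (alpha - m%:R) H0 be0 gd gh (base i) (Xs i) (2 / (q n)%:R) js m (fun=> 0%N)
  (base_cube i) (cX i) (enum_uniq _) d0 (fun j => base_near i j nn1) _.
rewrite z0 => /(_ erefl).
have -> : mix (base i) (Xs i) js = Xs i by apply/funext => j; rewrite /mix mem_enum.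
rewrite g0; last exact: cX.
have -> : (2 / (q n)%:R) ^+ m * powR (2 / (q n)%:R) (alpha - m%:R) = powR (2 / (q n)%:R) alpha :> R.
  rewrite -powR_mulrn// -powRD; first by rewrite addrC subrK.
  by apply/implyP => _; rewrite gt_eqF// divr_gt0.
rewrite powRM ?invr_ge0// => h'.
set T := tay _ _ _ _ _ _ in h h'; have q1 : 0 < ((q n)%:R^-1 : R) <= 1.
  by rewrite invr_gt0 qn0 invf_le1// ler1n q0.
(* This is where alpha <= p enters: the error 1/K of the squaring networks is then no larger than
   the Taylor error. *)
have KE : (K n)%:R^-1 <= powR ((q n)%:R^-1) alpha :> R.
  by rewrite /K natrX -exprVn -powR_mulrn ?invr_ge0//; apply: ger_powR ap; rewrite q1.
have -> : t (Xs i) - f0 (Xs i) = (t (Xs i) - T) - (f0 (Xs i) - T) by ring.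
apply: (le_trans (ler_normB _ _)); apply: (le_trans (lerD h h')).
rewrite mulrA -/C2; apply: (@le_trans _ _ ((C + C2) * powR ((q n)%:R^-1) alpha)).
  by rewrite mulrDl lerD2r ler_wpM2l.
by rewrite ler_wpM2r ?powR_ge0// /M ger0_norm//; lra.
Qed.

End Approximation.

Lemma measurable_gt_norm (R : realType) d (T : measurableType d) (f : T -> R) (B : R) :
  measurable_fun [set: T] f -> measurable [set t | B < `|f t|].
Proof.
move=> mf; rewrite (_ : [set t | _] = ~` [set t | `|f t| <= B]).
  apply: measurableC; rewrite -[X in measurable X]setTI.
  apply: (measurable_fun_le (f := fun t => `|f t|) (g := cst B)) => //.
  exact: measurableT_comp.
by apply/seteqP; split => t /=; [move=> h; apply/negP; rewrite -ltNge|move/negP; rewrite -ltNge].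
Qed.

(** * Integrals against the unnormalised prior of a fixed sparsity pattern *)

Section PriorIntegrals.
Context {R : realType}.
Local Notation mu := (@lebesgue_measure R).
Variables p w L : nat.
Hypotheses (pw : (p <= w)%N) (w0 : (0 < w)%N).
Implicit Types (G : {set Idx p w L}) (th : Idx p w L -> R).

Definition dens (k : Idx p w L) (t : R) : R := if top k then gauss t else udens t.

Lemma dens_ge0 k t : 0 <= dens k t.
Proof. by rewrite /dens; case: ifP => _; [exact: gauss_ge0|exact: udens_ge0]. Qed.

Lemma measurable_dens k : measurable_fun [set: R] (dens k).
Proof. by rewrite /dens; case: (top k); [exact: measurable_gauss|exact: measurable_udens]. Qed.

Lemma integral_dens k : (\int[mu]_t (dens k t)%:E = 1)%E.
Proof.
rewrite /dens; case: (top k); last exact: integral_udens.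
by rewrite -(integral_gauss 0); apply: eq_integral => t _; rewrite subr0.
Qed.

Lemma sdensE G th : sdens G th = \prod_(k in G) dens k (th k).
Proof. by []. Qed.

Lemma sdens_ge0 G th : 0 <= sdens G th.
Proof. by rewrite sdensE; apply: prodr_ge0 => k _; exact: dens_ge0. Qed.

Definition wt (F : R) G th : R := \1_(supbdd F) th * sdens G th.

Lemma wt_ge0 F G th : 0 <= wt F G th.
Proof. by rewrite mulr_ge0 ?sdens_ge0. Qed.

Lemma measurable_wt F G d (T : measurableType d) (u : T -> Idx p w L -> R) :
  (forall k, measurable_fun [set: T] (fun t => u t k)) ->
  measurable_fun [set: T] (fun t => wt F G (u t)).
Proof.
move=> mu_; apply: measurable_funM; first exact: measurable_supbdd.
have -> : (fun t => sdens G (u t)) = (fun t => \prod_(k <- enum G) dens k (u t k)).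
  by apply/funext => t; rewrite sdensE big_enum.
apply: measurable_prod => k _; apply: measurableT_comp => //; exact: measurable_dens.
Qed.

Lemma tmeas_wt F G : tmeas (fun th => (wt F G th)%:E).
Proof. by move=> d T u mu_; apply/measurable_EFinP; exact: measurable_wt. Qed.

Lemma cint_ge0 F G (h : (Idx p w L -> R) -> \bar R) :
  (forall th, 0 <= h th)%E -> (0 <= cint F G h)%E.
Proof. by move=> h0; apply: iint_ge0 => th; rewrite mule_ge0// lee_fin wt_ge0. Qed.

Lemma cint_le F G (h h' : (Idx p w L -> R) -> \bar R) :
  (forall th, 0 <= h th)%E ->
  (forall th, (forall k, k \notin G -> th k = 0) -> supbdd F th ->
    (forall k, k \in G -> ~~ top k -> `|th k| <= 1) -> (h th <= h' th)%E) ->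
  (cint F G h <= cint F G h')%E.
Proof.
move=> h0 hh; apply: iint_le => [th|th H]; first by rewrite mule_ge0// lee_fin wt_ge0.
have [->|nz] := eqVneq (\1_(supbdd F) th * sdens G th) 0; first by rewrite !mul0e.
apply: lee_wpmul2l; first by rewrite lee_fin wt_ge0.
move: nz; rewrite mulf_eq0 negb_or indicE => /andP[sb sd].
apply: hh.
- by move=> k kG; apply: H; rewrite mem_enum.
- by apply: contrapT => nsb; move: sb; rewrite memNset// eqxx.
- move=> k kG tk; move: sd; rewrite sdensE (bigD1 k)//= mulf_eq0 negb_or => /andP[+ _].
  rewrite /dens (negbTE tk) /udens mulf_eq0 negb_or indicE => /andP[_].
  case: (boolP (_ \in _)) => [|_]; last by rewrite eqxx.
  by rewrite inE/= in_itv/= ler_norml.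
Qed.

Lemma cintD F G (h h' : (Idx p w L -> R) -> \bar R) :
  (forall th, 0 <= h th)%E -> (forall th, 0 <= h' th)%E -> tmeas h -> tmeas h' ->
  (cint F G (fun th => h th + h' th) = cint F G h + cint F G h')%E.
Proof.
move=> h0 h0' mh mh'; rewrite /cint -iintD; last 4 first.
- by move=> th; rewrite mule_ge0// lee_fin wt_ge0.
- by move=> th; rewrite mule_ge0// lee_fin wt_ge0.
- by apply: tmeasM => //; exact: tmeas_wt.
- by apply: tmeasM => //; exact: tmeas_wt.
by apply: eq_iint => th; rewrite ge0_muleDr.
Qed.

Lemma cintZ F G (c : R) (h : (Idx p w L -> R) -> \bar R) :
  0 <= c -> (forall th, 0 <= h th)%E -> tmeas h ->
  (cint F G (fun th => c%:E * h th) = c%:E * cint F G h)%E.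
Proof.
move=> c0 h0 mh; rewrite /cint -iintZl; last 3 first.
- by rewrite lee_fin.
- by move=> th; rewrite mule_ge0// lee_fin wt_ge0.
- by apply: tmeasM => //; exact: tmeas_wt.
by apply: eq_iint => th; rewrite muleCA.
Qed.

Lemma iint_sdens_prod G (phi : Idx p w L -> R -> R) (c : Idx p w L -> R) th :
  (forall k, measurable_fun [set: R] (phi k)) -> (forall k t, 0 <= phi k t) ->
  (forall k, k \in G -> (\int[mu]_t (phi k t)%:E = (c k)%:E)%E) ->
  iint (enum G) (fun th => (\prod_(k in G) phi k (th k))%:E) th = (\prod_(k in G) c k)%:E.
Proof.
move=> mphi phi0 ic.
transitivity (iint (enum G) (fun th => (\prod_(k <- enum G) phi k (th k))%:E) th).
  by apply: eq_iint => x; rewrite big_enum.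
rewrite (iint_prod (phi := phi) (c := c)) ?enum_uniq ?big_enum//.
by move=> k; rewrite mem_enum; exact: ic.
Qed.

Lemma cint1_le1 (F : R) G : (cint F G (fun=> 1) <= 1)%E.
Proof.
apply: (@le_trans _ _ (iint (enum G) (fun th => (\prod_(k in G) dens k (th k))%:E) (fun=> 0))).
  apply: iint_le => [th|th _]; first by rewrite mule1 lee_fin wt_ge0.
  rewrite mule1 lee_fin -sdensE ler_piMl ?sdens_ge0// indicE; by case: (_ \in _).
rewrite (iint_sdens_prod (c := fun=> 1)) ?big1//.
- exact: measurable_dens.
- exact: dens_ge0.
- by move=> k _; exact: integral_dens.
Qed.

Lemma cint1_fin (F : R) G : cint F G (fun=> 1%E) \is a fin_num.
Proof.
apply/fin_numP; split.
  by rewrite gt_eqF// (lt_le_trans (ltNyr 0))//; apply: cint_ge0.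
by rewrite lt_eqF// (le_lt_trans (cint1_le1 F G))// ltry.
Qed.

(* Mass of a box around a centre: the only lower bound on the prior that is needed. *)
Lemma cint_box F G (h : (Idx p w L -> R) -> \bar R) (b : Idx p w L -> R) (c c0 eta : R) :
  0 <= c -> 0 <= c0 -> 0 <= eta -> (forall th, 0 <= h th)%E ->
  (forall k t, k \in G -> b k <= t <= b k + eta -> c0 <= dens k t) ->
  (forall th, (forall k, k \notin G -> th k = 0) ->
     (forall k, k \in G -> b k <= th k <= b k + eta) -> supbdd F th /\ (c%:E <= h th)%E) ->
  ((c * (c0 * eta) ^+ #|G|)%:E <= cint F G h)%E.
Proof.
move=> c00 c0_ge eta0 h0 hd hth.
pose phi k t := c0 * \1_(`[b k, b k + eta]%classic) t : R.
have phi0 k t : 0 <= phi k t by rewrite mulr_ge0.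
have mphi k : measurable_fun [set: R] (phi k).
  by apply: measurable_funM => //; exact: measurable_indic.
have -> : (c * (c0 * eta) ^+ #|G|)%:E =
    iint (enum G) (fun th => c%:E * (\prod_(k in G) phi k (th k))%:E)%E (fun=> 0).
  rewrite iintZl ?lee_fin//; last 2 first.
  - by move=> th; rewrite lee_fin prodr_ge0.
  - move=> d T u mu_; apply/measurable_EFinP.
    have -> : (fun t => \prod_(k in G) phi k (u t k)) = (fun t => \prod_(k <- enum G) phi k (u t k)).
      by apply/funext => t; rewrite big_enum.
    by apply: measurable_prod => k _; exact: measurableT_comp.
  rewrite (iint_sdens_prod (c := fun=> c0 * eta))//; first by rewrite prodr_const -EFinM.
  move=> k _; under eq_integral do rewrite /phi EFinM.
  rewrite ge0_integralZl; [|exact: measurableT|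
    by apply/measurable_EFinP; exact: measurable_indic|by move=> t _; rewrite lee_fin|by rewrite lee_fin].
  rewrite integral_indic// setIT [X in (_ * X)%E](_ : _ = eta%:E) ?EFinM//.
  apply: etrans; first exact: (lebesgue_measure_itv `[b k, b k + eta]).
  rewrite /= lte_fin ltrDl; have [_|] := ltP 0 eta.
    by rewrite -EFinD addrAC subrr add0r.
  by move=> e0; congr EFin; apply/eqP; rewrite eq_le eta0.
apply: iint_le => [th|th H].
  by rewrite mule_ge0// lee_fin prodr_ge0.
have [bx|nbx] := pselect (forall k, k \in G -> b k <= th k <= b k + eta); last first.
  rewrite [X in (_ * X)%E](_ : _ = 0%E) ?mule0; first by rewrite mule_ge0// lee_fin wt_ge0.
  have [k kG kb] : exists2 k, k \in G & ~~ (b k <= th k <= b k + eta).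
    apply: contrapT => H2; apply: nbx => k kG; apply: contrapT => /negP kb; apply: H2.
    by exists k.
  congr EFin; rewrite (bigD1 k)//= /phi indicE memNset ?mulr0 ?mul0r//=.
  by rewrite in_itv/=; exact/negP.
have [|sb ch] := hth th _ bx; first by move=> k kG; apply: H; rewrite mem_enum.
rewrite muleC; apply: lee_pmul => //; first by rewrite lee_fin prodr_ge0.
rewrite lee_fin indicE mem_set// mul1r sdensE; apply: ler_prod => k kG; rewrite phi0/=.
by rewrite /phi indicE mem_set/= ?in_itv/= ?bx// mulr1 hd// bx.
Qed.

(** Only the Gaussian top coordinates are unbounded. Off this event all parameters lie in a cube of
    half-side [B] (when [B >= 1]), which a finite grid covers. *)
Definition bigtop (B : R) G th : R := [exists k in G, top k && (B < `|th k|)]%:R.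

Lemma bigtop_ge0 B G th : 0 <= bigtop B G th.
Proof. by []. Qed.

Lemma measurable_bigtop B G d (T : measurableType d) (u : T -> Idx p w L -> R) :
  (forall k, measurable_fun [set: T] (fun t => u t k)) ->
  measurable_fun [set: T] (fun t => bigtop B G (u t)).
Proof.
move=> mu_.
have -> : (fun t => bigtop B G (u t)) =
    \1_(\bigcup_(k in [set k | (k \in G) && top k]) [set t | B < `|u t k|]).
  apply/funext => t; rewrite indicE; congr (_ : bool)%:R.
  apply/idP/idP; rewrite inE.
    by move=> /existsP[k /and3P[kG tk Bk]]; exists k => //=; rewrite kG.
  by move=> [k /= /andP[kG tk] Bk]; apply/existsP; exists k; rewrite kG tk.
apply: measurable_indic; apply: fin_bigcup_measurable => // k _.
by apply: measurable_gt_norm; exact: mu_.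
Qed.

Lemma cint_bigtop F B G : 0 <= B ->
  (cint F G (fun th => (bigtop B G th)%:E) <= (#|G|%:R * (2 * expR (- B ^+ 2 / 2)))%:E)%E.
Proof.
move=> B0; pose tl := (\int[mu]_t (gauss t * (B < `|t|)%R%:R)%:E)%E.
have tl_le : (tl <= (2 * expR (- B ^+ 2 / 2))%:E)%E by exact: integral_gauss_tail.
have tl0 : (0 <= tl)%E by apply: integral_ge0 => t _; rewrite lee_fin mulr_ge0 ?gauss_ge0.
have tlf : tl \is a fin_num by rewrite ge0_fin_numE// (le_lt_trans tl_le)// ltry.
pose phi (k j : Idx p w L) (t : R) : R := if j == k then gauss t * (B < `|t|)%R%:R else dens j t.
have mB : measurable_fun [set: R] (fun t : R => (B < `|t|)%R%:R : R).
  have -> : (fun t : R => (B < `|t|)%R%:R : R) = \1_[set t | B < `|t|].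
    by apply/funext => t; rewrite indicE; congr (_ : bool)%:R; apply/idP/idP; rewrite inE.
  by apply: measurable_indic; exact: (measurable_gt_norm (f := id)).
have mphi k j : measurable_fun [set: R] (phi k j).
  rewrite /phi; case: (j == k); last exact: measurable_dens.
  by apply: measurable_funM => //; exact: measurable_gauss.
have phi0 k j t : 0 <= phi k j t.
  by rewrite /phi; case: (j == k); [rewrite mulr_ge0 ?gauss_ge0|exact: dens_ge0].
have iphi k : k \in G -> iint (enum G) (fun th => (\prod_(j in G) phi k j (th j))%:E) (fun=> 0) = tl.
  move=> kG; rewrite (iint_sdens_prod (c := fun j => if j == k then fine tl else 1))//.
    by rewrite (bigD1 k)//= eqxx big1 ?mulr1 ?fineK// => j /andP[_ /negbTE ->].
  move=> j _; rewrite /phi; case: (j == k); last exact: integral_dens.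
  by rewrite fineK.
apply: (@le_trans _ _ (iint (enum G) (fun th =>
    \sum_(k <- enum G) (\prod_(j in G) phi k j (th j))%:E)%E (fun=> 0))).
  apply: iint_le => [th|th _]; first by rewrite mule_ge0// lee_fin ?wt_ge0 ?bigtop_ge0.
  rewrite sumEFin -EFinM lee_fin.
  have s0 : 0 <= \sum_(k <- enum G) \prod_(j in G) phi k j (th j).
    by apply: sumr_ge0 => k _; exact: prodr_ge0.
  rewrite /bigtop; case: existsP => [[k /and3P[kG tk Bk]]|_]; last by rewrite mulr0.
  rewrite mulr1 big_enum (bigD1 k)//= (le_trans _ (_ : \prod_(j in G) phi k j (th j) <= _))//; last first.
    by rewrite lerDl; apply: sumr_ge0 => j _; exact: prodr_ge0.
  apply: (@le_trans _ _ (sdens G th)); first by rewrite ler_piMl ?sdens_ge0// indicE; case: (_ \in _).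
  rewrite sdensE; apply: ler_prod => j jG; rewrite dens_ge0/= /phi.
  by case: eqP => // ->; rewrite /dens tk Bk mulr1.
rewrite iint_sum.
- apply: (@le_trans _ _ (\sum_(k <- enum G) (2 * expR (- B ^+ 2 / 2))%:E)%E).
    by rewrite big_seq [leRHS]big_seq; apply: lee_sum => k; rewrite mem_enum => kG; rewrite iphi.
  by rewrite sumEFin big_enum/= sumr_const [(#|G|%:R * _)%R]mulr_natl.
- by move=> k th; rewrite lee_fin prodr_ge0.
- move=> k d T u mu_; apply/measurable_EFinP.
  have -> : (fun t => \prod_(j in G) phi k j (u t j)) = (fun t => \prod_(j <- enum G) phi k j (u t j)).
    by apply/funext => t; rewrite big_enum.
  by apply: measurable_prod => j _; exact: measurableT_comp.
Qed.

End PriorIntegrals.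

Lemma width_ge p N : (0 < p)%N -> (0 < N)%N -> (p <= width p N)%N /\ (0 < width p N)%N.
Proof. by move=> p0 N0; rewrite /width; split; nia. Qed.

(** * Averages over width, sparsity level and connectivity pattern *)

Section PriorSum.
Context {R : realType}.
Variables (p L : nat) (lam lams F : R).
Hypotheses (p0 : (0 < p)%N) (lam0 : 0 < lam) (lams0 : 0 < lams).
Local Notation Ix N := (Idx p (width p N) L).


(* The prior average over (N, s, G) of a quantity [x N s G]. *)
Definition gsum (x : forall N : nat, nat -> {set Ix N} -> \bar R) : \bar R :=
  (\sum_(N <oo) (piN lam N)%:E *
     \sum_(s < (npar p L N).+1) (piS p L lams N s)%:E *
       \sum_(G in Gam p (width p N) L s)
          ((#|Gam p (width p N) L s|%:R)^-1)%:E * x N s G)%E.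

Lemma prior_intE (H : (('I_p -> R) -> R) -> \bar R) :
  prior_int L lam lams F H = gsum (fun N s G => cexp F G (fun th => H (net th))).
Proof. by []. Qed.

Lemma expR_sub1_gt0 (x : R) : 0 < x -> 0 < expR x - 1.
Proof. by move=> x0; rewrite subr_gt0 -expR0 ltr_expR. Qed.

Lemma piN_ge0 N : 0 <= piN lam N.
Proof.
rewrite /piN; case: eqP => // _; rewrite divr_ge0 ?exprn_ge0 ?mulr_ge0 ?(ltW lam0)//.
exact/ltW/expR_sub1_gt0.
Qed.

Lemma piS_ge0 N s : 0 <= piS p L lams N s.
Proof.
by rewrite /piS; case: ifP => // _; rewrite divr_ge0 ?expR_ge0 ?sumr_ge0// => i _; exact: expR_ge0.
Qed.

Lemma sum_piS N : \sum_(s < (npar p L N).+1) piS p L lams N s <= 1.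
Proof.
set a := (width p N).+1; set b := npar p L N.
have [ab|ab] := leqP a b; last first.
  rewrite big1// => s _; rewrite /piS -/a -/b; case: ifP => // /andP[as_ sb].
  by move: (leq_trans as_ sb); rewrite leqNgt ab.
rewrite -(big_mkord xpredT (fun s => piS p L lams N s)) (big_cat_nat (n := a))//=; last exact: leqW.
rewrite big_nat_cond big1 ?add0r; last first.
  by move=> i /andP[/andP[_ ia] _]; rewrite /piS -/a leqNgt ia.
set Z := \sum_(a <= s' < b.+1) expR (- lams * s'%:R).
rewrite big_nat_cond (eq_bigr (fun s => expR (- lams * s%:R) / Z)); last first.
  by move=> s /andP[/andP[as_ sb] _]; rewrite /piS -/a -/b -/Z as_ -ltnS sb.
rewrite -mulr_suml -big_nat_cond -/Z divff// gt_eqF// /Z big_ltn ?ltnS//.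
by rewrite ltr_pwDl ?expR_gt0// sumr_ge0// => i _; exact: expR_ge0.
Qed.

Lemma exp_partial (x : R) n : 0 <= x -> \sum_(0 <= k < n) x ^+ k / k`!%:R <= expR x.
Proof.
move=> x0; have := @nondecreasing_cvgn_le R (series (exp_coeff x)) _ (is_cvg_series_exp_coeff x) n.
rewrite /expR /series/= => h; apply: h.
apply: (@nondecreasing_series _ (exp_coeff x) xpredT 0) => k _ _; exact: exp_coeff_ge0.
Qed.

Lemma nneseries_le_cst (u : nat -> R) (C : R) : (forall k, 0 <= u k) ->
  (forall n, \sum_(0 <= k < n) u k <= C) -> (\sum_(k <oo) (u k)%:E <= C%:E)%E.
Proof.
move=> u0 uC; apply: lime_le.
  by apply: is_cvg_nneseries => k _ _; rewrite lee_fin.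
by apply: nearW => n; rewrite sumEFin lee_fin.
Qed.

Lemma sum_piN : (\sum_(N <oo) (piN lam N)%:E <= 1)%E.
Proof.
apply: nneseries_le_cst => [N|[|n]]; first exact: piN_ge0.
  by rewrite big_nil.
rewrite big_nat_recl//= {1}/piN eqxx add0r.
have E := exp_partial n.+1 (ltW lam0).
rewrite big_nat_recl// expr0 fact0 divr1 in E.
rewrite (eq_bigr (fun k => lam ^+ k.+1 / (k.+1)`!%:R / (expR lam - 1))); last first.
  by move=> k _; rewrite /piN/= invfM mulrA mulrAC.
by rewrite -mulr_suml ler_pdivrMr ?expR_sub1_gt0// mul1r lerBrDl.
Qed.

(** Chernoff for the Poisson-type weights: the indicator of M < N is at most exp(A (N - M)), and the
    weighted exponentials sum to at most exp(lam exp(A)). *)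
Lemma piN_tail (A : R) (M : nat) : 0 <= A ->
  (\sum_(N <oo) (piN lam N * (M < N)%N%:R)%:E <=
    (expR (lam * expR A) / (expR lam - 1) * expR (- A * M%:R))%:E)%E.
Proof.
move=> A0; have e1 := expR_sub1_gt0 lam0.
apply: nneseries_le_cst => [N|n]; first by rewrite mulr_ge0 ?piN_ge0.
rewrite [leRHS]mulrAC -[leRHS]mulrA [leRHS]mulrC.
have lA : 0 <= lam * expR A by rewrite mulr_ge0 ?expR_ge0// ltW.
apply: (@le_trans _ _ ((expR (- A * M%:R) / (expR lam - 1)) * \sum_(0 <= k < n) (lam * expR A) ^+ k / k`!%:R)); last first.
  rewrite ler_wpM2l ?exp_partial// divr_ge0 ?expR_ge0//; exact: ltW.
rewrite mulr_sumr; apply: ler_sum => k _.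
have k0 : 0 < k`!%:R :> R by rewrite ltr0n fact_gt0.
rewrite /piN; case: ltnP => Mk /=; last first.
  by rewrite mulr0 mulr_ge0 ?divr_ge0 ?expR_ge0 ?exprn_ge0// ltW.
rewrite mulr1 gtn_eqF ?(leq_ltn_trans _ Mk)//.
rewrite exprMn -expRM_natl invfM.
have -> : expR (- A * M%:R) / (expR lam - 1) * (lam ^+ k * expR (k%:R * A) / k`!%:R) =
  (expR (- A * M%:R) * expR (k%:R * A)) * (lam ^+ k * ((expR lam - 1)^-1 / k`!%:R)) by ring.
rewrite ler_peMl//; first by rewrite !mulr_ge0 ?exprn_ge0 ?invr_ge0// ltW.
rewrite -expRD -[leLHS]expR0 ler_expR.
have : M%:R <= k%:R :> R by rewrite ler_nat ltnW.
nra.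
Qed.

Lemma sum_Gam N s : ((\sum_(G in Gam p (width p N) L s) ((#|Gam p (width p N) L s|%:R)^-1)%:E) <= (1 : R)%:E)%E.
Proof.
rewrite sumEFin lee_fin sumr_const -[leLHS]mulr_natl.
have [->|c0] := eqVneq (#|Gam p (width p N) L s|) 0%N; first by rewrite mul0r.
by rewrite divff ?pnatr_eq0.
Qed.

Section Gsum.
Implicit Types x y : forall N : nat, nat -> {set Ix N} -> \bar R.

Lemma gsum_inner_ge0 x N s : (forall G, 0 <= x N s G)%E ->
  (0 <= \sum_(G in Gam p (width p N) L s) ((#|Gam p (width p N) L s|%:R)^-1)%:E * x N s G)%E.
Proof. by move=> x0; apply: sume_ge0 => G _; rewrite mule_ge0// lee_fin invr_ge0. Qed.

Lemma gsum_mid_ge0 x N : (forall s G, 0 <= x N s G)%E ->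
  (0 <= \sum_(s < (npar p L N).+1) (piS p L lams N s)%:E *
    \sum_(G in Gam p (width p N) L s) ((#|Gam p (width p N) L s|%:R)^-1)%:E * x N s G)%E.
Proof.
by move=> x0; apply: sume_ge0 => s _; rewrite mule_ge0 ?lee_fin ?piS_ge0// gsum_inner_ge0.
Qed.

Lemma gsum_ge0 x : (forall N s G, 0 <= x N s G)%E -> (0 <= gsum x)%E.
Proof.
move=> x0; apply: nneseries_ge0 => N _ _; rewrite mule_ge0 ?lee_fin ?piN_ge0//.
exact: gsum_mid_ge0.
Qed.

Lemma gsum_le x y : (forall N s G, 0 <= x N s G)%E ->
  (forall N s G, (0 < N)%N -> G \in Gam p (width p N) L s -> x N s G <= y N s G)%E ->
  (gsum x <= gsum y)%E.
Proof.
move=> x0 xy; apply: lee_nneseries => [N _ _|N _].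
  by rewrite mule_ge0 ?lee_fin ?piN_ge0// gsum_mid_ge0.
have [->|N0] := posnP N; first by rewrite /piN eqxx !mul0e.
rewrite lee_wpmul2l ?lee_fin ?piN_ge0//; apply: lee_sum => s _.
rewrite lee_wpmul2l ?lee_fin ?piS_ge0//; apply: lee_sum => G GG.
by rewrite lee_wpmul2l ?lee_fin ?invr_ge0// xy.
Qed.

Lemma gsumD x y : (forall N s G, 0 <= x N s G)%E -> (forall N s G, 0 <= y N s G)%E ->
  (gsum (fun N s G => x N s G + y N s G) = gsum x + gsum y)%E.
Proof.
move=> x0 y0; rewrite /gsum -nneseriesD; last 2 first.
- by move=> N _ _; rewrite mule_ge0 ?lee_fin ?piN_ge0// gsum_mid_ge0.
- by move=> N _ _; rewrite mule_ge0 ?lee_fin ?piN_ge0// gsum_mid_ge0.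
apply: eq_eseriesr => N _; rewrite -ge0_muleDr ?gsum_mid_ge0//; congr (_ * _)%E.
rewrite -big_split/=; apply: eq_bigr => s _.
rewrite -ge0_muleDr ?gsum_inner_ge0//; congr (_ * _)%E.
rewrite -big_split/=; apply: eq_bigr => G _.
by rewrite ge0_muleDr.
Qed.

Lemma gsum_cst_N (c : nat -> R) : (forall N, 0 <= c N) ->
  (gsum (fun N _ _ => (c N)%:E) <= \sum_(N <oo) (piN lam N * c N)%:E)%E.
Proof.
move=> c0; apply: lee_nneseries => [N _ _|N _].
  rewrite mule_ge0 ?lee_fin ?piN_ge0// (gsum_mid_ge0 (x := fun N _ _ => (c N)%:E))// => s G.
  by rewrite lee_fin.
rewrite EFinM lee_wpmul2l ?lee_fin ?piN_ge0//.
apply: (@le_trans _ _ (\sum_(s < (npar p L N).+1) (piS p L lams N s * c N)%:E)%E).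
  apply: lee_sum => s _; rewrite EFinM lee_wpmul2l ?lee_fin ?piS_ge0//.
  rewrite -ge0_sume_distrl; last by move=> G _; rewrite lee_fin invr_ge0.
  by rewrite -[leRHS]mul1e lee_wpmul2r ?lee_fin// sum_Gam.
by rewrite sumEFin lee_fin -mulr_suml ler_piMl// sum_piS.
Qed.

Lemma gsum_cst (c : R) : 0 <= c -> (gsum (fun _ _ _ => c%:E) <= c%:E)%E.
Proof.
move=> c0; apply: (le_trans (gsum_cst_N (c := fun=> c) (fun=> c0))).
under eq_eseriesr do rewrite mulrC EFinM.
rewrite nneseriesZl; last by move=> N _; rewrite lee_fin piN_ge0.
by rewrite -[leRHS]mule1 lee_wpmul2l ?lee_fin// sum_piN.
Qed.

(** A single width, level and pattern already bound the prior integral from below; this is applied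
    to the approximating network. *)
Lemma gsum_term x N s G : (forall N s G, 0 <= x N s G)%E -> (s <= npar p L N)%N ->
  G \in Gam p (width p N) L s ->
  ((piN lam N * (piS p L lams N s / #|Gam p (width p N) L s|%:R))%:E * x N s G <= gsum x)%E.
Proof.
move=> x0 sN GG.
have f0 N' : (0 <= (piN lam N')%:E * \sum_(s < (npar p L N').+1) (piS p L lams N' s)%:E *
       \sum_(G in Gam p (width p N') L s) ((#|Gam p (width p N') L s|%:R)^-1)%:E * x N' s G)%E.
  by rewrite mule_ge0 ?lee_fin ?piN_ge0// gsum_mid_ge0.
apply: (@le_trans _ _ ((piN lam N)%:E *
     \sum_(s < (npar p L N).+1) (piS p L lams N s)%:E *
       \sum_(G in Gam p (width p N) L s)
          ((#|Gam p (width p N) L s|%:R)^-1)%:E * x N s G)%E).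
  rewrite EFinM -muleA lee_wpmul2l ?lee_fin ?piN_ge0//.
  have sN' : (s < (npar p L N).+1)%N by [].
  rewrite (bigD1 (Ordinal sN'))//=.
  apply: (@le_trans _ _ ((piS p L lams N s)%:E *
       \sum_(G in Gam p (width p N) L s) ((#|Gam p (width p N) L s|%:R)^-1)%:E * x N s G)%E).
    rewrite EFinM -muleA lee_wpmul2l ?lee_fin ?piS_ge0//.
    rewrite (bigD1 G)//= leeDl// sume_ge0// => G' _.
    by rewrite mule_ge0// lee_fin invr_ge0.
  rewrite leeDl// sume_ge0// => s' _.
  by rewrite mule_ge0 ?lee_fin ?piS_ge0// gsum_inner_ge0.
rewrite /gsum; apply: (le_trans _ (@nneseries_lim_ge R _ xpredT 0 N.+1 (fun k _ _ => f0 k))).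
rewrite big_nat_recr//=; apply: leeDr; apply: sume_ge0 => k _; exact: f0.
Qed.

Lemma iint_gsum (I : eqType) js (th0 : I -> R) (e : (I -> R) -> R)
    (x : (I -> R) -> forall N : nat, nat -> {set Ix N} -> \bar R) :
  (forall Y N s G, 0 <= x Y N s G)%E -> (forall Y, 0 <= e Y) -> tmeas (fun Y => (e Y)%:E) ->
  (forall N s G, (0 < N)%N -> tmeas (fun Y => x Y N s G)) ->
  iint js (fun Y => (e Y)%:E * gsum (x Y))%E th0 =
  gsum (fun N s G => iint js (fun Y => (e Y)%:E * x Y N s G)%E th0).
Proof.
move=> x0 e0 me mx.
have minner N s : (0 < N)%N -> tmeas (fun Y => \sum_(G in Gam p (width p N) L s)
    ((#|Gam p (width p N) L s|%:R)^-1)%:E * x Y N s G)%E.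
  by move=> N0; apply: tmeas_sum => G; apply: tmeasM; [exact: tmeas_cst|exact: mx].
have mmid N : (0 < N)%N -> tmeas (fun Y => \sum_(s < (npar p L N).+1) (piS p L lams N s)%:E *
    \sum_(G in Gam p (width p N) L s) ((#|Gam p (width p N) L s|%:R)^-1)%:E * x Y N s G)%E.
  by move=> N0; apply: tmeas_sum => s; apply: tmeasM; [exact: tmeas_cst|exact: minner].
pose f N Y := ((piN lam N)%:E * ((e Y)%:E * \sum_(s < (npar p L N).+1) (piS p L lams N s)%:E *
    \sum_(G in Gam p (width p N) L s) ((#|Gam p (width p N) L s|%:R)^-1)%:E * x Y N s G))%E.
have f0 N Y : (0 <= f N Y)%E.
  by rewrite mule_ge0 ?lee_fin ?piN_ge0// mule_ge0 ?lee_fin// gsum_mid_ge0.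
have mf N : tmeas (f N).
  rewrite /f; have [->|N0] := posnP N.
    by move=> d T u mu_; under eq_fun do rewrite /piN eqxx mul0e; exact: measurable_cst.
  by apply: tmeasM; [exact: tmeas_cst|apply: tmeasM => //; exact: mmid].
transitivity (iint js (fun Y => \sum_(N <oo) f N Y)%E th0).
  apply: eq_iint => Y; rewrite /gsum -nneseriesZl => [|N _].
    by apply: eq_eseriesr => N _; rewrite /f muleCA.
  by rewrite mule_ge0 ?lee_fin ?piN_ge0// gsum_mid_ge0.
rewrite iint_series//; apply: eq_eseriesr => N _; rewrite /f.
have [->|N0] := posnP N.
  rewrite {2}/piN eqxx mul0e -[RHS](iint_cst0 js th0); apply: eq_iint => Y.
  by rewrite /piN eqxx mul0e.
rewrite iintZl ?lee_fin ?piN_ge0//; last 2 first.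
- by move=> Y; rewrite mule_ge0 ?lee_fin// gsum_mid_ge0.
- by apply: tmeasM => //; exact: mmid.
congr (_ * _)%E.
transitivity (iint js (fun Y => \sum_(s < (npar p L N).+1) (piS p L lams N s)%:E *
    ((e Y)%:E * \sum_(G in Gam p (width p N) L s) ((#|Gam p (width p N) L s|%:R)^-1)%:E * x Y N s G))%E th0).
  apply: eq_iint => Y; rewrite ge0_sume_distrr => [|s _].
    by apply: eq_bigr => s _; rewrite muleCA.
  by rewrite mule_ge0 ?lee_fin ?piS_ge0// gsum_inner_ge0.
rewrite iint_sum; last 2 first.
- by move=> s Y; rewrite mule_ge0 ?lee_fin ?piS_ge0// mule_ge0 ?lee_fin// gsum_inner_ge0.
- by move=> s; apply: tmeasM; [exact: tmeas_cst|apply: tmeasM => //; exact: minner].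
apply: eq_bigr => s _; rewrite iintZl ?lee_fin ?piS_ge0//; last 2 first.
- by move=> Y; rewrite mule_ge0 ?lee_fin// gsum_inner_ge0.
- by apply: tmeasM => //; exact: minner.
congr (_ * _)%E.
transitivity (iint js (fun Y => \sum_(G in Gam p (width p N) L s)
   ((#|Gam p (width p N) L s|%:R)^-1)%:E * ((e Y)%:E * x Y N s G))%E th0).
  apply: eq_iint => Y; rewrite ge0_sume_distrr => [|G _].
    by apply: eq_bigr => G _; rewrite muleCA.
  by rewrite mule_ge0// lee_fin invr_ge0.
rewrite iint_sum; last 2 first.
- by move=> G Y; rewrite mule_ge0 ?lee_fin ?invr_ge0// mule_ge0 ?lee_fin.
- by move=> G; apply: tmeasM; [exact: tmeas_cst|apply: tmeasM => //; exact: mx].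
apply: eq_bigr => G _; rewrite iintZl ?lee_fin ?invr_ge0//.
- by move=> Y; rewrite mule_ge0 ?lee_fin.
- by apply: tmeasM => //; exact: mx.
Qed.


Lemma tmeas_gsum (I : eqType) (x : (I -> R) -> forall N : nat, nat -> {set Ix N} -> \bar R) :
  (forall Y N s G, 0 <= x Y N s G)%E ->
  (forall N s G, (0 < N)%N -> tmeas (fun Y => x Y N s G)) -> tmeas (fun Y => gsum (x Y)).
Proof.
move=> x0 mx; apply: tmeas_series => [N Y|N].
  by rewrite mule_ge0 ?lee_fin ?piN_ge0// gsum_mid_ge0.
have [->|N0] := posnP N.
  by move=> d T u mu_; under eq_fun do rewrite /piN eqxx mul0e; exact: measurable_cst.
apply: tmeasM; first exact: tmeas_cst.
apply: tmeas_sum => s; apply: tmeasM; first exact: tmeas_cst.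
by apply: tmeas_sum => G; apply: tmeasM; [exact: tmeas_cst|exact: mx].
Qed.

End Gsum.
End PriorSum.

(** * Conditional prior expectations given a pattern, and the likelihood *)

Section Cexp.
Context {R : realType}.
Variables p w L : nat.
Hypotheses (pw : (p <= w)%N) (w0 : (0 < w)%N).
Variable F : R.
Implicit Types (G : {set Idx p w L}) (th : Idx p w L -> R) (h : (Idx p w L -> R) -> \bar R).

Definition nrm G : R := (fine (cint F G (fun=> 1%E)))^-1.

Lemma nrm_ge0 G : 0 <= nrm G.
Proof. by rewrite /nrm invr_ge0 fine_ge0// cint_ge0. Qed.

Lemma cexpE G h : cexp F G h = (cint F G h * (nrm G)%:E)%E.
Proof. by []. Qed.

Lemma cexp_ge0 G h : (forall th, 0 <= h th)%E -> (0 <= cexp F G h)%E.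
Proof. by move=> h0; rewrite cexpE mule_ge0 ?cint_ge0// lee_fin nrm_ge0. Qed.

Lemma cexp_le G (h h' : (Idx p w L -> R) -> \bar R) :
  (forall th, 0 <= h th)%E ->
  (forall th, (forall k, k \notin G -> th k = 0) -> supbdd F th ->
    (forall k, k \in G -> ~~ top k -> `|th k| <= 1) -> (h th <= h' th)%E) ->
  (cexp F G h <= cexp F G h')%E.
Proof. by move=> h0 hh; rewrite !cexpE lee_wpmul2r ?lee_fin ?nrm_ge0// cint_le. Qed.

Lemma cexpD G h h' : (forall th, 0 <= h th)%E -> (forall th, 0 <= h' th)%E -> tmeas h -> tmeas h' ->
  (cexp F G (fun th => h th + h' th) = cexp F G h + cexp F G h')%E.
Proof. by move=> h0 h0' mh mh'; rewrite !cexpE cintD// ge0_muleDl ?cint_ge0. Qed.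

(** Only an inequality: when the normalising mass is zero its inverse is 0 by convention, and so is
    the conditional expectation. *)
Lemma cexp_cst G (c : R) : 0 <= c -> (cexp F G (fun=> c%:E) <= c%:E)%E.
Proof.
move=> c0; rewrite cexpE.
have -> : cint F G (fun=> c%:E) = (c%:E * cint F G (fun=> 1%E))%E.
  by rewrite -cintZ//; congr cint; apply/funext => th; rewrite mule1.
rewrite -muleA -[leRHS]mule1 lee_wpmul2l ?lee_fin//.
rewrite -(fineK (cint1_fin F G)) -EFinM lee_fin /nrm.
have [->|c1] := eqVneq (fine (cint F G (fun=> 1%E))) 0; first by rewrite mul0r.
by rewrite divff.
Qed.

(** The normaliser is a mass at most 1, so dividing by it can only increase; when it is zero both
    sides vanish. *)
Lemma cexp_lb G h : (forall th, 0 <= h th <= 1)%E -> (cint F G h <= cexp F G h)%E.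
Proof.
move=> h01; have h0 th : (0 <= h th)%E by case/andP: (h01 th).
have hle : (cint F G h <= cint F G (fun=> 1%E))%E.
  by apply: cint_le => // th _ _ _; case/andP: (h01 th).
rewrite cexpE /nrm; set c := fine _.
have cE : cint F G (fun=> 1%E) = c%:E by rewrite /c fineK// cint1_fin.
have c0 : 0 <= c by rewrite -lee_fin -cE cint_ge0.
have [c00|cn] := eqVneq c 0.
  have -> : cint F G h = 0%E.
    by apply/eqP; rewrite eq_le cint_ge0// andbT; rewrite cE c00 in hle.
  by rewrite mul0e.
rewrite -[leLHS]mule1 lee_wpmul2l ?cint_ge0// lee_fin invf_ge1 ?lt0r ?cn//.
by rewrite -lee_fin -cE cint1_le1.
Qed.

Lemma cexp_bigtop (B b0 : R) G : 0 <= B -> 0 < b0 -> (b0%:E <= cint F G (fun=> 1%E))%E ->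
  (cexp F G (fun th => (bigtop B G th)%:E) <= (#|G|%:R * (2 * expR (- B ^+ 2 / 2)) / b0)%:E)%E.
Proof.
move=> B0 b00 bc; rewrite cexpE EFinM; apply: lee_pmul.
- by apply: cint_ge0 => th; rewrite lee_fin bigtop_ge0.
- by rewrite lee_fin nrm_ge0.
- exact: cint_bigtop.
- have bf : b0 <= fine (cint F G (fun=> 1%E)).
    by rewrite -lee_fin fineK// cint1_fin.
  by rewrite lee_fin /nrm lef_pV2// posrE (lt_le_trans b00).
Qed.

Section Lik.
Variables (n : nat) (X : 'I_n -> 'I_p -> R).

(** The factor (2 pi)^(-n/2) that [lik] omits from the Gaussian density. *)
Definition k0 : R := (Num.sqrt (2 * pi))^-1 ^+ n.

Lemma k0_ge0 : 0 <= k0. Proof. by rewrite exprn_ge0// invr_ge0. Qed.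

Lemma prod_gauss_lik Y (f : ('I_p -> R) -> R) : \prod_(i < n) gauss (Y i - f (X i)) = lik X Y f * k0.
Proof.
rewrite /gauss big_split/= prodr_const card_ord -/k0; congr (_ * _).
by rewrite -expR_sum /lik mulr_sumr; congr expR; apply: eq_bigr => i _; rewrite mulNr mulrC mulNr.
Qed.

Lemma lik_gt0 Y (f : ('I_p -> R) -> R) : 0 < lik X Y f. Proof. exact: expR_gt0. Qed.

Lemma lik_le1 Y (f : ('I_p -> R) -> R) : lik X Y f <= 1.
Proof.
rewrite /lik -expR0 ler_expR mulNr oppr_le0 mulr_ge0// sumr_ge0// => i _; exact: sqr_ge0.
Qed.

Lemma measurable_lik d (T : measurableType d) (u : T -> 'I_n -> R) (v : T -> Idx p w L -> R) :
  (forall i, measurable_fun [set: T] (fun t => u t i)) ->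
  (forall k, measurable_fun [set: T] (fun t => v t k)) ->
  measurable_fun [set: T] (fun t => lik X (u t) (net (v t))).
Proof.
move=> mu_ mv; apply: measurableT_comp => //; apply: measurable_funM => //.
apply: measurable_sum => i; apply: measurable_funX; apply: measurable_funB => //.
exact: measurable_net.
Qed.

Variables (G : {set Idx p w L}) (h : (Idx p w L -> R) -> R).
Hypothesis h0 : forall th, 0 <= h th.
Hypothesis mh : forall d (T : measurableType d) (v : T -> Idx p w L -> R),
  (forall k, measurable_fun [set: T] (fun t => v t k)) -> measurable_fun [set: T] (fun t => h (v t)).

Let H (Y : 'I_n -> R) th : \bar R := ((wt F G th)%:E * (h th * lik X Y (net th))%:E)%E.

Let H0 Y th : (0 <= H Y th)%E.
Proof. by rewrite mule_ge0 ?lee_fin ?wt_ge0// mulr_ge0// ltW// lik_gt0. Qed.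

Let mH : tmeas2 H.
Proof.
move=> d T u v mu_ mv; apply: emeasurable_funM; apply/measurable_EFinP.
  exact: measurable_wt.
by apply: measurable_funM; [exact: mh|exact: measurable_lik].
Qed.

Lemma tmeas_cexp_lik : tmeas (fun Y => cexp F G (fun th => (h th * lik X Y (net th))%:E)).
Proof.
move=> d T u mu_; apply: emeasurable_funM; last exact: measurable_cst.
by apply: (tmeas2_iint (enum G) H0 mH (u := u) (v := fun _ _ => 0)).
Qed.

(** For fixed [th] the normalised likelihood is a probability density in [Y]. Exchanging integrals
    therefore removes the data, and a prior mass remains. *)
Lemma fubini_lik : iint (enum 'I_n) (fun Y => k0%:E *
    cexp F G (fun th => (h th * lik X Y (net th))%:E))%E (fun=> 0) =
  cexp F G (fun th => (h th)%:E).
Proof.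
transitivity (iint (enum 'I_n) (fun Y => (nrm G)%:E * iint (enum G) (fun th => k0%:E * H Y th) (fun=> 0%R))%E (fun=> 0)).
  apply: eq_iint => Y; rewrite cexpE muleA [RHS]muleC; congr (_ * _)%E.
  rewrite iintZl// ?lee_fin ?k0_ge0//.
  by move=> d T v mv; apply: (mH (u := fun _ _ => Y _)) => // i; exact: measurable_cst.
have kH0 Y th : (0 <= k0%:E * H Y th)%E by apply: mule_ge0; [rewrite lee_fin k0_ge0|exact: H0].
have mkH : tmeas2 (fun Y th => k0%:E * H Y th)%E.
  by move=> d T u v mu_ mv; apply: emeasurable_funM; [exact: measurable_cst|exact: mH].
rewrite iintZl ?lee_fin ?nrm_ge0//; last 2 first.
- by move=> Y; exact: iint_ge0.
- by move=> d T u mu_; apply: (tmeas2_iint (enum G) kH0 mkH (u := u) (v := fun _ _ => 0)).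
rewrite cexpE muleC; congr (_ * _)%E.
rewrite iint_Fubini//; apply: eq_iint => th.
transitivity (iint (enum 'I_n) (fun Y => (wt F G th * h th)%:E *
    (\prod_(i < n) gauss (Y i - net th (X i)))%:E)%E (fun=> 0)).
  by apply: eq_iint => Y; rewrite prod_gauss_lik /H -!EFinM; congr EFin; ring.
rewrite iintZl ?iint_gauss ?mule1 ?EFinM//.
- by rewrite lee_fin mulr_ge0 ?wt_ge0.
- by move=> Y; rewrite lee_fin prodr_ge0// => i _; exact: gauss_ge0.
- move=> d T u mu_; apply/measurable_EFinP.
  have -> : (fun t => \prod_(i < n) gauss (u t i - net th (X i))) =
      (fun t => \prod_(i <- enum 'I_n) gauss (u t i - net th (X i))).
    by apply/funext => t; rewrite big_enum.
  apply: measurable_prod => i _; apply: measurableT_comp; first exact: measurable_gauss.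
  exact: measurable_funB.
Qed.

End Lik.
End Cexp.


(** * A finite grid for sparse parameter vectors *)

Section Cover.
Context {R : realType}.
Variables (I : finType) (r : nat) (B eta : R).

(** A list of pairs (coordinate, grid index) encodes both pattern and values; coordinates absent
    from the list take the default 0 of [nth]. *)
Definition grid_th (z : seq (I * 'I_r.+1)) (k : I) : R :=
  nth 0 [seq - B + eta * (x.2 : nat)%:R | x : I * 'I_r.+1 <- z] (index k [seq x.1 | x <- z]).

(** Values on [G] are rounded down to the grid. Since tuples also record the coordinates, their
    number (#|I| * r.+1)^#|G| accounts for the choice of the pattern as well. *)
Lemma grid_cover (G : {set I}) (th : I -> R) : 0 < eta -> 2 * B <= r%:R * eta -> 0 <= B ->
  (forall k, k \notin G -> th k = 0) -> (forall k, `|th k| <= B) ->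
  exists z : #|G|.-tuple (I * 'I_r.+1),
    forall k, `|th k - grid_th z k| <= eta /\ `|grid_th z k| <= B.
Proof.
move=> e0 rB B0 thG thB.
pose f k : 'I_r.+1 := inord (Num.trunc ((th k + B) / eta)).
have fP k : `|th k - (- B + eta * (f k)%:R)| <= eta /\ `|- B + eta * (f k)%:R| <= B.
  have := thB k; rewrite ler_norml => /andP[l u].
  have y0 : 0 <= (th k + B) / eta by rewrite divr_ge0 ?(ltW e0)//; lra.
  have /andP[tl tu] := Num.Theory.truncn_itv y0.
  have fE : (f k : nat) = Num.trunc ((th k + B) / eta).
    rewrite /f inordK// ltnS -(ler_nat R) (le_trans tl)// ler_pdivrMr//; lra.
  rewrite fE; set m := (Num.trunc _)%:R; rewrite -natr1 -/m in tu.
  have h1 : m * eta <= th k + B by rewrite -ler_pdivlMr.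
  have h2 : th k + B < (m + 1) * eta by rewrite -ltr_pdivrMr.
  have m0 : 0 <= m by [].
  split; rewrite ler_norml; apply/andP; split.
  - lra.
  - lra.
  - nra.
  - lra.

have sz : size [seq (k, f k) | k <- enum G] == #|G| by rewrite size_map -cardE.
exists (Tuple sz) => k; rewrite /grid_th/=.
have -> : [seq x.1 | x <- [seq (k, f k) | k <- enum G]] = enum G.
  by rewrite -map_comp map_id.
have -> : [seq - B + eta * (x.2 : nat)%:R | x : I * 'I_r.+1 <- [seq (k, f k) | k <- enum G]] =
    [seq - B + eta * (f k)%:R | k <- enum G] by rewrite -map_comp.
have [kG|kG] := boolP (k \in G).
  rewrite (nth_map k) ?index_mem ?mem_enum// nth_index ?mem_enum//.
have nk : (size [seq (- B + eta * (f k)%:R)%R | k <- enum G] <= index k (enum G))%N.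
  by rewrite size_map leqNgt index_mem mem_enum.
by rewrite (nth_default 0 nk) thG// subrr normr0 (ltW e0).
Qed.

End Cover.

(** * Nonnegative functions of the data with a prescribed Gaussian mean *)

Section Egf.
Context {R : realType}.
Variables (n : nat) (m : 'I_n -> R).

Definition gpdf (Y : 'I_n -> R) : R := \prod_(i < n) gauss (Y i - m i).

Lemma gpdf_ge0 Y : 0 <= gpdf Y.
Proof. by apply: prodr_ge0 => i _; exact: gauss_ge0. Qed.

(* [q] is nonnegative with mean [v] when the noise [Y - m] is standard Gaussian. *)
Definition egf (q : ('I_n -> R) -> R) (v : R) : Prop :=
  [/\ forall Y, 0 <= q Y, tmeas (fun Y => (gpdf Y * q Y)%:E) &
      iint (enum 'I_n) (fun Y => (gpdf Y * q Y)%:E) (fun=> 0) = v%:E].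

Lemma tmeas_gpdf : tmeas (fun Y => (gpdf Y)%:E).
Proof.
move=> d T u mu_; apply/measurable_EFinP.
have -> : (fun t => gpdf (u t)) = (fun t => \prod_(i <- enum 'I_n) gauss (u t i - m i)).
  by apply/funext => t; rewrite big_enum.
apply: measurable_prod => i _; apply: measurableT_comp; first exact: measurable_gauss.
exact: measurable_funB.
Qed.

Lemma egf_exp (a : R) (c : 'I_n -> R) : 0 <= a ->
  egf (fun Y => a * expR (\sum_i c i * (Y i - m i))) (a * expR (\sum_i c i ^+ 2 / 2)).
Proof.
move=> a0.
have E Y : (gpdf Y * (a * expR (\sum_i c i * (Y i - m i))))%:E =
    (a%:E * (gpdf Y * expR (\sum_i c i * (Y i - m i)))%:E)%E by rewrite -EFinM mulrCA.
have mE : tmeas (fun Y => (gpdf Y * expR (\sum_i c i * (Y i - m i)))%:E).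
  move=> d T u mu_; under eq_fun do rewrite EFinM.
  apply: emeasurable_funM; first exact: tmeas_gpdf.
  apply/measurable_EFinP; apply: measurableT_comp => //.
  apply: measurable_sum => i; apply: measurable_funM => //; exact: measurable_funB.
split.
- by move=> Y; rewrite mulr_ge0 ?expR_ge0.
- move=> d T u mu_; under eq_fun do rewrite E.
  by apply: emeasurable_funM; [exact: measurable_cst|exact: mE].
- transitivity (iint (enum 'I_n) (fun Y => a%:E * (gpdf Y * expR (\sum_i c i * (Y i - m i)))%:E)%E (fun=> 0)).
    by apply: eq_iint => Y; exact: E.
  rewrite iintZl ?lee_fin//; last by move=> Y; rewrite lee_fin mulr_ge0 ?gpdf_ge0 ?expR_ge0.
  by rewrite gauss_mgf -EFinM.
Qed.

Lemma egfD q q' v v' : egf q v -> egf q' v' -> egf (fun Y => q Y + q' Y) (v + v').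
Proof.
move=> [q0 mq iq] [q0' mq' iq']; split.
- by move=> Y; rewrite addr_ge0.
- have -> : (fun Y => (gpdf Y * (q Y + q' Y))%:E) = (fun Y => (gpdf Y * q Y)%:E + (gpdf Y * q' Y)%:E)%E.
    by apply/funext => Y; rewrite mulrDr EFinD.
  exact: tmeasD.
- rewrite EFinD -iq -iq' -iintD//.
  + by apply: eq_iint => Y; rewrite mulrDr EFinD.
  + by move=> Y; rewrite lee_fin mulr_ge0 ?gpdf_ge0.
  + by move=> Y; rewrite lee_fin mulr_ge0 ?gpdf_ge0.
Qed.

Lemma egf_sum (J : Type) (js : seq J) (q : J -> ('I_n -> R) -> R) (v : J -> R) :
  (forall j, egf (q j) (v j)) -> egf (fun Y => \sum_(j <- js) q j Y) (\sum_(j <- js) v j).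
Proof.
move=> H; elim: js => [|j js IH].
  rewrite big_nil; have -> : (fun Y => \sum_(j <- [::]) q j Y) = (fun Y => 0).
    by apply/funext => Y; rewrite big_nil.
  split=> //; first by move=> d T u mu_; under eq_fun do rewrite mulr0; exact: measurable_cst.
  by rewrite -[RHS](iint_cst0 (enum 'I_n) (fun=> 0)); apply: eq_iint => Y; rewrite mulr0.
rewrite big_cons; have -> : (fun Y => \sum_(j <- j :: js) q j Y) = (fun Y => q j Y + \sum_(j <- js) q j Y).
  by apply/funext => Y; rewrite big_cons.
exact: egfD.
Qed.

End Egf.

Lemma ler_sum_term (R : realType) (J : eqType) (s : seq J) (f : J -> R) j :
  (forall j, 0 <= f j) -> j \in s -> f j <= \sum_(i <- s) f i.
Proof.
move=> f0; elim: s => // i s IH; rewrite inE big_cons => /orP[/eqP <-|/IH h].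
  by rewrite lerDl sumr_ge0.
by rewrite (le_trans h)// lerDr.
Qed.

(** * Likelihood ratios and their stability under small changes of the function *)

Section LikRatio.
Context {R : realType}.
Variables (p n : nat) (X : 'I_n -> 'I_p -> R).
Implicit Types (f : ('I_p -> R) -> R) (Y : 'I_n -> R).

Lemma lik_ratio Y f0 f : lik X Y f = lik X Y f0 *
  expR (\sum_i (Y i - f0 (X i)) * (f (X i) - f0 (X i)) - \sum_i (f (X i) - f0 (X i)) ^+ 2 / 2).
Proof.
rewrite /lik -expRD -sumrB; congr expR; rewrite !mulr_sumr -big_split/=.
by apply: eq_bigr => i _; field.
Qed.

Variables (f0 : ('I_p -> R) -> R) (Y : 'I_n -> R) (b e0 : R).
Hypotheses (b1 : forall i, `|Y i - f0 (X i)| <= b) (e00 : 0 <= e0)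
  (be : n%:R * b * e0 <= 1) (ee : n%:R * e0 ^+ 2 <= 1).

Let cross f f' : (forall i, `|f (X i) - f' (X i)| <= e0) ->
  \sum_i (Y i - f0 (X i)) * (f (X i) - f0 (X i)) <=
  \sum_i (Y i - f0 (X i)) * (f' (X i) - f0 (X i)) + 1.
Proof.
move=> ff; rewrite -lerBlDl -sumrB (le_trans _ be)//.
apply: (@le_trans _ _ (\sum_(i < n) b * e0)).
  apply: ler_sum => i _; rewrite -mulrBr opprB addrA subrK.
  rewrite (le_trans (ler_norm _))// normrM ler_pM//.
by rewrite sumr_const card_ord -[leLHS]mulr_natl mulrA.
Qed.

(** The hypothesis is the Chernoff event at the grid function [f']. Replacing [f'] by the nearby [f]
    costs at most 1 in the cross term, as [be] bounds n b e0, and a bounded amount in the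
    squares. *)
Lemma lik_upper f f' t : (forall i, `|f (X i) - f' (X i)| <= e0) ->
  \sum_i (f' (X i) - f0 (X i)) / 2 * (Y i - f0 (X i)) <=
    \sum_i (f' (X i) - f0 (X i)) ^+ 2 / 8 + t / 2 ->
  lik X Y f <= lik X Y f0 * expR (- (\sum_i (f (X i) - f0 (X i)) ^+ 2) / 8 + t + 2).
Proof.
move=> ff h; rewrite (lik_ratio Y f0 f) ler_wpM2l ?(ltW (lik_gt0 _ _ _))// ler_expR.
have h1 := cross ff.
have -> : \sum_i (f (X i) - f0 (X i)) ^+ 2 / 2 = (\sum_i (f (X i) - f0 (X i)) ^+ 2) / 2.
  by rewrite mulr_suml.
(* The factor 3/2 leaves -1/2 + (1/4)(3/2) = -1/8 in front of the squared distance in the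
   exponent. *)
have h2 : \sum_i (f' (X i) - f0 (X i)) ^+ 2 <= 3 / 2 * \sum_i (f (X i) - f0 (X i)) ^+ 2 + 3.
  apply: (@le_trans _ _ (\sum_i (3 / 2 * (f (X i) - f0 (X i)) ^+ 2 + 3 * e0 ^+ 2))).
    apply: ler_sum => i _; have := ff i; rewrite ler_norml => /andP[? ?].
    set u := f (X i) - f0 (X i); set v := f (X i) - f' (X i) in ff *.
    have -> : f' (X i) - f0 (X i) = u - v by rewrite /u /v; ring.
    have v2 : v ^+ 2 <= e0 ^+ 2.
      by rewrite -(real_normK (num_real v)) lerXn2r ?nnegrE//; exact: ff.
    have := sqr_ge0 (u + 2 * v); nra.
  rewrite big_split/= -mulr_sumr lerD2l sumr_const card_ord -[leLHS]mulr_natl.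
  by rewrite mulrCA -[leRHS]mulr1 ler_wpM2l.
have h3 : \sum_i (Y i - f0 (X i)) * (f' (X i) - f0 (X i)) =
    2 * \sum_i (f' (X i) - f0 (X i)) / 2 * (Y i - f0 (X i)).
  by rewrite mulr_sumr; apply: eq_bigr => i _; field.
have h4 : \sum_i (f' (X i) - f0 (X i)) ^+ 2 / 8 = (\sum_i (f' (X i) - f0 (X i)) ^+ 2) / 8.
  by rewrite mulr_suml.
rewrite h3 in h1; rewrite h4 in h; lra.
Qed.

Lemma lik_lower f f' t : (forall i, `|f (X i) - f' (X i)| <= e0) ->
  - t <= \sum_i (Y i - f0 (X i)) * (f' (X i) - f0 (X i)) ->
  lik X Y f0 * expR (- (\sum_i (f' (X i) - f0 (X i)) ^+ 2) - t - 2) <= lik X Y f.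
Proof.
move=> ff h; rewrite (lik_ratio Y f0 f) ler_wpM2l ?(ltW (lik_gt0 _ _ _))// ler_expR.
have ff' i : `|f' (X i) - f (X i)| <= e0 by rewrite distrC.
have h1 := cross ff'.
have -> : \sum_i (f (X i) - f0 (X i)) ^+ 2 / 2 = (\sum_i (f (X i) - f0 (X i)) ^+ 2) / 2.
  by rewrite mulr_suml.
have h2 : \sum_i (f (X i) - f0 (X i)) ^+ 2 <= 2 * \sum_i (f' (X i) - f0 (X i)) ^+ 2 + 2.
  apply: (@le_trans _ _ (\sum_i (2 * (f' (X i) - f0 (X i)) ^+ 2 + 2 * e0 ^+ 2))).
    apply: ler_sum => i _; set u := f' (X i) - f0 (X i); set v := f (X i) - f' (X i).
    have -> : f (X i) - f0 (X i) = u + v by rewrite /u /v; ring.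
    have v2 : v ^+ 2 <= e0 ^+ 2.
      by rewrite -(real_normK (num_real v)) lerXn2r ?nnegrE//; exact: ff.
    have := sqr_ge0 (u - v); nra.
  rewrite big_split/= -mulr_sumr lerD2l sumr_const card_ord -[leLHS]mulr_natl.
  by rewrite mulrCA -[leRHS]mulr1 ler_wpM2l.
lra.
Qed.

End LikRatio.

(** * A nonasymptotic bound for the posterior probability *)

Section PosteriorBound.
Context {R : realType}.
Variables (p L n : nat) (lam lams F : R) (f0 fs : ('I_p -> R) -> R) (X : 'I_n -> 'I_p -> R).
Hypotheses (p0 : (0 < p)%N) (lam0 : 0 < lam) (lams0 : 0 < lams).
Variables (Nn sn r Tm : nat) (B eta e0 b t t1 D bd rho eps : R).
Local Notation Ix N := (Idx p (width p N) L).
Local Notation ep Y i := (Y i - f0 (X i)).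
Local Notation dl f i := (f (X i) - f0 (X i)).
Hypotheses (eta0 : 0 < eta) (B1 : 1 <= B) (rB : 2 * B <= r%:R * eta) (e00 : 0 <= e0).
Hypotheses (be : n%:R * b * e0 <= 1) (ee : n%:R * e0 ^+ 2 <= 1) (bd0 : 0 < bd) (eps0 : 0 < eps).
Hypothesis Hlip : forall N, (0 < N <= Nn)%N -> forall th th' : Ix N -> R,
  (forall k, `|th k| <= B) -> (forall k, `|th' k| <= B) -> (forall k, `|th k - th' k| <= eta) ->
  forall i, `|net th (X i) - net th' (X i)| <= e0.
Hypothesis HT : forall N, (0 < N <= Nn)%N -> (npar p L N * r.+1 <= Tm)%N.
Hypothesis Tm0 : (0 < Tm)%N.

(** The Chernoff variable of one grid function. The Gaussian mean of the second factor is the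
    exponential of the sum of squares over 8, so the whole has mean exp(-t/2); being below 1 is the
    hypothesis of [lik_upper], with strict inequality. *)
Definition chern (N s : nat) (z : s.-tuple (Ix N * 'I_r.+1)) (Y : 'I_n -> R) : R :=
  let f := net (grid_th B eta z) in
  expR (- (\sum_i dl f i ^+ 2) / 8 - t / 2) * expR (\sum_i dl f i / 2 * ep Y i).

(** For the signs 1 and -1, both values being below 1 means |Y_j - f0(X_j)| < b; the mean is exp(1/2
    - b). *)
Definition noise (sg : R) (j : 'I_n) (Y : 'I_n -> R) : R :=
  expR (- b) * expR (\sum_i sg * (i == j)%:R * ep Y i).

(** Being below 1 bounds the linear part of the log-likelihood ratio of the approximating function
    [fs] from below by -t1, as the denominator requires. *)
Definition center (Y : 'I_n -> R) : R :=
  expR (- t1) * expR (\sum_i - dl fs i * ep Y i).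

(* When this sum is below 1 none of the exceptional noise events occurs. *)
Definition exceptional (Y : 'I_n -> R) : R :=
  \sum_(N <- iota 1 Nn) \sum_(s <- iota 0 sn.+1)
     \sum_(z <- enum {: s.-tuple (Ix N * 'I_r.+1)}) chern z Y +
  (\sum_(j <- enum 'I_n) noise 1 j Y + \sum_(j <- enum 'I_n) noise (-1) j Y) + center Y.

Local Notation m0 := (fun i : 'I_n => f0 (X i)).
Local Notation G2 := (\sum_i dl fs i ^+ 2).

Lemma egf_eq (q : ('I_n -> R) -> R) v v' : v = v' -> egf m0 q v -> egf m0 q v'.
Proof. by move=> ->. Qed.

Lemma egf_exceptional : exists2 v, egf m0 exceptional v &
  v <= Nn%:R * sn.+1%:R * Tm%:R ^+ sn * expR (- t / 2) + 2 * n%:R * expR (1 / 2 - b) + expR (G2 / 2 - t1).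
Proof.
have cE N s (z : s.-tuple (Ix N * 'I_r.+1)) : egf m0 (chern z) (expR (- t / 2)).
  apply: (egf_eq _ (egf_exp _ _ (expR_ge0 _))); rewrite -expRD; congr expR.
  rewrite mulNr mulr_suml -sumrN addrAC -big_split/= big1 ?add0r ?mulNr// => i _; by field.
have nE sg j : sg ^+ 2 = 1 -> egf m0 (noise sg j) (expR (1 / 2 - b)).
  move=> sg1; apply: (egf_eq _ (egf_exp _ _ (expR_ge0 _))); rewrite -expRD; congr expR.
  rewrite (bigD1 j)//= eqxx big1 ?addr0; last first.
    by move=> i /negbTE ->; rewrite mulr0 expr0n mul0r.
  by rewrite mulr1 sg1 addrC.
have fE : egf m0 center (expR (G2 / 2 - t1)).
  apply: (egf_eq _ (egf_exp _ _ (expR_ge0 _))); rewrite -expRD; congr expR.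
  by rewrite addrC mulr_suml; congr (_ - _); apply: eq_bigr => i _; rewrite sqrrN.
eexists.
  apply: egfD; last exact: fE.
  apply: egfD.
    apply: egf_sum => N; apply: egf_sum => s; apply: egf_sum => z; exact: cE.
  apply: egfD; apply: egf_sum => j; apply: nE; rewrite ?sqrrN expr1n//.
rewrite lerD2r; apply: lerD; last first.
  rewrite !big_enum/= !sumr_const card_ord -mulr2n -[leLHS]mulr_natl -[_ *+ n]mulr_natl mulrA.
  by [].
set e := expR (- t / 2); have e1 : 0 <= e by exact: expR_ge0.
apply: (@le_trans _ _ (\sum_(N <- iota 1 Nn) sn.+1%:R * Tm%:R ^+ sn * e)); last first.
  by rewrite big_const_seq count_predT size_iota iter_addr addr0 -[leLHS]mulr_natl !mulrA.
rewrite big_seq [leRHS]big_seq; apply: ler_sum => N; rewrite mem_iota add1n ltnS => N1.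
apply: (@le_trans _ _ (\sum_(s <- iota 0 sn.+1) Tm%:R ^+ sn * e)); last first.
  by rewrite big_const_seq count_predT size_iota iter_addr addr0 -[leLHS]mulr_natl mulrA.
rewrite big_seq [leRHS]big_seq; apply: ler_sum => s; rewrite mem_iota add0n ltnS /= => s1.
rewrite big_enum/= sumr_const card_tuple card_prod card_ord -[leLHS]mulr_natl ler_wpM2r//.
rewrite -natrX ler_nat (@leq_trans (Tm ^ s)%N)//; last by rewrite leq_pexp2l.
by have [->|s0] := posnP s; rewrite ?expn0// leq_exp2r//; exact: HT.
Qed.

Hypothesis Hden : forall Y c, 0 <= c ->
  (forall f, (forall i, `|f (X i) - fs (X i)| <= e0) -> c <= lik X Y f) ->
  ((c * bd)%:E <= prior_int L lam lams F (fun f => (lik X Y f)%:E))%E.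
Hypothesis Hbad : (gsum lam lams (fun N s (G : {set Ix N}) =>
   if ((N <= Nn) && (s <= sn))%N then cexp F G (fun th => (bigtop B G th)%:E) else 1) <= rho%:E)%E.
Hypothesis Hsep : expR (- D / 8 + t + 2) <= eps / 2 * (bd * expR (- G2 - t1 - 2)).

(** Indicator of the parameters not reached by the grid: width or sparsity too large, or some top
    weight above [B]. *)
Definition bad N s (G : {set Ix N}) (th : Ix N -> R) : R :=
  if ((N <= Nn) && (s <= sn))%N then bigtop B G th else 1.

Lemma bad_ge0 N s G th : 0 <= @bad N s G th.
Proof. by rewrite /bad; case: (_ && _) => //; exact: bigtop_ge0. Qed.

Lemma bad_le1 N s G th : @bad N s G th <= 1.
Proof. by rewrite /bad /bigtop; case: ((N <= Nn) && (s <= sn))%N => //; rewrite -[1]/(1%:R) ler_nat leq_b1. Qed.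

Lemma measurable_bad N s (G : {set Ix N}) d (T : measurableType d) (u : T -> Ix N -> R) :
  (forall k, measurable_fun [set: T] (fun t => u t k)) ->
  measurable_fun [set: T] (fun t => bad s G (u t)).
Proof.
move=> mu_; rewrite /bad; case: ((N <= Nn) && (s <= sn))%N; last exact: measurable_cst.
exact: measurable_bigtop.
Qed.

Definition rest (Y : 'I_n -> R) : \bar R :=
  gsum lam lams (fun N s (G : {set Ix N}) => cexp F G (fun th => (bad s G th * lik X Y (net th))%:E)).

Lemma lik_ge0E N (Y : 'I_n -> R) (th : Ix N -> R) : (0 <= (lik X Y (net th))%:E)%E.
Proof. by rewrite lee_fin ltW// lik_gt0. Qed.

Lemma bad_lik_ge0 N s (G : {set Ix N}) (Y : 'I_n -> R) (th : Ix N -> R) :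
  (0 <= (bad s G th * lik X Y (net th))%:E)%E.
Proof. by rewrite lee_fin mulr_ge0 ?bad_ge0// ltW// lik_gt0. Qed.

Lemma rest_ge0 Y : (0 <= rest Y)%E.
Proof.
apply: gsum_ge0 => // N s G; apply: cexp_ge0 => th; exact: bad_lik_ge0.
Qed.

Lemma gsum_le1 (x : forall N : nat, nat -> {set Ix N} -> \bar R) : (forall N s G, 0 <= x N s G)%E ->
  (forall N s G, (0 < N)%N -> x N s G <= 1)%E -> (gsum lam lams x <= 1)%E.
Proof.
move=> x0 x1; apply: (@le_trans _ _ (gsum lam lams (fun N s (G : {set Ix N}) => (1 : R)%:E))).
  by apply: gsum_le => // N s G N0 _; exact: x1.
exact: gsum_cst.
Qed.

Lemma rest_le1 Y : (rest Y <= 1)%E.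
Proof.
apply: gsum_le1 => N s G; first by apply: cexp_ge0 => th; exact: bad_lik_ge0.
move=> N0; have [pw w0] := width_ge p0 N0.
apply: (@le_trans _ _ (cexp F G (fun=> (1 : R)%:E))).
  apply: cexp_le => [th|th _ _ _]; first exact: bad_lik_ge0.
  by rewrite lee_fin mulr_ile1 ?bad_ge0 ?bad_le1 ?lik_le1// ltW// lik_gt0.
exact: cexp_cst.
Qed.

Lemma rest_fin Y : rest Y \is a fin_num.
Proof. by rewrite ge0_fin_numE ?rest_ge0// (le_lt_trans (rest_le1 Y))// ltry. Qed.

Lemma mean_rest : (iint (enum 'I_n) (fun Y => (@k0 R n)%:E * rest Y) (fun=> 0%R) <= rho%:E)%E.
Proof.
rewrite /rest (@iint_gsum R p L lam lams lam0 _ (enum 'I_n) (fun=> 0) (fun=> @k0 R n)); last 4 first.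
- by move=> Y N s G; apply: cexp_ge0 => th; exact: bad_lik_ge0.
- by move=> _; exact: k0_ge0.
- exact: tmeas_cst.
- move=> N s G N0; have [pw w0] := width_ge p0 N0.
  apply: (@tmeas_cexp_lik R p (width p N) L pw w0 F n X G (bad s G)) => [th|d T v mv]; first exact: bad_ge0.
  exact: measurable_bad.
apply: le_trans Hbad; apply: gsum_le => // [N s G|N s G N0 _].
  apply: iint_ge0 => Y; rewrite mule_ge0 ?lee_fin ?k0_ge0//.
  by apply: cexp_ge0 => th; exact: bad_lik_ge0.
have [pw w0] := width_ge p0 N0.
rewrite (@fubini_lik R p (width p N) L pw w0 F n X G (bad s G)); last 2 first.
- by move=> th; exact: bad_ge0.
- by move=> d T v mv; exact: measurable_bad.
rewrite /bad; case: ((N <= Nn) && (s <= sn))%N => //; exact: cexp_cst.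
Qed.

Variable A : set (('I_p -> R) -> R).
Hypothesis HA : forall f, A f -> D <= \sum_i dl f i ^+ 2.

(** All summands of [exceptional] are nonnegative, so each is below 1, and the three kinds of events
    can be read off. *)
Lemma small_exceptional Y : exceptional Y < 1 ->
  [/\ forall i, `|ep Y i| <= b,
      forall N s (z : s.-tuple (Ix N * 'I_r.+1)), (0 < N <= Nn)%N -> (s <= sn)%N ->
        \sum_i dl (net (grid_th B eta z)) i / 2 * ep Y i <=
        \sum_i dl (net (grid_th B eta z)) i ^+ 2 / 8 + t / 2 &
      - t1 <= \sum_i ep Y i * dl fs i].
Proof.
have c0 N s z : 0 <= @chern N s z Y by rewrite mulr_ge0 ?expR_ge0.
have n0 sg j : 0 <= noise sg j Y by rewrite mulr_ge0 ?expR_ge0.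
have f0' : 0 <= center Y by rewrite mulr_ge0 ?expR_ge0.
have S1_0 : 0 <= \sum_(N <- iota 1 Nn) \sum_(s <- iota 0 sn.+1)
     \sum_(z <- enum {: s.-tuple (Ix N * 'I_r.+1)}) chern z Y.
  by apply: sumr_ge0 => N _; apply: sumr_ge0 => s _; apply: sumr_ge0 => z _.
have S2_0 sg : 0 <= \sum_(j <- enum 'I_n) noise sg j Y by apply: sumr_ge0 => j _.
have explt (x y : R) : expR x * expR y < 1 -> x + y < 0.
  by rewrite -expRD -[X in _ < X]expR0 ltr_expR.
rewrite /exceptional => ex.
have := S1_0; have := S2_0 1; have := S2_0 (-1) => a1 a2 a3.
split.
- have nz sg j : sg \in [:: 1; -1] -> noise sg j Y < 1 -> sg * ep Y j < b.
    move=> _ /explt; rewrite (bigD1 j)//= eqxx mulr1 big1 ?addr0; first by lra.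
    by move=> i /negbTE ->; rewrite mulr0 mul0r.
  move=> i; have h1 : noise 1 i Y < 1.
    have := @ler_sum_term R _ (enum 'I_n) (fun j => noise 1 j Y) i (n0 1) (mem_enum _ i); lra.
  have h2 : noise (-1) i Y < 1.
    have := @ler_sum_term R _ (enum 'I_n) (fun j => noise (-1) j Y) i (n0 (-1)) (mem_enum _ i); lra.
  have := nz 1 i (mem_head _ _) h1; have := nz (-1) i _ h2.
  rewrite !inE eqxx orbT => /(_ isT); rewrite ler_norml; lra.
- move=> N s z /andP[N0 NN] ss.
  have h : chern z Y < 1.
    have e1 := @ler_sum_term R _ (enum {: s.-tuple (Ix N * 'I_r.+1)}) (fun z => chern z Y) z (fun z => c0 _ _ z) (mem_enum _ z).
    have e2 := @ler_sum_term R _ (iota 0 sn.+1) (fun s => \sum_(z <- enum {: s.-tuple (Ix N * 'I_r.+1)}) chern z Y) s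
      (fun s => sumr_ge0 _ (fun z _ => c0 _ _ z)).
    have e3 := @ler_sum_term R _ (iota 1 Nn) (fun N => \sum_(s <- iota 0 sn.+1) \sum_(z <- enum {: s.-tuple (Ix N * 'I_r.+1)}) chern z Y) N
      (fun N => sumr_ge0 _ (fun s _ => sumr_ge0 _ (fun z _ => c0 _ _ z))).
    have {}e2 := e2 _; have {}e3 := e3 _.
    have := e2 (_ : s \in iota 0 sn.+1); rewrite mem_iota add0n ltnS ss => /(_ isT) e2'.
    have := e3 (_ : N \in iota 1 Nn); rewrite mem_iota add1n ltnS N0 NN => /(_ isT) e3'.
    lra.
  have := explt _ _ h; rewrite (mulr_suml _ _ _ (8^-1)) || idtac.
  have -> : \sum_i dl (net (grid_th B eta z)) i ^+ 2 / 8 = (\sum_i dl (net (grid_th B eta z)) i ^+ 2) / 8.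
    by rewrite mulr_suml.
  lra.
- have h : center Y < 1 by lra.
  have := explt _ _ h.
  have -> : \sum_i - dl fs i * ep Y i = - \sum_i ep Y i * dl fs i.
    by rewrite -sumrN; apply: eq_bigr => i _; ring.
  lra.
Qed.

(** A good parameter in [A] is rounded to a grid point, where the Chernoff event holds, and
    [lik_upper] bounds its likelihood; bad parameters are collected in [rest]. *)
Lemma numerator_le Y : exceptional Y < 1 ->
  (prior_int L lam lams F (fun f => (\1_A f * lik X Y f)%:E) <=
   (lik X Y f0 * expR (- D / 8 + t + 2))%:E + rest Y)%E.
Proof.
move=> /small_exceptional[h1 h2 _]; rewrite prior_intE.
set c := lik X Y f0 * expR (- D / 8 + t + 2).
have c0 : 0 <= c by rewrite mulr_ge0 ?expR_ge0// ltW// lik_gt0.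
have A0 f : (0 <= (\1_A f * lik X Y f)%:E)%E by rewrite lee_fin mulr_ge0// ltW// lik_gt0.
have A1 f : \1_A f * lik X Y f <= lik X Y f.
  by rewrite ler_piMl ?(ltW (lik_gt0 _ _ _))// indicE; case: (_ \in _).
apply: (@le_trans _ _ (gsum lam lams (fun N s (G : {set Ix N}) =>
    c%:E + cexp F G (fun th => (bad s G th * lik X Y (net th))%:E))%E)).
  apply: gsum_le => // [N s G|N s G N0].
    by apply: cexp_ge0 => th; exact: A0.
  rewrite /Gam inE => /andP[topG /eqP Gs].
  have [pw w0] := width_ge p0 N0.
  have mbl : tmeas (fun th => (bad s G th * lik X Y (net th))%:E).
    move=> d T u mu_; apply/measurable_EFinP; apply: measurable_funM; first exact: measurable_bad.
    by apply: (@measurable_lik R p (width p N) L n X d T (fun _ => Y) u) => // i; exact: measurable_cst.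
  apply: (@le_trans _ _ (cexp F G (fun th => c%:E + (bad s G th * lik X Y (net th))%:E)%E)).
    apply: cexp_le => [th|th thG sb th1]; first exact: A0.
    rewrite -EFinD lee_fin /bad.
    have [/andP[NN ss]|_] := boolP ((N <= Nn) && (s <= sn))%N; last first.
      by rewrite mul1r (le_trans (A1 _))// lerDr.
    rewrite /bigtop; have [_|/existsP nbt] := boolP [exists k in G, top k && (B < `|th k|)].
      by rewrite mul1r (le_trans (A1 _))// lerDr.
    rewrite mul0r addr0 indicE; case: (boolP (_ \in A)) => [|_]; last by rewrite mul0r.
    rewrite inE mul1r => /HA hD.
    have thB k : `|th k| <= B.
      have [kG|/thG ->] := boolP (k \in G); last by rewrite normr0 (le_trans _ B1).
      have [tk|tk] := boolP (top k); last by rewrite (le_trans (th1 k kG tk)).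
      rewrite leNgt; apply/negP => Bk; apply: nbt; exists k.
      by rewrite kG tk.
    have [z zP] := grid_cover eta0 rB (le_trans ler01 B1) thG thB.
    have z1 k : `|grid_th B eta z k| <= B by case: (zP k).
    have z2 k : `|th k - grid_th B eta z k| <= eta by case: (zP k).
    have NN' : (0 < N <= Nn)%N by rewrite N0.
    have ff := Hlip NN' thB z1 z2.
    have Gsn : (#|G| <= sn)%N by rewrite Gs.
    have := lik_upper h1 e00 be ee ff (h2 N _ z NN' Gsn).
    move=> /le_trans; apply; rewrite ler_wpM2l ?(ltW (lik_gt0 _ _ _))// ler_expR.
    lra.
  rewrite cexpD//; last by move=> th; exact: bad_lik_ge0.
  by apply: leeD; [exact: cexp_cst|exact: lexx].
rewrite gsumD//; last by move=> N s G; apply: cexp_ge0 => th; exact: bad_lik_ge0.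
by apply: leeD; [exact: gsum_cst|exact: lexx].
Qed.

(** The terms are the means of the grid, noise and centre events, followed by the bad prior mass
    divided by the lower bound for the denominator. *)
Theorem posterior_bound : (P0 X f0 [set Y | (eps < posterior L lam lams F X A Y)%R] <=
  (Nn%:R * sn.+1%:R * Tm%:R ^+ sn * expR (- t / 2) + 2 * n%:R * expR (1 / 2 - b) + expR (G2 / 2 - t1) +
   2 / (eps * (bd * expR (- G2 - t1 - 2))) * rho)%:E)%E.
Proof.
set cd := bd * expR (- G2 - t1 - 2); have cd0 : 0 < cd by rewrite mulr_gt0 ?expR_gt0.
set E := [set Y | _].
have [v [ex0 mex iex] vle] := egf_exceptional.
pose C := 2 / (eps * cd); have C0 : 0 < C by rewrite divr_gt0// mulr_gt0.
(* Pointwise domination of the indicator of [E] times the density. Integrating the right-hand side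
   is the union bound and Markov's inequality at once, and [E] need not be measurable. *)
have key Y : ((\1_E Y * \prod_(i < n) gauss (Y i - f0 (X i)))%:E <=
    (gpdf m0 Y * exceptional Y)%:E + C%:E * ((@k0 R n)%:E * rest Y))%E.
  have CR0 : (0 <= C%:E * ((@k0 R n)%:E * rest Y))%E.
    by rewrite mule_ge0 ?lee_fin ?(ltW C0)// mule_ge0 ?lee_fin ?k0_ge0// rest_ge0.
  have gE : \prod_(i < n) gauss (Y i - f0 (X i)) = gpdf m0 Y by [].
  rewrite gE indicE; case: (boolP (Y \in E)) => [|_]; last first.
    by rewrite mul0r adde_ge0// lee_fin mulr_ge0 ?gpdf_ge0.
  rewrite inE mul1r /E/= => YE.
  have [ex1|ex1] := leP 1 (exceptional Y).
    rewrite -[X in (X <= _)%E]adde0 leeD// lee_fin ler_peMr// gpdf_ge0//.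
  (* Without exceptional noise, [eps] times the denominator is below the numerator. By [Hsep] the
     grid part of the numerator accounts for at most half of the lower bound for that product, so
     [rest] exceeds the other half: the likelihood at [f0] is at most [C] times [rest]. *)
  suff h : ((gpdf m0 Y)%:E <= C%:E * ((@k0 R n)%:E * rest Y))%E.
    by rewrite -[X in (X <= _)%E]add0e leeD// lee_fin mulr_ge0 ?gpdf_ge0.
  rewrite -gE prod_gauss_lik -(fineK (rest_fin Y)) -!EFinM lee_fin.
  have l0 := lik_gt0 X Y f0.
  have num := numerator_le ex1; have [h1 _ h3] := small_exceptional ex1.
  have den : ((lik X Y f0 * cd)%:E <= prior_int L lam lams F (fun f => (lik X Y f)%:E))%E.
    have := @Hden Y (lik X Y f0 * expR (- G2 - t1 - 2)) _ _.
    rewrite /cd (mulrC bd) mulrA; apply; first by rewrite mulr_ge0 ?expR_ge0// ltW.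
    by move=> f ff; exact: (lik_lower h1 e00 be ee ff h3).
  have lik01 : (prior_int L lam lams F (fun f => (lik X Y f)%:E) <= 1)%E.
    rewrite prior_intE; apply: gsum_le1 => N s G.
      by apply: cexp_ge0 => th; exact: lik_ge0E.
    move=> N0; have [pw w0] := width_ge p0 N0.
    apply: (@le_trans _ _ (cexp F G (fun=> (1 : R)%:E))); last exact: cexp_cst.
    by apply: cexp_le => [th|th _ _ _]; rewrite ?lik_ge0E// lee_fin lik_le1.
  move: YE; rewrite /posterior; move: num den lik01.
  set a := prior_int _ _ _ _ _; set d := prior_int _ _ _ _ _ => num den lik01.
  have d0 : (0 <= d)%E by apply: le_trans den; rewrite lee_fin mulr_ge0 ?ltW.
  have df : d \is a fin_num by rewrite ge0_fin_numE// (le_lt_trans lik01)// ltry.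
  have a0 : (0 <= a)%E.
    rewrite /a prior_intE; apply: gsum_ge0 => // N s G; apply: cexp_ge0 => th.
    by rewrite lee_fin mulr_ge0// ltW// lik_gt0.
  have af : a \is a fin_num.
    rewrite ge0_fin_numE// (le_lt_trans num)// -(fineK (rest_fin Y)) -EFinD ltry//.
  move: num den; rewrite -(fineK af) -(fineK df) -{1}(fineK (rest_fin Y)) -EFinD !lee_fin /=.
  move=> num den; have dd : 0 < fine d by apply: lt_le_trans den; rewrite mulr_gt0.
  rewrite ltr_pdivlMr// => YE.
  set rr := fine (rest Y) in num *.
  have sep : lik X Y f0 * expR (- D / 8 + t + 2) <= lik X Y f0 * (eps / 2 * cd).
    by rewrite ler_wpM2l// ltW.
  have h4 : eps * (lik X Y f0 * cd) <= eps * fine d by rewrite ler_wpM2l// ltW.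
  have h5 : eps / 2 * (lik X Y f0 * cd) <= rr by lra.
  have ec0 : 0 < eps * cd by rewrite mulr_gt0.
  have h6 : lik X Y f0 <= C * rr.
    rewrite /C mulrAC ler_pdivlMr//; lra.
  by rewrite mulrC mulrCA ler_wpM2l ?k0_ge0.
have krest0 Y : (0 <= (@k0 R n)%:E * rest Y)%E by rewrite mule_ge0 ?lee_fin ?k0_ge0// rest_ge0.
have mrest : tmeas (fun Y => (@k0 R n)%:E * rest Y)%E.
  apply: tmeasM; first exact: tmeas_cst.
  apply: tmeas_gsum => // [Y' N s G|N s G N0].
    by apply: cexp_ge0 => th; exact: bad_lik_ge0.
  have [pw w0] := width_ge p0 N0.
  apply: (@tmeas_cexp_lik R p (width p N) L pw w0 F n X G (bad s G)) => [th|d T v0 mv]; first exact: bad_ge0.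
  exact: measurable_bad.
apply: (@le_trans _ _ (iint (enum 'I_n) (fun Y => (gpdf m0 Y * exceptional Y)%:E +
    C%:E * ((@k0 R n)%:E * rest Y))%E (fun=> 0))).
  apply: iint_le => [Y|Y _]; last exact: key.
  by rewrite lee_fin mulr_ge0// prodr_ge0// => i _; exact: gauss_ge0.
rewrite iintD//; last 3 first.
- by move=> Y; rewrite lee_fin mulr_ge0 ?gpdf_ge0.
- by move=> Y; rewrite mule_ge0 ?lee_fin ?(ltW C0).
- by apply: tmeasM => //; exact: tmeas_cst.
rewrite iex iintZl ?lee_fin ?(ltW C0)// EFinD leeD// ?lee_fin//.
by rewrite [leRHS]EFinM -/C lee_wpmul2l ?lee_fin ?(ltW C0)// mean_rest.
Qed.

End PosteriorBound.

(** * Numbers of parameters and of sparsity patterns *)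

Section Counting.
Variables p w L : nat.

Lemma card_Idx_le : (p <= w)%N -> (0 < w)%N -> (#|Idx p w L| <= L.+1 * (w * w.+1))%N.
Proof.
move=> pw w0; rewrite /Idx card_tagged sumnE big_map big_enum/=.
apply: (@leq_trans (\sum_(l : 'I_L.+1) w * w.+1)%N); last by rewrite sum_nat_const card_ord.
apply: leq_sum => l _; rewrite card_prod card_option !card_ord.
by apply: leq_mul; [exact: dim_leq_width|rewrite ltnS; exact: dim_leq_width].
Qed.

Lemma card_top : (0 < L)%N -> #|[set k : Idx p w L | top k]%SET| = w.+1.
Proof.
move=> L0.
have d1 : (0 < Defs.dim p w L (@ord_max L).+1)%N by rewrite /Defs.dim/= ltnn.
have d2 (j : 'I_w) : (j < Defs.dim p w L (@ord_max L))%N.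
  by rewrite /Defs.dim/= gtn_eqF// leqnn.
pose T0 := (fun l0 : 'I_L.+1 => ('I_(Defs.dim p w L l0.+1) * option 'I_(Defs.dim p w L l0))%type).
pose f (o : option 'I_w) : Idx p w L :=
  existT T0 ord_max (Ordinal d1, omap (fun j => Ordinal (d2 j)) o).
have fi : injective f.
  move=> o o' /(congr1 (fun k : Idx p w L => (val (tag k), val (tagged k).1, omap val (tagged k).2))).
  by case: o o' => [j|] [j'|] //= [] /val_inj ->.
have -> : [set k : Idx p w L | top k]%SET = imset f (mem (@predT (option 'I_w))).
  apply/setP => k; rewrite inE; apply/idP/imsetP => [tk|[ o _ ->]]; last by rewrite /top/= eqxx.
  case: k tk => [l [i j]]; rewrite /top/= => /eqP lL.
  have j_lt (j0 : 'I_(Defs.dim p w L l)) : (j0 < w)%N.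
    have e : Defs.dim p w L l = w by rewrite /Defs.dim lL gtn_eqF// leqnn.
    by rewrite -[leqRHS]e.
  exists (omap (fun j0 => Ordinal (j_lt j0)) j) => //.
  apply: vals_inj => /=; congr (_, _, _); first exact: lL.
    have e : Defs.dim p w L l.+1 = 1%N by rewrite /Defs.dim lL ltnn.
    have : (i < 1)%N by rewrite -[leqRHS]e.
    by rewrite ltnS leqn0 => /eqP ->.
  by case: j.
by rewrite card_imset// card_option card_ord.
Qed.

Lemma card_Gam_le s : (#|Gam p w L s| <= #|Idx p w L| ^ s)%N.
Proof.
apply: (@leq_trans 'C(#|Idx p w L|, s)).
  rewrite -card_draws; apply: subset_leq_card; apply/fintype.subsetP => G.
  by rewrite !inE => /andP[].
apply: (@leq_trans ('C(#|Idx p w L|, s) * s`!)); first by rewrite leq_pmulr// fact_gt0.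
rewrite bin_ffact ffact_prod -[s in (_ ^ s)%N]card_ord -prod_nat_const.
by apply: leq_prod => i _; exact: leq_subr.
Qed.

End Counting.

(** * Lower bounds for prior mass near a network and upper bounds for the bad set *)

Section PriorMass.
Context {R : realType}.
Variables (p L n : nat) (lam lams F : R) (X : 'I_n -> 'I_p -> R).
Hypotheses (p0 : (0 < p)%N) (lam0 : 0 < lam) (lams0 : 0 < lams).
Local Notation Ix N := (Idx p (width p N) L).

(** A lower bound common to both slab densities: 1/2 for the uniform on [-1,1], and the Gaussian
    density at [C1] for the top layer. *)
Definition densmin (C1 : R) : R := Num.min 2^-1 (expR (- C1 ^+ 2 / 2) / Num.sqrt (2 * pi)).

Lemma densmin_gt0 C1 : 0 < densmin C1.
Proof. by rewrite /densmin lt_min invr_gt0 ltr0n/= divr_gt0 ?expR_gt0 ?sqrt2pi_gt0. Qed.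

Lemma densmin_le1 C1 : densmin C1 <= 1.
Proof. by rewrite /densmin ge_min invf_le1// ler1n. Qed.

Lemma dens_lb w (k : Idx p w L) (C1 t : R) : 1 <= C1 -> (~~ top k -> `|t| <= 1) -> `|t| <= C1 ->
  densmin C1 <= dens k t.
Proof.
move=> C11 lo hi; rewrite /densmin /dens; case: (boolP (top k)) => tk.
  by rewrite ge_min gauss_lb ?orbT.
rewrite /udens indicE mem_set; first by rewrite mulr1 ge_min lexx.
by have := lo tk; rewrite /= in_itv/= ler_norml.
Qed.

(* A side of the interval is chosen so that it stays within any centred interval containing [x]. *)
Definition side (eta x : R) : R := if 0 <= x then x - eta else x.

Lemma sideP (eta x M t : R) : 0 <= eta -> eta <= M -> `|x| <= M -> side eta x <= t <= side eta x + eta ->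
  `|t - x| <= eta /\ `|t| <= M.
Proof.
move=> e0 eM; rewrite /side ler_norml => /andP[xl xu].
by case: ifP => x0 /andP[tl tu]; split; rewrite ler_norml; move: x0; try (move/negbT; rewrite -ltNge);
  move=> x0; apply/andP; split; lra.
Qed.

(** Within the pattern [G], a box of side [eta] whose points are within [eta] of [th0] gives
    networks within [e0] of [net th0]. The slack [e0] below [F] keeps them inside the truncated
    prior. *)
Lemma prior_mass N (th0 : Ix N -> R) (G : {set Ix N}) (C1 eta e0 : R) :
  (0 < N)%N -> 1 <= C1 -> 0 <= eta -> eta <= 1 -> 0 <= e0 ->
  (forall k, k \notin G -> th0 k = 0) -> (forall k, ~~ top k -> `|th0 k| <= 1) ->
  (forall k, top k -> `|th0 k| <= C1) -> [set k | top k] \subset G ->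
  (forall th, (forall k, `|th k| <= C1) -> (forall k, `|th k - th0 k| <= eta) ->
     forall x, cube x -> `|net th x - net th0 x| <= e0) ->
  (forall x, cube x -> `|net th0 x| + e0 <= F) -> (forall i, cube (X i)) ->
  forall Y c, 0 <= c ->
  (forall f, (forall i, `|f (X i) - net th0 (X i)| <= e0) -> c <= lik X Y f) ->
  ((c * (piN lam N * (piS p L lams N #|G| / #|Gam p (width p N) L #|G| |%:R) * (densmin C1 * eta) ^+ #|G|))%:E
     <= prior_int L lam lams F (fun f => (lik X Y f)%:E))%E.
Proof.
move=> N0 C11 eta0 eta1 e00 thG th1 thC tG lip thF cX Y c c0 cf.
have [pw w0] := width_ge p0 N0.
have thC' k : `|th0 k| <= C1.
  by have [/thC//|/th1 h] := boolP (top k); rewrite (le_trans h).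
have lik01 th : (0 <= (lik X Y (@net R p (width p N) L th))%:E <= 1)%E.
  by rewrite !lee_fin ltW ?lik_gt0// lik_le1.
have GG : G \in Gam p (width p N) L #|G| by rewrite /Gam inE tG eqxx.
have x0 N' (s : nat) (G' : {set Ix N'}) : (0 <= cexp F G' (fun th => (lik X Y (net th))%:E))%E.
  by apply: cexp_ge0 => th; rewrite lee_fin ltW// lik_gt0.
rewrite prior_intE.
apply: (le_trans _ (@gsum_term R p L lam lams lam0 (fun N s G => cexp F G (fun th => (lik X Y (net th))%:E))
   N #|G| G x0 (max_card _) GG)).
rewrite mulrCA EFinM lee_wpmul2l//.
  by rewrite lee_fin mulr_ge0 ?piN_ge0 // mulr_ge0 ?piS_ge0 // invr_ge0.
apply: (le_trans _ (cexp_lb F G lik01)).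
apply: (cint_box (b := fun k => side eta (th0 k))) => //.
- exact/ltW/densmin_gt0.
- by move=> th; rewrite lee_fin ltW// lik_gt0.
- move=> k t kG H; apply: dens_lb => //.
    by move=> tk; case: (sideP eta0 eta1 (th1 k tk) H).
  by case: (sideP eta0 (le_trans eta1 C11) (thC' k) H).
move=> th thGc thb.
have near k : `|th k - th0 k| <= eta /\ `|th k| <= C1.
  have [kG|kG] := boolP (k \in G); first by apply: (sideP eta0 (le_trans eta1 C11) (thC' k) (thb k kG)).
  by rewrite thGc// thG// subrr normr0 eta0 (le_trans ler01 C11).
have l1 := lip th (fun k => (near k).2) (fun k => (near k).1).
split.
  move=> x cx; rewrite -[net th x](subrK (net th0 x)) addrC.
  by rewrite (le_trans (ler_normD _ _))// (le_trans _ (thF x cx))// lerD2l l1.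
by rewrite lee_fin; apply: cf => i; exact/l1/cX.
Qed.

Lemma fact_leqX m : (m`! <= m ^ m)%N.
Proof.
rewrite fact_prod -[X in (_ <= _ ^ X)%N](subn1 m.+1) -prod_nat_const_nat.
by rewrite big_seq [leqRHS]big_seq; apply: leq_prod => i; rewrite mem_index_iota ltnS => /andP[].
Qed.

(** Crude counts suffice on the logarithmic scale: N! <= N^N, at most [T] terms of size at most 1 in
    the normaliser of the sparsity prior, and at most T^s patterns. *)
Lemma weight_lb N s (T : R) : (0 < N)%N -> ((width p N).+1 <= s <= npar p L N)%N -> (npar p L N)%:R <= T ->
  (0 < #|Gam p (width p N) L s|)%N ->
  lam ^+ N / ((expR lam - 1) * N%:R ^+ N) * (expR (- lams * s%:R) / T / T ^+ s) <=
  piN lam N * (piS p L lams N s / #|Gam p (width p N) L s|%:R).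
Proof.
move=> N0 sr nT g0; have /andP[ws sn] := sr.
have np0 : (0 < npar p L N)%N by exact: leq_trans (ltn0Sn _) (leq_trans ws sn).
have T0 : 0 < T by apply: lt_le_trans nT; rewrite ltr0n.
have e1 : 0 < expR lam - 1 by exact: expR_sub1_gt0.
have N0R : 0 < N%:R :> R by rewrite ltr0n.
apply: ler_pM.
- by rewrite divr_ge0 ?exprn_ge0 ?mulr_ge0 ?exprn_ge0// ltW.
- by rewrite !divr_ge0 ?expR_ge0 ?exprn_ge0// ltW.
- rewrite /piN gtn_eqF// ler_wpM2l ?exprn_ge0 ?(ltW lam0)// lef_pV2 ?posrE ?mulr_gt0 ?exprn_gt0 ?ltr0n ?fact_gt0//.
  by rewrite ler_pM2l// -natrX ler_nat fact_leqX.
- apply: ler_pM.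
  + by rewrite divr_ge0 ?expR_ge0// ltW.
  + by rewrite invr_ge0 exprn_ge0// ltW.
  + rewrite /piS sr ler_wpM2l ?expR_ge0// lef_pV2 ?posrE//; last first.
      rewrite big_ltn ?ltnS ?(leq_trans ws)// ltr_pwDl ?expR_gt0// sumr_ge0// => i _; exact: expR_ge0.
    apply: le_trans nT.
    apply: (@le_trans _ _ (\sum_((width p N).+1 <= s' < (npar p L N).+1) 1)).
      by apply: ler_sum => i _; rewrite -expR0 ler_expR mulNr oppr_le0 mulr_ge0// ltW.
    by rewrite sumr_const_nat ler_nat subSS leq_subr.
  + rewrite lef_pV2 ?posrE ?exprn_gt0 ?ltr0n//.
    rewrite (le_trans _ (_ : (npar p L N)%:R ^+ s <= _)) ?lerXn2r ?nnegrE ?(ltW T0)//.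
    by rewrite -natrX ler_nat card_Gam_le.
Qed.

(** Parameters in [0, eta] give networks close to the zero network, which satisfy the sup bound; so
    the normaliser is bounded below uniformly over patterns. *)
Lemma cint1_lb N (G : {set Ix N}) (eta : R) (s : nat) : (0 < N)%N -> 0 <= eta -> eta <= 1 ->
  (forall th : Ix N -> R, (forall k, `|th k| <= eta) -> forall x, cube x -> `|net th x| <= F) ->
  (#|G| <= s)%N -> (((densmin 1 * eta) ^+ s)%:E <= cint F G (fun=> 1))%E.
Proof.
move=> N0 eta0 eta1 H Gs.
apply: (@le_trans _ _ ((1 * (densmin 1 * eta) ^+ #|G|)%:E)).
  rewrite mul1r lee_fin ler_wiXn2l//.
    by rewrite mulr_ge0// ltW// densmin_gt0.
  by rewrite mulr_ile1 ?densmin_le1// ltW// densmin_gt0.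
apply: (cint_box (b := fun _ => 0)) => //.
- exact/ltW/densmin_gt0.
- move=> k t kG; rewrite add0r => /andP[t0 t1]; apply: dens_lb => //; rewrite ger0_norm ?(le_trans t1)//.
move=> th thG thb; split; last by [].
move=> x cx; apply: H => // k.
have [kG|kG] := boolP (k \in G); last by rewrite thG// normr0.
by have := thb k kG; rewrite add0r => /andP[t0 t1]; rewrite ger0_norm.
Qed.

Lemma gsum_cst_Ns (c : nat -> nat -> R) (tau : R) : 0 <= tau -> (forall N s, 0 <= c N s) ->
  (forall N, (0 < N)%N -> \sum_(s < (npar p L N).+1) piS p L lams N s * c N s <= tau) ->
  (gsum lam lams (fun N s (G : {set Ix N}) => (c N s)%:E) <= tau%:E)%E.
Proof.
move=> tau0 c0 H.
apply: (@le_trans _ _ (\sum_(N <oo) (piN lam N)%:E * tau%:E)%E); last first.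
  under eq_eseriesr do rewrite muleC.
  rewrite nneseriesZl; last by move=> N _; rewrite lee_fin piN_ge0.
  by rewrite -[leRHS]mule1 lee_wpmul2l ?lee_fin// sum_piN.
apply: lee_nneseries => [N _ _|N _].
  rewrite mule_ge0 ?lee_fin ?piN_ge0// (@gsum_mid_ge0 _ _ _ lams (fun N s _ => (c N s)%:E))// => s G.
  by rewrite lee_fin.
have [->|N0] := posnP N; first by rewrite /piN eqxx !mul0e.
rewrite lee_wpmul2l ?lee_fin ?piN_ge0//.
apply: (@le_trans _ _ (\sum_(s < (npar p L N).+1) (piS p L lams N s * c N s)%:E)%E).
  apply: lee_sum => s _; rewrite EFinM lee_wpmul2l ?lee_fin ?piS_ge0//.
  rewrite -ge0_sume_distrl; last by move=> G _; rewrite lee_fin invr_ge0.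
  by rewrite -[leRHS]mul1e lee_wpmul2r ?lee_fin// sum_Gam.
by rewrite sumEFin lee_fin H.
Qed.

(** The normaliser is at least its first term, the one for s = width + 1. Hence [sn] must exceed a
    multiple of the width for the tail to be small. *)
Lemma piS_tail N (sn : nat) : (0 < N)%N ->
  \sum_(s < (npar p L N).+1) piS p L lams N s * (sn < s)%N%:R <=
  (npar p L N).+1%:R * expR (- lams * (sn%:R - (width p N).+1%:R)).
Proof.
move=> N0.
apply: (@le_trans _ _ (\sum_(s < (npar p L N).+1) expR (- lams * (sn%:R - (width p N).+1%:R)))); last first.
  by rewrite sumr_const card_ord -[leLHS]mulr_natl.
apply: ler_sum => s _; case: ltnP => ss /=; last by rewrite mulr0 expR_ge0.
rewrite mulr1 /piS; case: ifP => [/andP[ws wn]|_]; last exact: expR_ge0.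
set Z := \sum_(_ <= _ < _) _.
have ZE : expR (- lams * (width p N).+1%:R) <= Z.
  rewrite /Z big_ltn ?ltnS ?(leq_trans ws)// lerDl sumr_ge0// => i _; exact: expR_ge0.
have Z0 : 0 < Z by apply: lt_le_trans ZE; exact: expR_gt0.
rewrite ler_pdivrMr// (le_trans _ (ler_wpM2l (expR_ge0 _) ZE))// -expRD ler_expR.
have : sn%:R <= (s : nat)%:R :> R by rewrite ler_nat ltnW.
by move=> /(ler_wpM2l (ltW lams0)) h; lra.
Qed.

(** The three terms treat large width, large sparsity and a large Gaussian weight; the last is
    divided by [b0] because the prior is conditioned on the sup bound. *)
Lemma bad_mass (Nn sn : nat) (B b0 Tm : R) : 0 <= B -> 0 < b0 -> 0 <= Tm ->
  (forall N (G : {set Ix N}), (0 < N <= Nn)%N -> (#|G| <= sn)%N -> (b0%:E <= cint F G (fun=> 1))%E) ->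
  (forall N, (0 < N <= Nn)%N -> (npar p L N).+1%:R <= Tm) ->
  (gsum lam lams (fun N s (G : {set Ix N}) =>
     if ((N <= Nn) && (s <= sn))%N then cexp F G (fun th => (bigtop B G th)%:E) else 1) <=
   (expR (lam * expR 1) / (expR lam - 1) * expR (- 1 * Nn%:R) +
    Tm * expR (- lams * (sn%:R - (width p Nn).+1%:R)) +
    sn%:R * (2 * expR (- B ^+ 2 / 2)) / b0)%:E)%E.
Proof.
move=> B0 b00 Tm0 cb Tb.
set c3 := sn%:R * (2 * expR (- B ^+ 2 / 2)) / b0.
have c30 : 0 <= c3 by rewrite divr_ge0 ?mulr_ge0 ?expR_ge0// ltW.
pose ind1 N : R := (Nn < N)%N%:R.
pose ind2 N s : R := ((0 < N <= Nn) && (sn < s))%N%:R.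
apply: (@le_trans _ _ (gsum lam lams (fun N s (G : {set Ix N}) => (ind1 N)%:E + (ind2 N s)%:E + c3%:E)%E)).
  apply: gsum_le => // [N s G|N s G N0].
    by case: ifP => _; [apply: cexp_ge0 => th; rewrite lee_fin bigtop_ge0|exact: lee01].
  rewrite /Gam inE => /andP[_ /eqP Gs]; have [pw w0] := width_ge p0 N0.
  rewrite /ind1 /ind2 N0 /= ltnNge (ltnNge sn).
  case: (boolP (N <= Nn)%N) => NN; case: (boolP (s <= sn)%N) => ss /=; rewrite -!EFinD ?lee_fin ?addr0 ?add0r ?lerDl//.
    have Gsn : (#|G| <= sn)%N by rewrite Gs.
    apply: (le_trans (cexp_bigtop B0 b00 (cb N G _ Gsn))); first by rewrite N0.
    rewrite lee_fin /c3 ler_wpM2r ?invr_ge0 ?(ltW b00)// ler_wpM2r ?mulr_ge0 ?expR_ge0//.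
    by rewrite ler_nat.
have i1 N (s : nat) (G : {set Ix N}) : (0 <= (ind1 N)%:E :> \bar R)%E by rewrite lee_fin.
have i2 N s (G : {set Ix N}) : (0 <= (ind2 N s)%:E :> \bar R)%E by rewrite lee_fin.
have i12 N s (G : {set Ix N}) : (0 <= (ind1 N)%:E + (ind2 N s)%:E :> \bar R)%E by apply: adde_ge0; [exact: i1|exact: i2].
have i3 N (s : nat) (G : {set Ix N}) : (0 <= c3%:E :> \bar R)%E by rewrite lee_fin.
rewrite (@gsumD _ _ _ lam lams lam0 _ (fun _ _ _ => c3%:E) i12 i3).
rewrite (@gsumD _ _ _ lam lams lam0 _ _ i1 i2).
rewrite !EFinD; apply: leeD; last exact: gsum_cst.
apply: leeD.
  apply: (le_trans (@gsum_cst_N R p L lam lams lam0 ind1 _)); first by move=> N.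
  exact: piN_tail.
apply: gsum_cst_Ns => //; first by rewrite mulr_ge0 ?expR_ge0.
move=> N N0; rewrite /ind2 N0/=.
case: (boolP (N <= Nn)%N) => NN /=; last first.
  by rewrite big1 ?mulr_ge0 ?expR_ge0// => s _; rewrite mulr0.
apply: (le_trans (piS_tail sn N0)).
apply: ler_pM; rewrite ?expR_ge0//; first by rewrite Tb// N0.
rewrite ler_expR !mulNr lerN2 ler_wpM2l ?(ltW lams0)// lerD2l lerN2 ler_nat ltnS.
by rewrite /width leq_mul2l NN orbT.
Qed.

End PriorMass.

(** * Approximating parameters of arbitrary large depth *)

Section NetApproximation.
Context {R : realType}.
Variable p : nat.
Local Notation X := ('I_p -> R).
Hypothesis p0 : (0 < p)%N.
Variables (q : nat -> nat) (Xs : forall n, 'I_n -> X) (a n1 : nat) (Ls : nat -> nat).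
Hypothesis q0 : forall n, (0 < q n)%N.
Hypothesis cX : forall n (i : 'I_n), cube (Xs i).
Hypothesis qa : forall n, (n1 <= n)%N -> (q n * n.+1 <= (q n ^ p) ^ a)%N.

(** The clipped approximation is carried up to depth [L] by identity layers. Besides its nonzero
    lower weights, the pattern [G] contains the whole top layer, as the prior demands. *)
Lemma net_approx (f0 : X -> R) (alpha F : R) : 0 < F -> alpha <= p%:R -> holder alpha f0 ->
  (forall x, cube x -> `|f0 x| <= F) ->
  exists (C : R) (d c n2 : nat), [/\ 1 <= C, (0 < c)%N & forall n L, (n2 <= n)%N -> (d < L)%N -> (0 < n)%N ->
    let K := (q n ^ p)%N in
    exists (th : Idx p (width p (c * K)) L -> R) (G : {set Idx p (width p (c * K)) L}),
    [/\ forall k, k \notin G -> th k = 0,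
        forall k, ~~ top k -> `|th k| <= 1,
        forall k, top k -> `|th k| <= C,
        [set k | top k] \subset G &
     [/\ (#|G| <= c * K + (L - d.+1) * (2 * (c * K)) + (width p (c * K)).+1)%N,
        forall x, `|net th x| <= F * (1 - n%:R^-1) &
        forall i : 'I_n, `|net th (Xs i) - f0 (Xs i)| <= C * (powR ((q n)%:R^-1) alpha + n%:R^-1)]]].
Proof.
move=> F0 ap hf f0F.
have [C [d [c [n2 [C0 HC]]]]] := holder_approx p0 q0 cX qa F0 ap hf f0F.
exists (1 + C + F), d, c.+1, n2; split => //; first by lra.
move=> n L nn dL n0 K.
have [Phi [h1 h2 h3]] := HC n nn.
have nR : 0 < n%:R :> R by rewrite ltr0n.
have n1R : n%:R^-1 <= 1 :> R by rewrite invf_le1// ler1n.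
have ni0 : 0 < n%:R^-1 :> R by rewrite invr_gt0.
(* Shrinking the output by 1 - 1/n leaves room F/n below the sup bound for perturbing the
   parameters, at the price of an extra error of at most F/n. *)
pose r : R := 1 - n%:R^-1.
have r0 : 0 <= r by rewrite subr_ge0.
have r1 : r <= 1 by rewrite gerBl ltW.
have cW : (c * K <= c.+1 * K)%N by rewrite leq_mul2r leqnSn orbT.
have Ww : (c.+1 * K <= width p (c.+1 * K))%N by rewrite /width leq_pmull// muln_gt0.
have EL : L = (d + (L - d.+1)).+1 by lia.
pose al (b : bool) := if b then C * r else - (C * r).
have Cr : C * r <= C by rewrite ler_piMr.
have Cr0 : 0 <= C * r by rewrite mulr_ge0.
have Fr : F * r <= F by rewrite ler_piMr// ltW.
have Fr0 : 0 <= F * r by rewrite mulr_ge0// ltW.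
have D0 : 0 <= 1 + C + F by lra.
have alD b : `|al b| <= 1 + C + F by rewrite /al; case: b; rewrite ?normrN ger0_norm//; lra.
have al0D : `|- (F * r)| <= 1 + C + F by rewrite normrN ger0_norm//; lra.
have [th [g1 g2 g3 g4]] := feat_net (feat_carry (L - d.+1) (feat_mono cW cW h1)) EL Ww D0 alD al0D.
have netE x : net th x = (C * Phi true x - C * Phi false x - F) * r.
  by rewrite g1 big_bool /al/=; ring.
pose T : {set Idx p (width p (c.+1 * K)) L} := [set k | top k]%SET.
pose S : {set Idx p (width p (c.+1 * K)) L} := [set k | ~~ top k & th k != 0]%SET.
exists th, (S :|: T)%SET; split => //.
- by move=> k; rewrite !inE => /norP[]; case: (top k) => //=; rewrite negbK => /eqP.
- apply/fintype.subsetP => k; rewrite !inE => tk; rewrite tk orbT//.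
split.
- apply: (leq_trans (leq_card_setU _ _)); rewrite /T card_top ?(leq_ltn_trans _ dL)//.
  by rewrite leq_add2r.
- by move=> x; rewrite netE normrM (ger0_norm r0) ler_wpM2r.
move=> i; rewrite netE.
set z := _ - F.
have -> : z * r - f0 (Xs i) = (z - f0 (Xs i)) - z * n%:R^-1 by rewrite /r; ring.
apply: (le_trans (ler_normB _ _)); rewrite mulrDr lerD//.
  by apply: (le_trans (h3 i)); rewrite ler_wpM2r ?powR_ge0//; lra.
rewrite normrM (ger0_norm (ltW ni0)) ler_wpM2r ?(ltW ni0)//.
by apply: (le_trans (h2 _)); lra.
Qed.

End NetApproximation.

(** * Exponentials with natural exponents *)

Section NatExponents.
Context {R : realType}.

(** Bounding every quantity by exp(-k) with k natural turns the final estimates into inequalities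
    between natural numbers. *)
Definition en (k : nat) : R := expR (- k%:R).

Lemma en_gt0 k : 0 < en k. Proof. exact: expR_gt0. Qed.
Lemma en_ge0 k : 0 <= en k. Proof. exact: expR_ge0. Qed.
Lemma enD j k : en (j + k) = en j * en k.
Proof. by rewrite /en natrD opprD expRD. Qed.
Lemma enM j k : en (j * k) = en j ^+ k.
Proof. by rewrite /en natrM -mulNr mulrC expRM_natl. Qed.
Lemma en_le j k : (k <= j)%N -> en j <= en k.
Proof. by move=> kj; rewrite /en ler_expR lerN2 ler_nat. Qed.
Lemma enV k : (en k)^-1 = expR k%:R.
Proof. by rewrite /en expRN invrK. Qed.
Lemma natr_le_enV k : k.+1%:R <= (en k)^-1.
Proof. by rewrite enV -natr1 addrC expR_ge1Dx. Qed.
Lemma en_le_inv k (x : R) : 0 < x -> x <= (en k)^-1 -> en k <= x^-1.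
Proof. by move=> x0 h; rewrite -[en k]invrK lef_pV2// posrE invr_gt0 en_gt0. Qed.

Lemma nat_between (x : R) : 1 <= x -> exists ksz : nat, x <= ksz%:R <= 2 * x.
Proof.
move=> x1; exists (Num.truncn x).+1; have x0 : 0 <= x by lra.
have /andP[h1 h2] := truncn_itv x0.
by rewrite ltW//= -natr1; lra.
Qed.

End NatExponents.

(** * Choice of mesh, cutoffs and deviation levels, for fixed n *)

Section Rate.
Context {R : realType}.
Variables (p n L K l : nat) (F lam lams : R) (f0 : ('I_p -> R) -> R) (X : 'I_n -> 'I_p -> R).
Variables (u c Cs aL CG CN CS : nat) (C1 : R).
Hypotheses (p0 : (0 < p)%N) (lam0 : 0 < lam) (lams0 : 0 < lams) (F0 : 0 < F) (C11 : 1 <= C1).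
Hypotheses (u1 : en u <= lam) (u2 : en u <= densmin C1) (u3 : en u <= densmin (1 : R)).
Hypotheses (u4 : lam <= u%:R) (u5 : lams <= u%:R).
Hypotheses (c0 : (0 < c)%N) (l0 : (0 < l)%N) (lK : (l <= K)%N) (nl : (n%:R : R) <= (en l)^-1).
Hypotheses (L0 : (0 < L)%N) (La : (L <= aL * l)%N) (C1n : C1 <= n%:R) (Fl : en (3 * l) <= F).
Hypothesis (cX : forall i, cube (X i)).

(** Makes L + 2 l (L + 1) + 4 l at most cE l^2 when L <= aL l: the logarithm of the Lipschitz
    constant plus the exponent of [tol]. *)
Definition cE := (3 * aL + 6)%N.
(** exp(cT l^2) bounds the number of parameters times the number of grid values. *)
Definition cT := (cE + aL + 7)%N.
Definition mesh := @en R (cE * l ^ 2).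
Definition tol := @en R (4 * l).
(** Order of the negative log prior mass: O(K l) parameters, each costing l^2 for its position and
    its precision. *)
Definition ksz := (K * l ^ 3)%N.
Definition cB := (u * c + u + c + u * Cs + (cT.+1 + cT.+1 * Cs) + u * Cs + cE * Cs)%N.
Definition cD := (cB + 2 * CG + 3)%N.
Local Notation Nn := (CN * ksz)%N.
Local Notation sn := (CS * ksz)%N.
Local Notation Ix N := (Idx p (width p N) L).
Hypotheses (cN : (c <= CN)%N) (wn : ((width p Nn).+1 <= n)%N) (sn1 : (sn.+1 <= n)%N).

Lemma n_gt0 : (0 < n)%N. Proof. exact: leq_ltn_trans wn. Qed.
Lemma n_ge1 : 1 <= n%:R :> R. Proof. by rewrite ler1n n_gt0. Qed.

Lemma l_le_ksz : (l <= ksz)%N.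
Proof. by rewrite /ksz expnS mulnCA leq_pmulr// muln_gt0 expn_gt0 l0 (leq_trans l0 lK). Qed.
Lemma l2_le_ksz : (l ^ 2 <= ksz)%N.
Proof. by rewrite /ksz (expnSr l 2) mulnCA leq_pmulr// muln_gt0 l0 (leq_trans l0 lK). Qed.
Lemma K_le_ksz : (K <= ksz)%N.
Proof. by rewrite /ksz leq_pmulr// expn_gt0 l0. Qed.
Lemma ksz_gt0 : (0 < ksz)%N. Proof. exact: leq_trans l0 l_le_ksz. Qed.

Lemma width_n N : (N <= Nn)%N -> ((width p N).+1 <= n)%N.
Proof. by move=> NN; apply: leq_trans wn; rewrite ltnS /width leq_mul2l NN orbT. Qed.

(** Width plus one and the parameter bound are at most n <= exp(l), so the Lipschitz constant is at
    most exp(L + 2 l (L + 1)) and is absorbed by [mesh]. *)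
Lemma lip_n N (th th' : Ix N -> R) x : (0 < N <= Nn)%N ->
  (forall k, `|th k| <= n%:R) -> (forall k, `|th' k| <= n%:R) -> (forall k, `|th k - th' k| <= mesh) ->
  cube x -> `|net th x - net th' x| <= tol.
Proof.
move=> /andP[N0 NN] h1 h2 h3 cx; have [pw w0] := width_ge p0 N0.
apply: (le_trans (@net_dist _ _ _ _ th th' x x n%:R mesh 0 pw w0 n_ge1 (en_ge0 _) (lexx _) h1 h2 h3 cx _)).
  by move=> j; rewrite subrr normr0.
rewrite addr0.
have a1 : L.+1%:R <= (en L)^-1 :> R by exact: natr_le_enV.
have a2 : ((width p N)%:R + 1) * n%:R <= (en (2 * l))^-1 :> R.
  rewrite mulnC enM expr2 invfM; apply: ler_pM => //.
  by rewrite natr1 (le_trans _ nl)// ler_nat width_n.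
have a3 : (((width p N)%:R + 1) * n%:R) ^+ L.+1 <= (en (2 * l * L.+1))^-1 :> R.
  by rewrite enM -exprVn lerXn2r// nnegrE ?invr_ge0 ?en_ge0// mulr_ge0// natr1.
apply: (@le_trans _ _ ((en L)^-1 * mesh * (en (2 * l * L.+1))^-1)).
  by apply: ler_pM => //; rewrite ?mulr_ge0 ?exprn_ge0 ?en_ge0 ?natr1// ler_wpM2r// en_ge0.
rewrite mulrAC -invfM -enD mulrC ler_pdivrMr ?en_gt0// /tol /mesh -enD; apply: en_le.
have b1 : (L <= aL * l ^ 2)%N by rewrite (leq_trans La)// leq_mul2l -[leqLHS]expn1 leq_pexp2l// orbT.
have b2 : (l * L <= aL * l ^ 2)%N by rewrite -mulnn mulnCA leq_mul2l La orbT.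
have b3 : (l <= l ^ 2)%N by rewrite -[leqLHS]expn1 leq_pexp2l.
rewrite /cE mulnDl; move: b1 b2 b3; rewrite -mulnA.
rewrite mulnS -mulnA; move: (aL * l ^ 2)%N (l ^ 2)%N (l * L)%N => z y lL.
by clear - l L y z lL; lia.
Qed.

Lemma npar_n N r : (0 < N <= Nn)%N -> r%:R <= 4 * n%:R / mesh ->
  ((npar p L N).+1 * r.+1)%:R <= (en (cT * l ^ 2))^-1 :> R.
Proof.
move=> /andP[N0 NN] rn; have [pw w0] := width_ge p0 N0.
have b3 : (l <= l ^ 2)%N by rewrite -[leqLHS]expn1 leq_pexp2l.
have a1 : ((npar p L N).+1 <= L.+1 * (n * n))%N.
  have wN := width_n NN.
  apply: (@leq_trans (L.+1 * (width p N * (width p N).+1) + L.+1 * (width p N).+1)%N); last first.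
    by rewrite -mulnDr leq_mul2l -mulSnr leq_mul.
  by rewrite -addn1 leq_add ?card_Idx_le// muln_gt0.
have a2 : r.+1%:R <= 5 * n%:R / mesh :> R.
  rewrite -natr1; have : 1 <= n%:R / mesh :> R.
    by rewrite ler_pdivlMr ?en_gt0// mul1r (le_trans _ n_ge1)// /mesh /en -expR0 ler_expR oppr_le0.
  by move=> h; move: rn; rewrite -!mulrA; lra.
rewrite natrM; apply: (@le_trans _ _ ((en L)^-1 * (en (2 * l))^-1 * (en 4)^-1 * (en l)^-1 * mesh^-1)); last first.
  rewrite -!invfM lef_pV2 ?posrE ?en_gt0 ?mulr_gt0 ?en_gt0// /mesh -!enD; apply: en_le.
  rewrite /cT !mulnDl; have := leq_mul (leqnn aL) b3.
  move: b3 La l0; rewrite /cE; move: (l ^ 2)%N (aL * l)%N => y z; move: (aL * y)%N => t; clear - l L y z t. lia.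
rewrite -!(mulrA ((en L)^-1 * _)) ; apply: ler_pM => //.
  rewrite (le_trans (_ : _ <= (L.+1 * (n * n))%:R))// ?ler_nat// natrM.
  apply: ler_pM => //; first exact: natr_le_enV.
  by rewrite natrM mulnC enM expr2 invfM ler_pM.
apply: (le_trans a2); rewrite ler_pM2r ?invr_gt0 ?en_gt0//.
by apply: ler_pM => //; exact: natr_le_enV.
Qed.

Variables (th0 : Ix (c * K) -> R) (G : {set Ix (c * K)}).
Hypotheses (thG : forall k, k \notin G -> th0 k = 0) (th1 : forall k, ~~ top k -> `|th0 k| <= 1).
Hypotheses (thC : forall k, top k -> `|th0 k| <= C1) (tG : [set k | top k] \subset G).
Hypotheses (Gs : (#|G| <= Cs * (K * l))%N) (thF : forall x, `|net th0 x| <= F * (1 - n%:R^-1)).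
Hypothesis thf : \sum_i (net th0 (X i) - f0 (X i)) ^+ 2 <= CG%:R * K%:R.

Lemma card_G : ((width p (c * K)).+1 <= #|G|)%N.
Proof.
rewrite -(card_top p (width p (c * K)) L0); apply: subset_leq_card.
by apply/fintype.subsetP => k; rewrite inE => tk; apply: (fintype.subsetP tG); rewrite inE.
Qed.

Definition mass : R :=
  piN lam (c * K) * (piS p L lams (c * K) #|G| / #|Gam p (width p (c * K)) L #|G| |%:R) *
  (densmin C1 * mesh) ^+ #|G|.

Variable Tm : nat.
Hypothesis T2 : Tm%:R <= (en (cT.+1 * l ^ 2))^-1 :> R.
Variable r : nat.
Hypothesis HT : forall N, (0 < N <= Nn)%N -> ((npar p L N).+1 * r.+1 <= Tm)%N.

Lemma TT N : (0 < N <= Nn)%N -> ((npar p L N).+1 <= Tm)%N.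
Proof. by move=> NN; apply: leq_trans (HT NN); rewrite leq_pmulr. Qed.

Lemma N0n : (0 < c * K <= Nn)%N.
Proof. by rewrite muln_gt0 c0 (leq_trans l0 lK)/= leq_mul// K_le_ksz. Qed.

Lemma mass_lb : en (cB * ksz) <= mass.
Proof.
have /andP[N0 NN] := N0n.
have g0 : (0 < #|Gam p (width p (c * K)) L #|G| |)%N.
  by apply/card_gt0P; exists G; rewrite /Gam inE tG eqxx.
have Gn : ((width p (c * K)).+1 <= #|G| <= npar p L (c * K))%N by rewrite card_G max_card.
have nT : (npar p L (c * K))%:R <= Tm%:R :> R by rewrite ler_nat (leq_trans (leqnSn _))// TT// N0n.
have T0 : 0 < Tm%:R :> R by rewrite ltr0n (leq_ltn_trans _ (TT N0n)).
have e1 : 0 < expR lam - 1 by exact: expR_sub1_gt0.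
have NR : 0 < (c * K)%:R :> R by rewrite ltr0n.
(* In order, the factors bound lam^N, the normaliser of the width prior, 1/N^N, the sparsity weight,
   its normaliser, the number of patterns and the mass of the box. *)
apply: (@le_trans _ _ (en (u * (c * K)) * (en u * en (l * (c * K))) *
   (en (u * #|G|) * en (cT.+1 * l ^ 2) * en (cT.+1 * l ^ 2 * #|G|)) * en ((u + cE * l ^ 2) * #|G|))).
  rewrite -!enD; apply: en_le.
  have mE : (l ^ 2 * (K * l))%N = ksz by rewrite /ksz !expnS; ring.
  have h1 : (K * l <= ksz)%N by rewrite -mE leq_pmull// expn_gt0 l0.
  have h2 : (#|G| <= Cs * ksz)%N by rewrite (leq_trans Gs)// leq_mul2l h1 orbT.
  have h3 : (l ^ 2 * #|G| <= Cs * ksz)%N by rewrite -mE mulnCA leq_mul2l Gs orbT.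
  have h4 : (l * (c * K) <= c * ksz)%N by rewrite mulnCA leq_mul2l (mulnC l) h1 orbT.
  have h5 := l2_le_ksz.
  rewrite /cB; move: h3 h5; move: cT.+1 cE (l ^ 2)%N => CT CE l2 h3 h5; rewrite !mulnDl -!mulnA !addnA.
  do !apply: leq_add; rewrite ?leq_mul2l ?K_le_ksz ?h1 ?h2 ?h3 ?h4 ?h5 ?orbT//.
  by rewrite leq_pmulr// ksz_gt0.
rewrite /mass; apply: ler_pM; rewrite ?mulr_ge0 ?en_ge0//.
  apply: le_trans (weight_lb lam0 lams0 N0 Gn nT g0).
  apply: ler_pM; rewrite ?mulr_ge0 ?en_ge0//.
    apply: ler_pM; rewrite ?mulr_ge0 ?en_ge0//.
      by rewrite enM lerXn2r ?nnegrE ?en_ge0// ltW.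
    rewrite invfM; apply: ler_pM; rewrite ?en_ge0//.
      apply: en_le_inv => //; rewrite enV lerBlDr (le_trans (_ : _ <= expR u%:R)) ?ler_expR// lerDl//.
    apply: en_le_inv; first by rewrite exprn_gt0.
    rewrite enM -exprVn lerXn2r ?nnegrE ?invr_ge0 ?en_ge0//.
    by rewrite (le_trans _ nl)// ler_nat (leq_trans _ (width_n NN))// leqW// /width leq_pmull// muln_gt0 p0.
  apply: ler_pM; rewrite ?mulr_ge0 ?en_ge0//.
    apply: ler_pM; rewrite ?mulr_ge0 ?en_ge0//; last exact: en_le_inv.
    by rewrite /en ler_expR natrM mulNr lerN2 ler_wpM2r.
  apply: en_le_inv; first by rewrite exprn_gt0.
  by rewrite enM -exprVn lerXn2r ?nnegrE ?invr_ge0 ?en_ge0.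
rewrite enM lerXn2r ?nnegrE ?mulr_ge0 ?en_ge0 ?(ltW (densmin_gt0 _))//.
by rewrite enD ler_wpM2r ?en_ge0.
Qed.


Hypothesis rB : 2 * n%:R <= r%:R * mesh.
Hypotheses (HCN : (cD.+1 <= CN)%N)
  (HCS : (cT + 2 + cD)%:R <= lams * (CS%:R - (12 * p * CN + 1)%:R))
  (Hn : (2 * ((u + cE * l ^ 2) * sn + cD * ksz + 2 * l + 1) <= n ^ 2)%N).

Definition b0 : R := (densmin 1 * mesh) ^+ sn.
Definition rho : R := expR (lam * expR 1) / (expR lam - 1) * expR (- 1 * Nn%:R) +
    Tm%:R * expR (- lams * (sn%:R - (width p Nn).+1%:R)) +
    sn%:R * (2 * expR (- n%:R ^+ 2 / 2)) / b0.
Definition cR : R := expR (lam * expR 1) / (expR lam - 1) + 2.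
Local Notation fs := (net th0).
Local Notation G2 := (\sum_i (fs (X i) - f0 (X i)) ^+ 2).
Local Notation t1 := (G2 / 2 + K%:R).

Lemma tol_le_F : tol <= F.
Proof. by apply: le_trans Fl; apply: en_le; rewrite leq_mul2r orbT. Qed.

Lemma mesh_le1 : mesh <= 1.
Proof. by rewrite /mesh /en -expR0 ler_expR oppr_le0. Qed.

Lemma b0_gt0 : 0 < b0.
Proof. by rewrite exprn_gt0// mulr_gt0 ?densmin_gt0 ?en_gt0. Qed.

Lemma bad_le :
  (gsum lam lams (fun N s (G : {set Ix N}) =>
     if ((N <= Nn) && (s <= sn))%N then cexp F G (fun th => (bigtop n%:R G th)%:E) else 1) <= rho%:E)%E.
Proof.
apply: (bad_mass p0 lam0 lams0 (ler0n _ _) b0_gt0 (ler0n _ _)).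
  move=> N G' NN Gs'; have /andP[N0 _] := NN; apply: cint1_lb => //; rewrite ?en_ge0 ?mesh_le1//.
  move=> th th_eta x cx; rewrite -[net th x]subr0 -(@net0 R p (width p N) L x).
  apply: le_trans tol_le_F; apply: lip_n => // k.
  - by rewrite (le_trans (th_eta k))// (le_trans mesh_le1)// n_ge1.
  - by rewrite normr0.
  - by rewrite subr0.
by move=> N NN; rewrite ler_nat TT.
Qed.

(** [HCN] makes the width tail, [HCS] the sparsity tail and [Hn] the Gaussian tail beyond n smaller
    than the denominator bound, each with a factor exp(-l) to spare. *)
Lemma rho_le : (en (cD * ksz))^-1 * rho <= cR * en l.
Proof.
have e1 : 0 < expR lam - 1 by exact: expR_sub1_gt0.
have mp := ksz_gt0.
have -> : cR * en l = expR (lam * expR 1) / (expR lam - 1) * en l + (en l + en l) by rewrite /cR mulrDl mulr_natl mulr2n.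
rewrite /rho; set x1 := (_ * expR (- 1 * _)); set x2 := (Tm%:R * _); rewrite 2!mulrDr -addrA.
apply: lerD; last apply: lerD; rewrite ?/x1 ?/x2.
- rewrite mulrCA ler_wpM2l ?divr_ge0 ?expR_ge0 ?(ltW e1)//.
  rewrite mulrC ler_pdivrMr ?en_gt0// mulN1r -/(en Nn) -enD; apply: en_le.
  apply: leq_trans (leq_mul HCN (leqnn ksz)); rewrite mulSn leq_add2r; exact: l_le_ksz.
- rewrite mulrC ler_pdivrMr ?en_gt0// mulrC.
  rewrite (le_trans (ler_wpM2l (expR_ge0 _) T2))// ler_pdivrMr ?en_gt0// -!enD /en ler_expR.
  rewrite mulNr lerN2.
  have s1 : (cT + 2 + cD)%:R * ksz%:R <= lams * (sn%:R - (width p Nn).+1%:R).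
    apply: (le_trans (ler_wpM2r (ler0n _ ksz) HCS)); rewrite -mulrA ler_wpM2l ?(ltW lams0)//.
    rewrite mulrBl -!natrM lerB// ler_nat mulnDl mul1n /width -[(12 * p * CN * ksz)%N]mulnA -addn1 leq_add2l; exact: ksz_gt0.
  apply: (le_trans _ s1); rewrite -natrM ler_nat.
  move: l_le_ksz l2_le_ksz; move: cT cD ksz (l ^ 2)%N => T D a y h1 h2; have h3 := leq_mul (leqnn T) h2.
  rewrite !mulnDl mulSn; move: h1 h2 h3; move: (T * y)%N (T * a)%N (D * a)%N => b1 b2 b3.
  clear - a y b1 b2 b3 l; lia.
- rewrite mulrC ler_pdivrMr ?en_gt0// ler_pdivrMr ?b0_gt0//.
  apply: (@le_trans _ _ (en l * en (cD * ksz) * en ((u + cE * l ^ 2) * sn))); last first.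
    rewrite ler_wpM2l ?mulr_ge0 ?en_ge0// enM lerXn2r ?nnegrE ?mulr_ge0 ?en_ge0 ?(ltW (densmin_gt0 _))//.
    by rewrite enD ler_wpM2r ?en_ge0.
  have s1 : sn%:R <= (en l)^-1 :> R by rewrite (le_trans _ nl)// ler_nat (leq_trans _ sn1).
  have s2 : 2 <= (en 1)^-1 :> R by exact: natr_le_enV.
  rewrite mulrA; apply: (@le_trans _ _ ((en l)^-1 * (en 1)^-1 * expR (- n%:R ^+ 2 / 2))).
    by rewrite ler_wpM2r ?expR_ge0//; apply: ler_pM.
  rewrite -invfM mulrC ler_pdivrMr ?mulr_gt0 ?en_gt0// -!enD /en ler_expR mulNr lerN2.
  rewrite ler_pdivlMr// -natrX -natrM ler_nat (leq_trans _ Hn)// mulnC leq_mul2l/=.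
  move: (cD * ksz)%N ((u + cE * l ^ 2) * sn)%N => a1 a2; clear - a1 a2 l; lia.
Qed.

Lemma mass_dev : en (cD * ksz) <= mass * expR (- G2 - t1 - 2).
Proof.
rewrite /cD -addnA mulnDl enD; apply: ler_pM; rewrite ?en_ge0 ?mass_lb//.
rewrite /en ler_expR natrM natrD natrM.
have h1 : K%:R <= ksz%:R :> R by rewrite ler_nat K_le_ksz.
have h2 : 1 <= ksz%:R :> R by rewrite ler1n ksz_gt0.
have h3 : CG%:R * K%:R <= CG%:R * ksz%:R :> R by rewrite ler_wpM2l.
have h4 : 0 <= CG%:R * K%:R :> R by rewrite mulr_ge0.
by move: thf h1 h2 h3 h4; set g := G2; move: (CG%:R * K%:R) => y; lra.
Qed.

Lemma mass_gt0 : 0 < mass.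
Proof. exact: lt_le_trans (en_gt0 _) mass_lb. Qed.

Lemma prior_mass_n Y z : 0 <= z ->
  (forall f, (forall i, `|f (X i) - fs (X i)| <= tol) -> z <= lik X Y f) ->
  ((z * mass)%:E <= prior_int L lam lams F (fun f => (lik X Y f)%:E))%E.
Proof.
have /andP[N0 _] := N0n.
apply: prior_mass => //; rewrite ?en_ge0 ?mesh_le1//.
- move=> th thC1 thd x cx; apply: (lip_n N0n) => // k; first exact: le_trans (thC1 k) C1n.
  apply: le_trans C1n; have [/thC//|/th1 h] := boolP (top k); exact: le_trans C11.
- move=> x _; rewrite (le_trans (lerD (thF x) (_ : _ <= F * n%:R^-1)))//; last first.
    by rewrite -mulrDr subrK mulr1.
  rewrite /tol (_ : 4 * l = 3 * l + l)%N ; last by rewrite (mulnDl 3 1) mul1n.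
  rewrite (enD (3 * l) l); apply: ler_pM; [exact: en_ge0|exact: en_ge0|exact: Fl|apply: en_le_inv nl].
  by rewrite ltr0n n_gt0.
Qed.

(** Twice the log-cardinality of the grid, sn log Tm = O(K l^3 l^2), with a margin; this level fixes
    the power of log n in the rate. *)
Definition tdev := (2 * ((cT.+1 * CS + 3) * (K * l ^ 5)))%N.

Lemma posterior_rate (eps D : R) (A : set (('I_p -> R) -> R)) : 0 < eps ->
  (forall f, A f -> D <= \sum_i (f (X i) - f0 (X i)) ^+ 2) ->
  expR (- D / 8 + tdev%:R + 2) <= eps / 2 * en (cD * ksz) ->
  (P0 X f0 [set Y | (eps < posterior L lam lams F X A Y)%R] <= ((4 + 2 / eps * cR) * en l)%:E)%E.
Proof.
move=> eps0 HA HD.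
have md := mass_dev.
(* Noise level b = 2 l + 1: the union over 2 n one-sided events then costs O(n exp(-2 l)), while n b
   stays far below 1/[tol]. *)
have be : n%:R * (2 * l).+1%:R * tol <= 1.
  rewrite -ler_pdivlMr ?en_gt0// mul1r /tol (_ : 4 * l = l + 3 * l)%N; last by rewrite (mulnDl 1 3) mul1n.
  rewrite (enD l (3 * l)) invfM; apply: ler_pM => //; apply: (le_trans (natr_le_enV _)).
  by rewrite lef_pV2 ?posrE ?en_gt0// en_le// leq_mul2r orbT.
have ee : n%:R * tol ^+ 2 <= 1.
  rewrite -ler_pdivlMr ?exprn_gt0 ?en_gt0// mul1r (le_trans nl)// lef_pV2 ?posrE ?exprn_gt0 ?en_gt0//.
  by rewrite -enM en_le// -mulnA (mulnC l) mulnA leq_pmull.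
have sep : expR (- D / 8 + tdev%:R + 2) <= eps / 2 * (mass * expR (- G2 - t1 - 2)).
  by apply: (le_trans HD); rewrite ler_wpM2l// divr_ge0// ltW.
apply: (le_trans (@posterior_bound R p L n lam lams F f0 fs X p0 lam0 Nn sn r Tm
  n%:R mesh tol (2 * l).+1%:R tdev%:R t1 D mass rho eps (en_gt0 _) n_ge1 rB (en_ge0 _) be ee mass_gt0 eps0
  _ _ _ prior_mass_n bad_le sep A HA)).
- by move=> N NN th th' h1 h2 h3 i; apply: lip_n.
- by move=> N NN; apply: leq_trans (HT NN); rewrite leq_mul2r leqnSn orbT.
- by apply: leq_trans (TT N0n).
rewrite lee_fin (_ : (4 + 2 / eps * cR) * en l = en l + 2 * en l + en l + 2 / eps * cR * en l); last by ring.
apply: lerD; first apply: lerD; first apply: lerD.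
- have h1 : Nn%:R <= (en l)^-1 :> R.
    rewrite (le_trans _ nl)// ler_nat (leq_trans _ wn)// leqW// /width leq_pmull// muln_gt0.
    by rewrite p0.
  have h2 : sn.+1%:R <= (en l)^-1 :> R by rewrite (le_trans _ nl)// ler_nat.
  have h3 : Tm%:R ^+ sn <= (en (cT.+1 * l ^ 2 * sn))^-1 :> R.
    by rewrite enM -exprVn lerXn2r ?nnegrE ?invr_ge0 ?en_ge0.
  have h4 : expR (- tdev%:R / 2) = en ((cT.+1 * CS + 3) * (K * l ^ 5)) :> R.
    by rewrite /en /tdev natrM mulNr mulrAC divff// mul1r.
  rewrite h4; apply: (@le_trans _ _ ((en l)^-1 * (en l)^-1 * (en (cT.+1 * l ^ 2 * sn))^-1 *
     en ((cT.+1 * CS + 3) * (K * l ^ 5)))).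
    rewrite ler_wpM2r ?en_ge0//; apply: ler_pM => //; rewrite ?mulr_ge0 ?exprn_ge0//.
    by apply: ler_pM.
  rewrite -!invfM mulrC ler_pdivrMr ?mulr_gt0 ?en_gt0// -!enD; apply: en_le.
  have mE : (l ^ 2 * ksz)%N = (K * l ^ 5)%N by rewrite /ksz mulnCA -expnD.
  have ll : (l <= K * l ^ 5)%N by rewrite -mE (leq_trans l_le_ksz)// leq_pmull// expn_gt0 l0.
  rewrite mulnDl (_ : cT.+1 * l ^ 2 * sn = cT.+1 * CS * (K * l ^ 5))%N; last by rewrite -mE; ring.
  move: (K * l ^ 5)%N ll => a2; move: (cT.+1 * CS * a2)%N => a1; clear - a1 a2 l; lia.
- rewrite -mulrA ler_pM2l//.
  apply: (@le_trans _ _ ((en l)^-1 * en (2 * l))).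
    by apply: ler_pM => //; rewrite ?expR_ge0// /en ler_expR -[(2 * l).+1%:R]natr1; lra.
  by rewrite mulrC ler_pdivrMr ?en_gt0// -enD en_le// mul2n addnn.
- rewrite opprD addNKr -/(en K).
  exact: en_le.
have r0 : 0 <= rho.
  rewrite -lee_fin (le_trans _ bad_le)// gsum_ge0// => N s G'; case: ifP => _; last exact: lee01.
  by apply: cexp_ge0 => th; rewrite lee_fin bigtop_ge0.
apply: (@le_trans _ _ (2 / eps * ((en (cD * ksz))^-1 * rho))).
  rewrite [leRHS]mulrA ler_wpM2r// invfM mulrA ler_wpM2l ?divr_ge0 ?(ltW eps0)//.
  by rewrite lef_pV2 ?posrE ?en_gt0// (lt_le_trans (en_gt0 _) md).
by rewrite -[leRHS]mulrA ler_wpM2l ?divr_ge0 ?(ltW eps0)// rho_le.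
Qed.

End Rate.

(** * Asymptotics in n of q, K and l *)

Section Growth.
Context {R : realType}.
Variables (p : nat) (alpha : R).
Hypotheses (a0 : 0 < alpha) (ap : alpha < p%:R).

Lemma ln_near (A : R) : \forall n \near \oo, A <= ln (n%:R : R).
Proof.
near=> n; have h : expR A <= n%:R by near: n; exact: nbhs_infty_ger.
by rewrite -[A]expRK ler_ln ?posrE ?expR_gt0// (lt_le_trans (expR_gt0 A) h).
Unshelve. all: by end_near. Qed.

Lemma exp_dom (a C : R) k : 0 < a -> exists Y : R, forall y, Y <= y -> C * y ^+ k <= expR (a * y).
Proof.
move=> ha; pose b := a / k.+1%:R; have b0 : 0 < b by rewrite divr_gt0.
exists (Num.max 1 (C / b ^+ k.+1)) => y; rewrite ge_max => /andP[y1 yC].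
have y0 : 0 <= y by lra.
have -> : a * y = k.+1%:R * (b * y) by rewrite /b mulrA [k.+1%:R * _]mulrC divfK// pnatr_eq0.
rewrite expRM_natl.
apply: (@le_trans _ _ ((b * y) ^+ k.+1)).
  rewrite exprMn [y ^+ k.+1]exprS mulrA ler_wpM2r ?exprn_ge0//.
  by rewrite mulrC -ler_pdivrMr ?exprn_gt0.
rewrite lerXn2r ?nnegrE ?expR_ge0 ?(mulr_ge0 (ltW b0) y0)//.
by rewrite (le_trans _ (expR_ge1Dx _))// lerDr.
Qed.

Definition kap : R := (2 * alpha + p%:R)^-1.
(** q is about n^(1/(2 alpha + p)), the value balancing n q^(-2 alpha) against K = q^p; the
    successor keeps it positive and above n^[kap]. *)
Definition qn (n : nat) : nat := (Num.truncn (expR (kap * ln (n%:R : R)))).+1.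
Definition lgn (n : nat) : nat := (Num.truncn (ln (n%:R : R))).+1.
Local Notation y n := (ln (n%:R : R)).
Local Notation K n := (qn n ^ p)%N.

Lemma den_gt0 : 0 < 2 * alpha + p%:R.
Proof. by have p0 := lt_trans a0 ap; rewrite addr_gt0 ?mulr_gt0. Qed.

Lemma kap_gt0 : 0 < kap.
Proof. by rewrite invr_gt0 den_gt0. Qed.

Lemma lnn_ge0 n : 0 <= y n.
Proof. by case: n => [|n]; [rewrite ln0|rewrite ln_ge0// ler1n]. Qed.

Lemma exp_lnn n : (0 < n)%N -> expR (y n) = n%:R.
Proof. by move=> n0; rewrite lnK// posrE ltr0n. Qed.

Lemma qn_ge n : expR (kap * y n) <= (qn n)%:R.
Proof. by have /andP[_ /ltW] := truncn_itv (expR_ge0 (kap * y n)). Qed.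

Lemma qn_le n : (qn n)%:R <= 2 * expR (kap * y n).
Proof.
have /andP[h _] := truncn_itv (expR_ge0 (kap * y n)).
have h1 : 1 <= expR (kap * y n) by rewrite -[leLHS]expR0 ler_expR mulr_ge0 ?(ltW kap_gt0)// lnn_ge0.
by rewrite /qn -natr1; lra.
Qed.

Lemma K_ge n : expR (p%:R * (kap * y n)) <= (K n)%:R.
Proof. by rewrite expRM_natl natrX lerXn2r ?nnegrE ?expR_ge0// qn_ge. Qed.

Lemma K_le n : (K n)%:R <= 2 ^+ p * expR (p%:R * (kap * y n)).
Proof. by rewrite expRM_natl natrX -exprMn lerXn2r ?nnegrE ?mulr_ge0 ?expR_ge0// qn_le. Qed.

Lemma lgn_ge n : y n <= (lgn n)%:R.
Proof. by have /andP[_ /ltW] := truncn_itv (lnn_ge0 n). Qed.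

Lemma lgn_le n : (lgn n)%:R <= y n + 1.
Proof. by have /andP[h _] := truncn_itv (lnn_ge0 n); rewrite /lgn -natr1; lra. Qed.

Lemma ln_qn n : y n <= (2 * alpha + p%:R) * ln (qn n)%:R.
Proof.
rewrite mulrC -ler_pdivrMr ?den_gt0// mulrC -/kap -[leLHS]expRK.
by rewrite ler_ln ?posrE ?expR_gt0 ?ltr0n// qn_ge.
Qed.

(** Slope K^7 suffices for the ramps: alpha < p gives n <= q^(3p), whence q (n + 1) <= q^(3p +
    2). *)
Lemma qn_pow n : (0 < n)%N -> (qn n * n.+1 <= K n ^ 7)%N.
Proof.
move=> n0; have q2 : (2 <= qn n)%N.
  rewrite /qn ltnS.
  have := truncn_itv (expR_ge0 (kap * y n)); case: (Num.truncn _) => [|//] /andP[_].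
  by rewrite ltNge -[leLHS]expR0 ler_expR mulr_ge0 ?(ltW kap_gt0) ?lnn_ge0.
have p0 : (0 < p)%N by rewrite -(ltr0n R) (lt_trans a0).
have nq : (n <= qn n ^ (3 * p))%N.
  rewrite -(ler_nat R) natrX -(exp_lnn n0) -[(qn n)%:R]lnK ?posrE ?ltr0n//.
  have h3 : 2 * alpha + p%:R <= 3%:R * p%:R.
    have -> : 3%:R = 2 + 1 :> R by rewrite natr1.
    by rewrite [leRHS]mulrDl mul1r lerD// ler_wpM2l// ltW.
  rewrite -expRM_natl ler_expR (le_trans (ln_qn n))// natrM ler_wpM2r//.
  by rewrite ln_ge0// ler1n.
rewrite -expnM; apply: (@leq_trans (qn n ^ (3 * p + 2))); last by rewrite leq_pexp2l//; lia.
rewrite addn2 expnS leq_mul2l expnS; apply/orP; right.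
apply: (@leq_trans (2 * qn n ^ (3 * p))); last by rewrite leq_mul2r q2 orbT.
by rewrite mul2n -addnn -addn1 leq_add// expn_gt0.
Qed.

Lemma bias_le n : (0 < n)%N -> n%:R * powR ((qn n)%:R^-1) alpha ^+ 2 <= (K n)%:R.
Proof.
move=> n0; have q0 : 0 < (qn n)%:R :> R by rewrite ltr0n.
rewrite /powR gt_eqF ?invr_gt0// -expRM_natl lnV ?posrE// -[in leLHS](exp_lnn n0) -expRD.
rewrite natrX -[in leRHS](@lnK _ (qn n)%:R)// -expRM_natl ler_expR.
by have := ln_qn n; lra.
Qed.

Lemma lgn_le_K : \forall n \near \oo, (lgn n <= K n)%N.
Proof.
have pk : 0 < p%:R * kap by rewrite mulr_gt0 ?kap_gt0// (lt_trans a0).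
have [Y HY] := exp_dom 2 1 pk.
near=> n; rewrite -(ler_nat R).
have y1 : 1 <= y n by near: n; exact: ln_near.
have yY : Y <= y n by near: n; exact: ln_near.
apply: le_trans (K_ge n); rewrite mulrA; apply: le_trans (HY _ yY); rewrite expr1.
by have := lgn_le n; lra.
Unshelve. all: by end_near. Qed.

Lemma lgn5 n : 1 <= y n -> ((K n * lgn n ^ 5)%N)%:R <= 2 ^+ p * 32 * y n ^+ 5 * expR (p%:R * (kap * y n)).
Proof.
move=> y1; rewrite natrM (natrX _ (lgn n)).
have -> : 2 ^+ p * 32 * y n ^+ 5 * expR (p%:R * (kap * y n)) =
  2 ^+ p * expR (p%:R * (kap * y n)) * (2 * y n) ^+ 5 by ring.
apply: ler_pM; [by []|exact: exprn_ge0|exact: K_le|].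
rewrite lerXn2r ?nnegrE ?mulr_ge0 ?lnn_ge0//; have := lgn_le n; lra.
Qed.

Lemma Kl5_near (A : nat) : \forall n \near \oo, (A * (K n * lgn n ^ 5) <= n)%N.
Proof.
have pk : 0 < 2 * alpha * kap by rewrite !mulr_gt0 ?kap_gt0.
have [Y HY] := exp_dom (A%:R * (2 ^+ p * 32)) 5 pk.
near=> n; rewrite -(ler_nat R).
have y1 : 1 <= y n by near: n; exact: ln_near.
have yY : Y <= y n by near: n; exact: ln_near.
have n0 : (0 < n)%N by near: n; exact: nbhs_infty_gt.
rewrite natrM -[leRHS](exp_lnn n0) (le_trans (ler_wpM2l (ler0n _ _) (lgn5 y1)))//.
have -> : expR (y n) = expR (2 * alpha * kap * y n) * expR (p%:R * (kap * y n)).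
  by rewrite -expRD; congr expR; rewrite /kap; field; rewrite gt_eqF// den_gt0.
by rewrite [leLHS]mulrA ler_wpM2r ?expR_ge0// [leLHS]mulrA HY.
Unshelve. all: by end_near. Qed.

(** With exponent 3, n xi^2 equals n^(p/(2 alpha + p)) (log n)^6, one logarithm more than K l^5;
    that logarithm absorbs every constant [A]. *)
Lemma xi_near (A : nat) : \forall n \near \oo, (A * (K n * lgn n ^ 5))%:R <=
  n%:R * (powR n%:R (- (alpha / (2 * alpha + p%:R))) * powR (y n) 3) ^+ 2.
Proof.
near=> n.
have y1 : 1 <= y n by near: n; exact: ln_near.
have yY : A%:R * (2 ^+ p * 32) <= y n by near: n; exact: ln_near.
have n0 : (0 < n)%N by near: n; exact: nbhs_infty_gt.
rewrite natrM (le_trans (ler_wpM2l (ler0n _ _) (lgn5 y1)))//.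
rewrite powR_mulrn ?lnn_ge0// /powR gt_eqF ?ltr0n// exprMn -expRM_natl -exprM.
rewrite -[X in _ <= X * _](exp_lnn n0) [leRHS]mulrA -expRD.
have -> : y n + 2 * (- (alpha / (2 * alpha + p%:R)) * y n) = p%:R * (kap * y n).
  by rewrite /kap; field; rewrite gt_eqF// den_gt0.
rewrite [leLHS]mulrA [leRHS]mulrC ler_wpM2r ?expR_ge0// [leRHS]exprS.
by rewrite [leLHS]mulrA ler_wpM2r ?exprn_ge0 ?lnn_ge0.
Unshelve. all: by end_near. Qed.

End Growth.

(** * Passage to the empirical norm and the final limit *)

Section Assembly.
Context {R : realType}.

Lemma nat_ge (x : R) : exists k : nat, x <= k%:R.
Proof.
exists (Num.truncn `|x|).+1; apply: le_trans (ler_norm x) _.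
by have /andP[_ /ltW] := truncn_itv (normr_ge0 x).
Qed.

Lemma en_le_ln (x : R) k : 0 < x -> `|ln x| <= k%:R -> en k <= x.
Proof.
move=> x0 h; rewrite -[leRHS]lnK ?posrE// /en ler_expR.
by rewrite lerNl (le_trans _ h)// -normrN ler_norm.
Qed.

Lemma en_eq_ln (k : nat) (x : R) : ln x <= k%:R -> 0 < x -> en k <= x^-1.
Proof. by move=> h x0; rewrite -[x]lnK ?posrE// -expRN /en ler_expR lerN2. Qed.

Lemma emp_norm_sum p n (X : 'I_n -> 'I_p -> R) (f0 f : ('I_p -> R) -> R) (M xi : R) : (0 < n)%N ->
  1 <= M -> 0 <= xi -> M * xi < emp_norm X (fun x => f x - f0 x) ->
  n%:R * xi ^+ 2 <= \sum_i (f (X i) - f0 (X i)) ^+ 2.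
Proof.
move=> n0 M1 xi0 /ltW h; have nR : 0 < n%:R :> R by rewrite ltr0n.
have S0 : 0 <= n%:R^-1 * \sum_i (f (X i) - f0 (X i)) ^+ 2.
  by rewrite mulr_ge0 ?sumr_ge0// => i _; exact: sqr_ge0.
have h1 : xi <= emp_norm X (fun x => f x - f0 x) by rewrite (le_trans _ h)// ler_peMl.
have : xi ^+ 2 <= emp_norm X (fun x => f x - f0 x) ^+ 2 by rewrite lerXn2r ?nnegrE ?sqrtr_ge0.
by rewrite /emp_norm sqr_sqrtr// ler_pdivlMl.
Qed.

Lemma bias_sum p n (X : 'I_n -> 'I_p -> R) (f0 f : ('I_p -> R) -> R) (C w K : R) :
  (0 < n)%N -> 0 <= w -> 1 <= K -> n%:R * w ^+ 2 <= K ->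
  (forall i, `|f (X i) - f0 (X i)| <= C * (w + n%:R^-1)) ->
  \sum_i (f (X i) - f0 (X i)) ^+ 2 <= 4 * C ^+ 2 * K.
Proof.
move=> n0 w0 K1 wK h; have nR : 0 < n%:R :> R by rewrite ltr0n.
have n1 : n%:R^-1 <= 1 :> R by rewrite invf_le1// ler1n.
apply: (@le_trans _ _ (\sum_(i < n) 2 * C ^+ 2 * (w ^+ 2 + n%:R^-1 ^+ 2))).
  apply: ler_sum => i _; rewrite -real_normK ?num_real//.
  have h2 := h i; have h0 := normr_ge0 (f (X i) - f0 (X i)).
  apply: (@le_trans _ _ ((C * (w + n%:R^-1)) ^+ 2)); first by rewrite lerXn2r// nnegrE (le_trans h0 h2).
  rewrite exprMn [2 * _ in leRHS]mulrC -[leRHS]mulrA ler_wpM2l ?sqr_ge0//.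
  by have := sqr_ge0 (w - n%:R^-1); rewrite sqrrB (sqrrD w); lra.
have hK : n%:R * (w ^+ 2 + n%:R^-1 ^+ 2) <= 2 * K.
  by rewrite mulrDr (expr2 n%:R^-1) [n%:R * (n%:R^-1 * _)]mulrA divff ?gt_eqF// mul1r; lra.
rewrite sumr_const card_ord -[leLHS]mulr_natl.
have -> : n%:R * (2 * C ^+ 2 * (w ^+ 2 + n%:R^-1 ^+ 2)) = 2 * C ^+ 2 * (n%:R * (w ^+ 2 + n%:R^-1 ^+ 2)) by ring.
have -> : 4 * C ^+ 2 * K = 2 * C ^+ 2 * (2 * K) by ring.
by apply: ler_wpM2l hK; rewrite mulr_ge0 ?sqr_ge0.
Qed.

End Assembly.

Theorem mainTheorem7 (R : realType) (p : nat) (alpha F lam lams : R)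
    (f0 : ('I_p -> R) -> R) (X : forall n : nat, 'I_n -> 'I_p -> R)
    (Lseq : nat -> nat) :
  0 < alpha -> alpha < p%:R -> 0 < F -> 0 < lam -> 0 < lams ->
  holder alpha f0 ->
  (forall x, cube x -> `|f0 x| <= F) ->
  (forall n i, cube (X n i)) ->
  (exists c1 c2 : R, [/\ 0 < c1, 0 < c2 &
     \forall n \near \oo, c1 * ln n%:R <= (Lseq n)%:R <= c2 * ln n%:R]) ->
  exists delta : R, 1 < delta /\
    forall M : nat -> R, (forall A : R, \forall n \near \oo, A < M n) ->
    forall eps : R, 0 < eps ->
      (fun n : nat =>
         P0 (X n) f0
           [set Y | eps < posterior (Lseq n) lam lams F (X n)
              [set f | M n * (powR n%:R (- (alpha / (2 * alpha + p%:R)))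
                              * powR (ln n%:R) delta)
                       < emp_norm (X n) (fun x => f x - f0 x)] Y])
      @ \oo --> (0 : \bar R).
Proof.
move=> a0 ap F0 lam0 lams0 hf f0F cX [c1 [c2 [c10 c20 HL]]].
exists 3; split; first by rewrite ltr1n.
move=> M HM eps eps0.
have p0 : (0 < p)%N by rewrite -(ltr0n R) (lt_trans a0).
have q0 n : (0 < qn p alpha n)%N by [].
have [C [d [c [n2 [C1 c0 HC]]]]] := net_approx p0 q0 cX (qn_pow a0 ap) F0 (ltW ap) hf f0F.
have [aL HaL] := nat_ge c2.
have [u Hu] := nat_ge (`|ln lam| + `|ln (densmin C)| + `|ln (densmin (1 : R))| + lam + lams).
have [CG HCG] := nat_ge (4 * C ^+ 2).
(* Nonzero parameters: [c] for the features, [2 * c * aL] for the identity layers, [12 * p * c + 1]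
   for the top layer. *)
pose Cs := (c + 2 * c * aL + 12 * p * c + 1)%N.
pose CD := cD u c Cs aL CG.
(* The constants are fixed in the order [CD], [CN], [CS]: the width cutoff must beat the denominator
   exponent, and the sparsity cutoff must beat that exponent and the width cutoff. *)
pose CN := (CD.+1 + c)%N.
have [CS HCS0] := nat_ge ((cT aL + 2 + CD)%:R / lams + (12 * p * CN + 1)%:R).
pose CC := (2 * (u * CS + cE aL * CS + CD + 3) + (12 * p * CN + 1) + (CS + 1))%N.
have [Z HZ] := nat_ge (ln (2 / eps)).
(* The factor 8 undoes D/8 in the exponent; [Z] absorbs 2/eps and [CD] the denominator. *)
pose AA := (8 * (2 * ((cT aL).+1 * CS + 3) + 2 + Z + CD))%N.
pose Cst := 4 + 2 / eps * cR lam.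
have HCS : (cT aL + 2 + CD)%:R <= lams * (CS%:R - (12 * p * CN + 1)%:R).
  by rewrite mulrC -ler_pdivrMr// lerBrDr.
have [h1 h2 h3] := And3 (normr_ge0 (ln lam)) (normr_ge0 (ln (densmin C))) (normr_ge0 (ln (densmin (1 : R)))).
have u1 : en u <= lam by apply: en_le_ln => //; lra.
have u2 : en u <= densmin C by apply: en_le_ln; [exact: densmin_gt0|lra].
have u3 : en u <= densmin (1 : R) by apply: en_le_ln; [exact: densmin_gt0|lra].
have [u4 u5] : lam <= u%:R /\ lams <= u%:R by split; lra.
have key : \forall n \near \oo, (P0 (X n) f0
           [set Y | (eps < posterior (Lseq n) lam lams F (X n)
              [set f | (M n * (powR n%:R (- (alpha / (2 * alpha + p%:R)))
                              * powR (ln n%:R) 3)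
                       < emp_norm (X n) (fun x => f x - f0 x))%R] Y)%R] <= (Cst * en (@lgn R n))%:E)%E.
  near=> n.
  have n0 : (0 < n)%N by near: n; exact: nbhs_infty_gt.
  have nn2 : (n2 <= n)%N by near: n; exact: nbhs_infty_ge.
  have lK : (@lgn R n <= qn p alpha n ^ p)%N by near: n; exact: lgn_le_K.
  have bigN : (CC * (qn p alpha n ^ p * @lgn R n ^ 5) <= n)%N by near: n; exact: Kl5_near.
  have xiN : (AA * (qn p alpha n ^ p * @lgn R n ^ 5))%:R <=
     n%:R * (powR n%:R (- (alpha / (2 * alpha + p%:R))) * powR (ln n%:R) 3) ^+ 2.
    by near: n; exact: xi_near.
  have M1 : 1 < M n by near: n; exact: HM.
  have /andP[L1 L2] : c1 * ln n%:R <= (Lseq n)%:R <= c2 * ln n%:R by near: n.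
  have Ld : d.+1%:R / c1 <= ln n%:R by near: n; exact: ln_near.
  have Cn : C <= n%:R by near: n; exact: nbhs_infty_ger.
  have Fn : `|ln F| <= ln n%:R by near: n; exact: ln_near.
  have y0 := @lnn_ge0 R n.
  have ly : ln n%:R <= (@lgn R n)%:R := lgn_ge n.
  have dL : (d < Lseq n)%N by rewrite -(ler_nat R) (le_trans _ L1)// mulrC -ler_pdivrMr.
  move: (Lseq n) L1 L2 dL => L L1 L2 dL.
  have La : (L <= aL * @lgn R n)%N.
    by rewrite -(ler_nat R) natrM (le_trans L2)//; apply: ler_pM => //; exact: ltW.
  have Fl : en (3 * @lgn R n) <= F.
    apply: en_le_ln => //; rewrite (le_trans Fn)// (le_trans ly)// ler_nat leq_pmull//.
  have nl : (n%:R : R) <= (en (@lgn R n))^-1 by rewrite enV -(exp_lnn n0) ler_expR.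
  have [th [G [thG th1 thC tG [Gs thF thf]]]] := HC n L nn2 dL n0.
  have bl := bias_le a0 ap n0.
  have lg0 : (0 < @lgn R n)%N by [].
  (* K and l become opaque numbers; from here on only the inequalities collected above are used. *)
  move: (qn p alpha n ^ p)%N (@lgn R n) lK bigN xiN ly La Fl nl th G thG th1 thC tG Gs thF thf bl lg0
    => K l lK bigN xiN ly La Fl nl th G thG th1 thC tG Gs thF thf bl lg0.
  have K0 : (0 < K)%N by exact: leq_trans lK.
  have k5 : (0 < K * l ^ 5)%N by rewrite muln_gt0 K0 expn_gt0 lg0.
  have mk : (ksz K l <= K * l ^ 5)%N by rewrite /ksz leq_mul2l leq_pexp2l ?orbT.
  have CCn x : (x <= CC)%N -> (x * (K * l ^ 5) <= n)%N.
    by move=> xC; apply: leq_trans bigN; rewrite leq_mul2r xC orbT.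
  have wn : ((width p (CN * ksz K l)).+1 <= n)%N.
    apply: leq_trans (CCn (12 * p * CN + 1)%N _); last by rewrite /CC -addnA addnCA leq_addr.
    by rewrite /width mulnA mulnDl mul1n -[leqLHS]addn1 leq_add// leq_mul2l mk orbT.
  have sn1 : ((CS * ksz K l).+1 <= n)%N.
    apply: leq_trans (CCn (CS + 1)%N _); last by rewrite /CC leq_addl.
    by rewrite mulnDl mul1n -[leqLHS]addn1 leq_add// leq_mul2l mk orbT.
  have Gs' : (#|G| <= Cs * (K * l))%N.
    apply: (leq_trans Gs); rewrite -[(width p (c * K)).+1]addn1 addnA.
    have -> : (Cs * (K * l) = c * (K * l) + 2 * c * aL * (K * l) + 12 * p * c * (K * l) + K * l)%N by rewrite /Cs; ring.
    have Kl : (K <= K * l)%N by rewrite leq_pmulr.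
    apply: leq_add; last by rewrite muln_gt0 K0.
    apply: leq_add; last by rewrite /width mulnA leq_mul2l Kl orbT.
    apply: leq_add; first by rewrite leq_mul2l Kl orbT.
    apply: (@leq_trans (aL * l * (2 * (c * K)))); first by rewrite leq_mul2r (leq_trans (leq_subr _ _) La) orbT.
    by apply/eq_leq; ring.
  have thf' : \sum_i (net th (X n i) - f0 (X n i)) ^+ 2 <= CG%:R * K%:R.
    apply: (le_trans (bias_sum n0 (powR_ge0 _ _) _ bl thf)); first by rewrite ler1n.
    by rewrite ler_wpM2r.
  have e0 : 0 < mesh l aL :> R by exact: en_gt0.
  have n1 : 1 <= n%:R :> R by rewrite ler1n.
  have [|r /andP[r1 r2]] := @nat_between R (2 * n%:R / mesh l aL).
    rewrite ler_pdivlMr// mul1r (le_trans (_ : _ <= 1))//; last by lra.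
    by rewrite -[leRHS]expR0 /mesh /en ler_expR oppr_le0.
  have [|Tm /andP[T1 T2]] := @nat_between R (en (cT aL * l ^ 2))^-1.
    by rewrite enV -[leLHS]expR0 ler_expR.
  have T2' : Tm%:R <= (en ((cT aL).+1 * l ^ 2))^-1 :> R.
    apply: (le_trans T2); rewrite mulSn enD invfM ler_wpM2r ?invr_ge0 ?en_ge0//.
    apply: (le_trans (natr_le_enV 1)); rewrite lef_pV2 ?posrE ?en_gt0// en_le//.
    by rewrite expn_gt0 lg0.
  have HT N : (0 < N <= CN * ksz K l)%N -> ((npar p L N).+1 * r.+1 <= Tm)%N.
    move=> NN; rewrite -(ler_nat R) (le_trans _ T1)//; apply: (npar_n p0 lg0 nl La wn NN).
    by rewrite (le_trans r2)// !mulrA; lra.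
  have rB : (2 * n%:R : R) <= r%:R * mesh l aL by rewrite -ler_pdivrMr.
  have Hn : (2 * ((u + cE aL * l ^ 2) * (CS * ksz K l) + CD * ksz K l + 2 * l + 1) <= n ^ 2)%N.
    apply: (@leq_trans n); last by rewrite -[leqLHS]expn1 leq_pexp2l.
    apply: leq_trans (CCn (2 * (u * CS + cE aL * CS + CD + 3))%N _); last by rewrite /CC -[leqRHS]addnA leq_addr.
    rewrite -mulnA leq_mul2l/= -addnA.
    have -> : ((u * CS + cE aL * CS + CD + 3) * (K * l ^ 5) = u * CS * (K * l ^ 5) + cE aL * CS * (K * l ^ 5) +
      CD * (K * l ^ 5) + (2 * (K * l ^ 5) + K * l ^ 5))%N by ring.
    apply: leq_add; last by rewrite leq_add// leq_mul2l (leq_trans lK)// leq_pmulr// expn_gt0 lg0.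
    rewrite mulnDl; apply: leq_add; last by rewrite leq_mul2l mk orbT.
    apply: leq_add; first by rewrite mulnA leq_mul2l mk orbT.
    by apply/eq_leq; rewrite /ksz; ring.
  have xi0 : 0 <= powR n%:R (- (alpha / (2 * alpha + p%:R))) * powR (ln n%:R) 3 by rewrite mulr_ge0 ?powR_ge0.
  apply: (posterior_rate p0 lam0 lams0 C1 u1 u2 u3 u4 u5 c0 lg0 lK nl (leq_ltn_trans (leq0n _) dL) La Cn
    Fl (cX n) _ wn sn1 thG th1 thC tG Gs' thF thf' T2' HT rB _ HCS Hn eps0
    (fun f => @emp_norm_sum R p n (X n) f0 f _ _ n0 (ltW M1) xi0)).
  - by rewrite /CN leq_addl.
  - by rewrite /CN leq_addr.
  have -> : eps / 2 = (2 / eps)^-1 by rewrite invfM invrK mulrC.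
  apply: (le_trans _ (ler_wpM2r (en_ge0 _) (en_eq_ln HZ (divr_gt0 (ltr0n _ 2) eps0)))).
  rewrite -enD /en ler_expR.
  set D := n%:R * _ in xiN *.
  have h : ((tdev K l aL CS + 2 + (Z + CD * ksz K l)) * 8 <= AA * (K * l ^ 5))%N.
    rewrite /AA -mulnA [leqLHS]mulnC leq_mul2l/= addnA.
    have -> : ((2 * ((cT aL).+1 * CS + 3) + 2 + Z + CD) * (K * l ^ 5) =
      tdev K l aL CS + 2 * (K * l ^ 5) + Z * (K * l ^ 5) + CD * (K * l ^ 5))%N by rewrite /tdev; ring.
    apply: leq_add; last by rewrite leq_mul2l mk orbT.
    apply: leq_add; last by rewrite leq_pmulr.
    by apply: leq_add; last by rewrite leq_pmulr.
  move: h; rewrite -(ler_nat R) natrM => /le_trans /(_ xiN).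
  by rewrite natrD (natrD _ (tdev _ _ _ _)); lra.
have lim0 : (fun n => (Cst * en (@lgn R n))%:E) @ \oo --> (0 : \bar R).
  apply: cvg_EFin; first by near=> n.
  rewrite -[0](mulr0 Cst); apply: cvgMr.
  apply/cvgrPdist_le => e e_gt0; near=> n.
  have n0 : (0 < n)%N by near: n; exact: nbhs_infty_gt.
  rewrite sub0r normrN ger0_norm ?en_ge0// -[leRHS]invrK.
  apply: (le_trans (_ : _ <= n%:R^-1)).
    by apply: en_le_inv; rewrite ?ltr0n// enV -(exp_lnn n0) ler_expR lgn_ge.
  rewrite lef_pV2 ?posrE ?invr_gt0 ?ltr0n//.
  by near: n; exact: nbhs_infty_ger.
(* The probability is squeezed between 0 and a multiple of exp(-[lgn n]), which is at most 1/n. *)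
apply: (squeeze_cvge _ (cvg_cst 0%E) lim0).
near=> n; apply/andP; split; last by near: n.
apply: iint_ge0 => Y; rewrite lee_fin mulr_ge0// prodr_ge0// => i _; exact: gauss_ge0.
Unshelve. all: by end_near. Qed.
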